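(* In the homogeneous Weibullian boundary-frontier setting described in the context, assume that the effective density $\omega$ extends continuously and boundedly to $\mathcal B\times[0,\varepsilon]$. (i) Suppose $\varrho=m+\zeta$ with $m\in\{0,1,2,\dots\}$, $0<\zeta<1$, and, uniformly on the collar, $$F(\varphi(t,u))=u^{m+1}\bigl(c(t)+u\,\mathcal R_{\mathrm{frac}}(t,u)\bigr),\qquad\inf_{t\in\mathcal B}c(t)>0,$$ where $c$ is continuous and $\mathcal R_{\mathrm{frac}}$ is bounded. Assume also that $\Phi\ge\delta>0$ on the complement of the collar in $\mathcal G$. Then, as $x\to\infty$, $$\mathbb P\{H(\boldsymbol\eta)>x\}=C_{\mathrm{frac}}z^{-1/(1-\zeta)}+o\bigl(z^{-1/(1-\zeta)}\bigr),\qquad C_{\mathrm{frac}}:=\frac{\Gamma(\lambda+1/(1-\zeta))}{\beta_F}\int_{\mathcal B}\omega(t,0)c(t)^{-1/(1-\zeta)}\,d\sigma_{\mathcal B}(t).$$ In particular, if $\omega(\cdot,0)$ is not identically zero, then $C_{\mathrm{frac}}>0$ and $\mathbb P\{H(\boldsymbol\eta)>x\}\sim C_{\mathrm{frac}}\,x^{-\beta_F/[\alpha_H(1-\zeta)]}$. (ii) Suppose $\varrho=m\in\{1,2,\dots\}$ and, uniformly on the collar, $$F(\varphi(t,u))=u^m\bigl(c_0(t)+u\,c_1(t)+O(u^2)\bigr),$$ with $c_0\in C^2(\mathcal B)$ and $c_1$ continuous. Assume that $c_0$ has a unique minimum at $t_0\in\mathcal B$ with $$\mu:=c_0(t_0)>0,\quad\nabla_{\mathcal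 B}c_0(t_0)=0,\quad\nabla^2_{\mathcal B}c_0(t_0)>0\ (\text{positive definite}),\quad c_1(t_0)>0,$$ and that for every sufficiently small neighborhood $V$ of $(t_0,0)$ in the collar there is $\delta>0$ with $\Phi\ge\mu+\delta$ on $\mathcal G\setminus\varphi(V)$. If $\omega(t_0,0)>0$, then, as $x\to\infty$, $$\mathbb P\{H(\boldsymbol\eta)>x\}\sim C_{\mathrm{integer}}\,z^{\lambda-1-D/2}e^{-\mu z},\qquad C_{\mathrm{integer}}:=\frac{(2\pi)^{(D-2)/2}}{\beta_F}\,\frac{\omega(t_0,0)\,\mu^{\lambda-1}}{c_1(t_0)\sqrt{\det(\nabla^2_{\mathcal B}c_0(t_0))}} .$$ For $D=2$ the determinant of the zero-dimensional Hessian and $(2\pi)^0$ are understood to be one. (Here $z=x^m$.)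
   Context: Setting. $D\ge2$; $\sigma$ is surface measure on $\mathbb S^{D-1}$; $\boldsymbol\eta$ is an $\mathbb R^D$-valued random vector with (normalized) density $p_{\boldsymbol\eta}(v)=A(v)e^{-F(v)}$, where $A\ge0$ and $F\ge0$ are positively homogeneous of orders $\beta_A\in\mathbb R$ and $\beta_F>0$, and $H:\mathbb R^D\to\mathbb R$ is positively homogeneous of order $\alpha_H>0$ (i.e. $A(r\theta)=r^{\beta_A}A(\theta)$, $F(r\theta)=r^{\beta_F}F(\theta)$, $H(r\theta)=r^{\alpha_H}H(\theta)$ for $r>0$, $\theta\in\mathbb S^{D-1}$); their restrictions to the sphere are measurable. Put $$\lambda:=\frac{D+\beta_A}{\beta_F}>0,\quad\varrho:=\frac{\beta_F}{\alpha_H},\quad z:=x^\varrho,\quad\mathcal G:=\{\theta\in\mathbb S^{D-1}:H(\theta)>0\},\quad\Phi(\theta):=\frac{F(\theta)}{H(\theta)^\varrho},\quad W(\theta):=\frac{A(\theta)}{F(\theta)^\lambda}\quad(\theta\in\mathcal G).$$ Standing assumptions: $F>0$ everywhere on $\mathcal G$, and $W\in L^1(\mathcal G,\sigma)$. Frontier. $\mathcal B$ is a compact smooth component of $\partial\mathcal G\subset\mathbb S^{D-1}$; $H|_{\mathbb S^{D-1}}$ is $C^2$ near $\mathcal B$ and its spherical differential does not vanish on $\mathcal B$. For some $\varepsilon>0$, $\varphi:\mathcal B\times[0,\varepsilon)\to\overline{\mathcal G}$ is a $C^1$ collar (product parametrization of a one-sided neighborhood of $\mathcal B$) with $\varphi(t,0)=t$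 and $H(\varphi(t,u))=u$. $\varepsilon$ may be decreased as needed. $\sigma_{\mathcal B}$ is the induced Riemannian measure on $\mathcal B$; $J$ is defined by $d\sigma(\varphi(t,u))=J(t,u)\,d\sigma_{\mathcal B}(t)\,du$, and $\omega(t,u):=W(\varphi(t,u))J(t,u)$. $\nabla_{\mathcal B},\nabla^2_{\mathcal B}$ are the gradient and Hessian on $\mathcal B$. $\Gamma(\cdot)$ is the gamma function.
   Formalization: In (i), the bound Φ ≥ δ > 0 off the collar is required for the collar of every width e in (0, ε] (δ depending on e), making ''ε may be decreased as needed'' explicit; for one fixed ε, c + u R_frac could approach 0 inside the collar and the claim would fail. *)

(* Defs.v *)
From HB Require Import structures.
From mathcomp Require Import all_boot all_order all_algebra.
From mathcomp Require Import all_classical all_reals all_analysis.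
From mathcomp Require Import measurable_realfun.

Set Implicit Arguments.
Unset Strict Implicit.
Unset Printing Implicit Defensive.

Import Order.TTheory GRing.Theory Num.Theory.
Import numFieldNormedType.Exports.

Local Open Scope classical_set_scope.
Local Open Scope ring_scope.

(* The sigma-algebra generated by the coordinates, which for T := R is the
   Borel sigma-algebra of R^n. *)

Definition measure_rV_display : measure_display -> measure_display.
Proof. exact. Qed.

Section measurable_rV.
Context {d} {T : measurableType d} (n : nat).

Let coords : 'I_n -> 'rV[T]_n -> T := fun i v => v ord0 i.

Let rV_set0 : g_sigma_preimage coords set0.
Proof. exact: sigma_algebra0. Qed.

Let rV_setC A : g_sigma_preimage coords A -> g_sigma_preimage coords (~` A).
Proof. exact: sigma_algebraC. Qed.

Let rV_bigcup (F : _^nat) : (forall i, g_sigma_preimage coords (F i)) ->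
  g_sigma_preimage coords (\bigcup_i F i).
Proof. exact: sigma_algebra_bigcup. Qed.

HB.instance Definition _ := @isMeasurable.Build (measure_rV_display d)
  'rV[T]_n (g_sigma_preimage coords) rV_set0 rV_setC rV_bigcup.

End measurable_rV.

Section measurable_rV_lemmas.
Context {d d'} {T : measurableType d} {S : measurableType d'}.

Lemma measurable_coord n (i : 'I_n) :
  measurable_fun [set: 'rV[T]_n] (fun v => v ord0 i).
Proof.
move=> _ Y mY; rewrite setTI; apply: sub_sigma_algebra => /=.
rewrite -bigcup_seq/=; exists i => /=; first by rewrite mem_index_enum.
by exists Y => //; rewrite setTI.
Qed.

Lemma measurable_fun_rV n (D : set S) (f : S -> 'rV[T]_n) :
  (forall i, measurable_fun D (fun x => f x ord0 i)) -> measurable_fun D f.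
Proof.
move=> mf mD; apply: (@measurability _ _ _ _ _ _ (
  \big[setU/set0]_(i < n)
    preimage_set_system setT (fun v : 'rV[T]_n => v ord0 i) measurable)) => //.
move=> _ [B + <-]; rewrite -bigcup_seq => -[i _ [A mA <-]].
by rewrite setTI; exact: mf.
Qed.

End measurable_rV_lemmas.

Section lebesgue_rV.
Context {R : realType}.

Definition cons_rV n (p : measurableTypeR R * 'rV[R]_n) :
    'rV[R]_n.+1 :=
  \row_i (if unlift ord0 i is Some j then p.2 ord0 j else p.1).

Definition uncons_rV n (v : 'rV[R]_n.+1) :
    measurableTypeR R * 'rV[R]_n :=
  (v ord0 ord0, \row_i v ord0 (lift ord0 i)).

Lemma cons_rVK n : cancel (@cons_rV n) (@uncons_rV n).
Proof.
move=> [x v]; rewrite /uncons_rV !mxE unlift_none; congr (_, _).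
by apply/rowP => i; rewrite !mxE liftK.
Qed.

Lemma measurable_cons_rV n : measurable_fun setT (@cons_rV n).
Proof.
apply: measurable_fun_rV => i; rewrite (_ : (fun x => _) = fun p : measurableTypeR R * 'rV[R]_n =>
    if unlift ord0 i is Some j then p.2 ord0 j else p.1); last first.
  by apply/funext => p; rewrite mxE.
case: (unliftP ord0 i) => [j|] _; last exact: measurable_fst.
exact: (measurableT_comp (measurable_coord j)).
Qed.

Lemma measurable_uncons_rV n : measurable_fun setT (@uncons_rV n).
Proof.
apply: measurable_fun_pair => /=; first exact: measurable_coord.
apply: measurable_fun_rV => i; rewrite (_ : (fun x => _) =
    fun v : 'rV[R]_n.+1 => v ord0 (lift ord0 i)); last first.
  by apply/funext => v; rewrite mxE.
exact: measurable_coord.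
Qed.

Section step.
Variables (n : nat) (mu : {sigma_finite_measure set 'rV[R]_n -> \bar R}).

HB.instance Definition _ := isMeasurableFun.Build _ _ _ _ (@cons_rV n)
  (@measurable_cons_rV n).

Definition lebesgue_step : set 'rV[R]_n.+1 -> \bar R :=
  pushforward (lebesgue_measure \x mu)%E (@cons_rV n).

Let step0 : lebesgue_step set0 = 0%E.
Proof. exact: measure0. Qed.

Let step_ge0 A : (0 <= lebesgue_step A)%E.
Proof. exact: measure_ge0. Qed.

Let step_sigma_additive : semi_sigma_additive lebesgue_step.
Proof. exact: measure_semi_sigma_additive. Qed.

HB.instance Definition _ := isMeasure.Build _ _ _ lebesgue_step
  step0 step_ge0 step_sigma_additive.

Let step_sigma_finite : sigma_finite setT lebesgue_step.
Proof.
have /sigma_finiteP[F [TF ndF Foo]] := sigma_finiteT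
  (lebesgue_measure : {sigma_finite_measure set (measurableTypeR R) -> \bar R}).
have /sigma_finiteP[G [TG ndG Goo]] := sigma_finiteT mu.
exists (fun k => @uncons_rV n @^-1` (F k `*` G k)).
  rewrite -preimage_bigcup (_ : \bigcup_k _ = setT) ?preimage_setT//.
  rewrite -setXTT TF TG; apply/seteqP; split=> [[x y] [k _ [? ?]]|[x y]].
    by split; exists k.
  move=> [[/= k _ Fkx] [l _ Gly]]; exists (maxn k l) => //; split.
    by move: x Fkx; exact/subsetPset/ndF/leq_maxl.
  by move: y Gly; exact/subsetPset/ndG/leq_maxr.
move=> k; have [mF Fk] := Foo k; have [mG Gk] := Goo k; split.
  rewrite -[X in measurable X]setTI; apply: measurable_uncons_rV => //.
  exact: measurableX.
rewrite /lebesgue_step /pushforward -comp_preimage (_ : _ \o _ = id).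
  by rewrite preimage_id product_measure1E// lte_mul_pinfty// ge0_fin_numE.
by apply/funext => p /=; rewrite cons_rVK.
Qed.

HB.instance Definition _ := Measure_isSigmaFinite.Build _ _ _ lebesgue_step
  step_sigma_finite.

End step.

Fixpoint lebesgue_rV n : {sigma_finite_measure set 'rV[R]_n -> \bar R} :=
  match n return {sigma_finite_measure set 'rV[R]_n -> \bar R} with
  | 0 => \d_(0 : 'rV[R]_0)
  | n'.+1 => lebesgue_step (lebesgue_rV n')
  end.

End lebesgue_rV.

Section surface_measure.
Context {R : realType} (n : nat).

Definition dotmul (u v : 'rV[R]_n) : R := (u *m v^T) ord0 ord0.

Definition enorm (v : 'rV[R]_n) : R := Num.sqrt (dotmul v v).

Definition sphere : set 'rV[R]_n := [set v | enorm v = 1].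

Definition punctured_ball : set 'rV[R]_n := [set v | 0 < enorm v <= 1].

Definition radial (v : 'rV[R]_n) : 'rV[R]_n := (enorm v)^-1 *: v.

Lemma measurable_enorm : measurable_fun setT enorm.
Proof.
rewrite (_ : enorm = (fun s => s `^ 2^-1) \o
    fun v : 'rV[R]_n => \sum_i v ord0 i * v ord0 i).
  apply: measurableT_comp; first exact: measurable_powR.
  by apply: measurable_sum => i; apply: measurable_funM;
    exact: measurable_coord.
apply/funext => v; rewrite /enorm /dotmul mxE /=.
under eq_bigr do rewrite mxE.
by rewrite powR12_sqrt// sumr_ge0// => i _; rewrite -expr2 sqr_ge0.
Qed.

Lemma measurable_radial : measurable_fun setT radial.
Proof.
apply: measurable_fun_rV => i; rewrite (_ : (fun x => _) =
    fun v : 'rV[R]_n => enorm v `^ (-1) * v ord0 i); last first.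
  by apply/funext => v; rewrite mxE powR_inv1// sqrtr_ge0.
apply: measurable_funM; last exact: measurable_coord.
by apply: (measurableT_comp (measurable_powR _)); exact: measurable_enorm.
Qed.

Lemma measurable_punctured_ball : measurable punctured_ball.
Proof.
rewrite (_ : punctured_ball = enorm @^-1` `]0, 1]%classic).
  by rewrite -[X in measurable X]setTI; exact: measurable_enorm.
by apply/seteqP; split => v /=; rewrite in_itv.
Qed.

(* Surface measure of the unit sphere, in its polar-coordinates definition:
   n times the volume of the cone over E in the unit ball. *)
Definition surface_measure (E : set 'rV[R]_n) : \bar R :=
  (n%:R%:E * lebesgue_rV n (radial @^-1` E `&` punctured_ball))%E.

HB.instance Definition _ := isMeasurableFun.Build _ _ _ _ radial
  measurable_radial.

Definition cone_measure :=
  pushforward (mrestr (lebesgue_rV n) measurable_punctured_ball) radial.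

Let cone0 : cone_measure set0 = 0%E.
Proof. exact: measure0. Qed.

Let cone_ge0 E : (0 <= cone_measure E)%E.
Proof. exact: measure_ge0. Qed.

Let cone_sigma_additive : semi_sigma_additive cone_measure.
Proof. exact: measure_semi_sigma_additive. Qed.

HB.instance Definition _ := isMeasure.Build _ _ _ cone_measure
  cone0 cone_ge0 cone_sigma_additive.

Let scaled := mscale (NngNum (ler0n R n)) cone_measure.

Let surface0 : surface_measure set0 = 0%E.
Proof. exact: (measure0 scaled). Qed.

Let surface_ge0 E : (0 <= surface_measure E)%E.
Proof. exact: (measure_ge0 scaled). Qed.

Let surface_sigma_additive : semi_sigma_additive surface_measure.
Proof. exact: (@measure_semi_sigma_additive _ _ _ scaled). Qed.

HB.instance Definition _ := isMeasure.Build _ _ _ surface_measure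
  surface0 surface_ge0 surface_sigma_additive.

End surface_measure.
Arguments sphere {R} n.
Arguments surface_measure {R} n E.

Section smooth_maps.
Context {R : realType}.

Definition partial d (V : normedModType R) (i : 'I_d) (f : 'rV[R]_d -> V) :
  'rV[R]_d -> V := 'D_(delta_mx ord0 i) f.

(* f is of class C^k on the open set U *)
Fixpoint Ck (k d : nat) (V : normedModType R) (U : set 'rV[R]_d)
    (f : 'rV[R]_d -> V) : Prop :=
  (forall y, U y -> {for y, continuous f}) /\
  (if k is k'.+1 then forall i : 'I_d,
     (forall y, U y -> derivable f y (delta_mx ord0 i)) /\
     Ck k' U (partial i f)
   else True).

Definition jac d n (f : 'rV[R]_d -> 'rV[R]_n) (y : 'rV[R]_d) : 'M[R]_(d, n) :=
  \matrix_(i, j) partial i f y ord0 j.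

Definition gram d n (f : 'rV[R]_d -> 'rV[R]_n) (y : 'rV[R]_d) : 'M[R]_d :=
  jac f y *m (jac f y)^T.

End smooth_maps.

Section submanifolds.
Context {R : realType} (d n : nat).
Implicit Types (M : set 'rV[R]_n) (U : set 'rV[R]_d)
  (psi : 'rV[R]_d -> 'rV[R]_n) (f : 'rV[R]_n -> R).

(* psi is a C^2 immersion of the open set U, and a homeomorphism of U onto a
   relatively open subset of M *)
Definition local_param M U psi : Prop :=
  [/\ open U, Ck 2 U psi,
      forall y, U y -> row_free (jac psi y),
      {in U &, injective psi} &
      forall V, open V -> V `<=` U -> exists2 O, open O & psi @` V = M `&` O].

Definition submanifold M : Prop :=
  forall t, M t -> exists U psi, local_param M U psi /\ (psi @` U) t.

Definition Ck_on_submanifold (k : nat) M f : Prop :=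
  forall U psi, local_param M U psi -> Ck k U (f \o psi).

(* mu is the Riemannian measure of M for the metric induced by R^n; for d = 0
   it is the counting measure of M *)
Definition is_riemannian_measure M (mu : set 'rV[R]_n -> \bar R) : Prop :=
  mu (~` M) = 0%E /\
  forall U psi, local_param M U psi ->
    forall E : set 'rV[R]_d, measurable E -> E `<=` U ->
      mu (psi @` E) =
        (\int[lebesgue_rV d]_(y in E) (Num.sqrt (\det (gram psi y)))%:E)%E.

(* A parametrization of M at t, centered at 0. The components of the tensors
   below are taken in such a parametrization; the tensors themselves, the
   ambient gradient, positive definiteness and hessian_det do not depend on
   which one is chosen. *)
Definition is_chart_at M (t : 'rV[R]_n) psi : Prop :=
  exists U, [/\ local_param M U psi, U 0 & psi 0 = t].

Definition chart_at M (t : 'rV[R]_n) : 'rV[R]_d -> 'rV[R]_n :=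
  xget (fun=> 0) (is_chart_at M t).

Definition differential M f (t : 'rV[R]_n) : 'rV[R]_d :=
  \row_i partial i (f \o chart_at M t) 0.

Definition metric M (t : 'rV[R]_n) : 'M[R]_d := gram (chart_at M t) 0.

Definition gradient M f (t : 'rV[R]_n) : 'rV[R]_n :=
  differential M f t *m invmx (metric M t) *m jac (chart_at M t) 0.

(* Gamma^k_ij, by the formula for a metric induced from R^n *)
Definition christoffel M (t : 'rV[R]_n) (i j k : 'I_d) : R :=
  \sum_l dotmul (partial i (partial j (chart_at M t)) 0)
                (partial l (chart_at M t) 0) * invmx (metric M t) l k.

(* the matrix of the bilinear form nabla^2 f in the coordinate basis *)
Definition hessian M f (t : 'rV[R]_n) : 'M[R]_d :=
  \matrix_(i, j) (partial i (partial j (f \o chart_at M t)) 0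
    - \sum_k christoffel M t i j k * differential M f t ord0 k).

Definition hessian_posdef M f (t : 'rV[R]_n) : Prop :=
  forall v : 'rV[R]_d, v != 0 -> 0 < dotmul (v *m hessian M f t) v.

(* det nabla^2 f is the determinant in an orthonormal basis of the tangent
   space, i.e. that of the associated endomorphism *)
Definition hessian_det M f (t : 'rV[R]_n) : R :=
  \det (hessian M f t *m invmx (metric M t)).

End submanifolds.
Arguments submanifold {R} d {n} M.
Arguments Ck_on_submanifold {R} d {n} k M f.
Arguments is_riemannian_measure {R} d {n} M mu.
Arguments differential {R} d {n} M f t.
Arguments gradient {R} d {n} M f t.
Arguments hessian {R} d {n} M f t.
Arguments hessian_posdef {R} d {n} M f t.
Arguments hessian_det {R} d {n} M f t.

Definition Gamma {R : realType} (s : R) : R :=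
  (\int[lebesgue_measure]_(t in `]0%R, +oo[) (t `^ (s - 1) * expR (- t)))%R.

Section homogeneous_weibull.
Context {R : realType} (D : nat).
Implicit Types (A F H : 'rV[R]_D -> R).

Definition pos_homogeneous (b : R) (f : 'rV[R]_D -> R) : Prop :=
  forall r theta, 0 < r -> sphere D theta -> f (r *: theta) = r `^ b * f theta.

Definition has_density d (Omega : measurableType d) (P : probability Omega R)
    (X : {RV P >-> 'rV[R]_D}) (p : 'rV[R]_D -> R) : Prop :=
  forall E, measurable E ->
    distribution P X E = (\int[lebesgue_rV D]_(v in E) (p v)%:E)%E.

Definition posdirs H : set 'rV[R]_D := sphere D `&` [set theta | 0 < H theta].

Definition Phi F H (rho : R) (theta : 'rV[R]_D) : R :=
  F theta / H theta `^ rho.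

Definition W A F (lambda : R) (theta : 'rV[R]_D) : R :=
  A theta / F theta `^ lambda.

Definition sphere_boundary (G : set 'rV[R]_D) : set 'rV[R]_D :=
  closure G `&` closure (sphere D `\` G).

Definition is_component (B X : set 'rV[R]_D) : Prop :=
  exists2 t, X t & B = connected_component X t.

Definition collar (B : set 'rV[R]_D) (eps : R) : set ('rV[R]_D * R) :=
  B `*` `[0, eps[.

(* C^1 up to u = 0 means having a C^1 extension to u > - eps in each local
   parametrization of B. *)
Definition is_collar_map (G B : set 'rV[R]_D) H (eps : R)
    (phi : 'rV[R]_D * R -> 'rV[R]_D) : Prop :=
  [/\ forall t, B t -> phi (t, 0) = t,
      forall p, collar B eps p -> closure G (phi p) /\ H (phi p) = p.2,
      {in collar B eps &, injective phi},
      forall V, open V -> exists2 O, open O &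
        phi @` (collar B eps `&` V) = closure G `&` O &
      forall U (psi : 'rV[R]_(D.-2) -> 'rV[R]_D), local_param B U psi ->
        exists g : 'rV[R]_(D.-2 + 1) -> 'rV[R]_D,
        [/\ Ck 1 [set w | U (lsubmx w) /\ - eps < rsubmx w ord0 ord0 < eps] g,
            forall y u, U y -> 0 <= u < eps ->
              g (row_mx y u%:M) = phi (psi y, u) &
            forall y u, U y -> 0 <= u < eps ->
              row_free (jac g (row_mx y u%:M))]].

(* d sigma(phi(t, u)) = J(t, u) d sigma_B(t) du *)
Definition is_collar_jacobian (B : set 'rV[R]_D)
    (sigmaB : {measure set 'rV[R]_D -> \bar R}) (eps : R)
    (phi : 'rV[R]_D * R -> 'rV[R]_D) (J : 'rV[R]_D * R -> R) : Prop :=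
  [/\ measurable_fun (collar B eps) J,
      forall p, collar B eps p -> 0 <= J p &
      forall E, measurable E -> E `<=` collar B eps ->
        surface_measure D (phi @` E) =
          (\int[sigmaB \x lebesgue_measure]_(p in E) (J p)%:E)%E].

End homogeneous_weibull.

(* Main.v *)
(** In polar coordinates the radial integral is an upper incomplete gamma function, whence
    P (H eta > x) = betaF^-1 * int_G W * IG (lambda, z * Phi) dsigma with z = x ^ rho and
    IG (s, y) = int_y^oo t ^ (s - 1) e ^ (- t) dt. As IG decays exponentially, only a neighbourhood
    of the points minimizing Phi matters, and there collar coordinates (t, u) apply.
    - In (i), Phi = u ^ (1 - zeta) * (c (t) + O (u)) vanishes on B. Substituting
      u = z ^ (- k) s with k = 1 / (1 - zeta), dominated convergence and
      int_0^oo IG (lambda, c s ^ (1 / k)) ds = c ^ (- k) Gamma (lambda + k) give the result.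
    - In (ii), Phi = c0 (t) + u * c1 (t) + O (u ^ 2) has its minimum mu at (t0, 0), and
      IG (lambda, y) ~ y ^ (lambda - 1) e ^ (- y). In a chart y centered at t0 one substitutes
      (y, u) -> (z ^ (- 1 / 2) y, u / z); dominated convergence leaves a Gaussian integral in y,
      evaluated by Schur complements, times an exponential integral in u. The factor
      det (gram) ^ (1 / 2) coming from the chart turns det of the coordinate Hessian into
      hessian_det, because the Christoffel term vanishes at a critical point. *)

(* Surface measure is defined by volumes of cones, so polar coordinates have to be derived. The
   radial coordinate is |v| ^ D rather than |v|: the volume of a truncated cone is linear in it,
   Lebesgue measure becomes a plain product measure, and the Jacobian enters only through a power
   substitution on the half line, which is merged with the passage to t = r ^ betaF * F. Each limit
   is a dominated convergence along sequences and needs a majorant valid on a whole collar. The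
   collar is therefore shrunk until Phi exceeds a fixed fraction of its leading part: half of inf c
   in (i), half of the limiting rates in y and u in (ii). Away from the shrunk collar the lower
   bound on Phi and the integrability of W suffice. At u = 0 the quotient Phi degenerates and omega
   = W * J is not given, so integrals run over u > 0 and values at u = 0 enter as limits. The class
   C^k is expressed by continuity of iterated partial derivatives; symmetry of the Hessian and the
   Taylor estimate are obtained from the mean value theorem along coordinate lines. *)
Require Import Defs.
From HB Require Import structures.
From mathcomp Require Import all_boot all_order all_algebra.
From mathcomp Require Import all_classical all_reals all_analysis.
From mathcomp Require Import measurable_realfun.
From mathcomp Require Import ring lra.

Set Implicit Arguments.
Unset Strict Implicit.
Unset Printing Implicit Defensive.

Import Order.TTheory GRing.Theory Num.Theory.
Import numFieldNormedType.Exports.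

Local Open Scope classical_set_scope.
Local Open Scope ring_scope.

(** * Borel sets and change of variables *)

Section borel.
Context {R : realType}.

(** The norm is the sup norm, so a ball is a finite intersection of coordinate strips. A nonpositive
    radius is split off because for n = 0 the empty intersection would be everything. *)
Lemma measurable_mx_ball n (v : 'rV[R]_n) e : measurable (ball v e).
Proof.
have [e0|e0] := ltP (0 : R) e; last first.
  by rewrite (_ : ball v e = set0)//; apply/seteqP; split => // w [/lt_geF]; rewrite e0.
rewrite (_ : ball v e = \bigcap_(i in [set: 'I_n])
    [set w | ball (v ord0 i) e (w ord0 i)]).
  apply: fin_bigcap_measurable => // i _.
  rewrite -[X in measurable X]setTI.
  apply: (measurable_coord i) => //.
  exact: measurable_ball.
apply/seteqP; split => w; first by move=> [_ vw] i _ /=; exact: vw.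
by move=> vw; split => // i j; rewrite (ord1 i); exact: vw.
Qed.

(** The sigma-algebra is generated by coordinates, not by open sets; second countability links the
    two: an open set is the union of the countably many rational boxes it contains. *)
Lemma measurable_open_prod n (O : set ('rV[R]_n * R)) : open O -> measurable O.
Proof.
move=> oO.
pose box (x : 'rV[rat]_n * rat * nat) : set ('rV[R]_n * R) :=
  ball (map_mx ratr x.1.1 : 'rV[R]_n) x.2.+1%:R^-1 `*`
  ball (ratr x.1.2 : R) x.2.+1%:R^-1.
have mbox x : measurable (box x).
  by apply: measurableX; [exact: measurable_mx_ball|exact: measurable_ball].
rewrite (_ : O = \bigcup_(x in [set x | box x `<=` O]) box x); last first.
  apply/seteqP; split => [[v r] Ovr|p [x xO /xO//]].
  have /nbhs_ballP[e /= e0 eO] : nbhs (v, r) O by exact: open_nbhs_nbhs.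
  (* A rational centre within 1 / (k + 1) of the point gives a box all of whose points are within 2
     / (k + 1) of it, hence the bound e / 2. *)
  have [k ke] : exists k : nat, k.+1%:R^-1 < e / 2.
    have [k _ /(_ k (leqnn k)) /=] := near_infty_natSinv_lt (PosNum (divr_gt0 e0 (ltr0n _ 2))).
    by exists k.
  have ball_rat (y : R) : exists q : rat, `|ratr q - y| < k.+1%:R^-1.
    have [q /itvP qy] : exists q, ratr q \in `]y - k.+1%:R^-1, y + k.+1%:R^-1[.
      by apply: rat_in_itvoo; rewrite ltrD2l gtrN// invr_gt0.
    by exists q; rewrite ltr_norml ltrBDr addrC qy ltrBlDr addrC qy.
  have [Q vQ] := @choice _ _ _ (fun i => ball_rat (v ord0 i)).
  have [q rq] := ball_rat r.
  have k0 : (0 : R) < k.+1%:R^-1 by rewrite invr_gt0.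
  exists (\row_i Q i, q, k).
    move=> [v' r'] [/= bv br]; apply: eO; split => /=.
      split => // i j; rewrite (ord1 i).
      apply: (@le_ball _ _ _ (k.+1%:R^-1 + k.+1%:R^-1)).
        by rewrite (splitr e) lerD// ltW.
      have b1 : ball (ratr (Q j) : R) k.+1%:R^-1 (v ord0 j) := vQ j.
      apply: ball_triangle (ball_sym b1) _.
      by have [_ /(_ ord0 j)] := bv; rewrite !mxE.
    apply: (@le_ball _ _ _ (k.+1%:R^-1 + k.+1%:R^-1)).
      by rewrite (splitr e) lerD// ltW.
    have b1 : ball (ratr q : R) k.+1%:R^-1 r := rq.
    exact: ball_triangle (ball_sym b1) br.
  split => //=; split => // i j; rewrite (ord1 i) !mxE; exact: vQ.
rewrite bigcup_mkcond; apply: countable_bigcupT_measurable => //.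
by move=> x; case: ifPn.
Qed.

Lemma measurable_open_rV n (O : set 'rV[R]_n) : open O -> measurable O.
Proof.
move=> oO; rewrite (_ : O = (fun v => (v, 0 : R)) @^-1` (O `*` setT)).
  rewrite -[X in measurable X]setTI; apply: measurable_fun_pair => //=.
  rewrite setXT; apply: measurable_open_prod.
  by apply: open_comp => // x _; exact: cvg_fst.
by apply/seteqP; split => // v [].
Qed.

Lemma measurable_closed_rV n (K : set 'rV[R]_n) : closed K -> measurable K.
Proof.
by move=> cK; rewrite -[K]setCK; apply: measurableC; apply: measurable_open_rV; exact: closed_openC.
Qed.

Lemma within_continuous_measurable d (T : measurableType d)
    (S : topologicalType) (E : set S) (f : S -> R) (g : T -> S) (D : set T) :
  (forall O, open O -> measurable (D `&` g @^-1` O)) ->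
  D `<=` g @^-1` E ->
  {within E, continuous f} -> measurable_fun D (f \o g).
Proof.
move=> mg DE /continuousP cf mD.
apply: (measurability _ (RGenOpens.measurableE R)) => //.
move=> _ [_ [a [b ->] <-]].
have : open (f @^-1` `]a, b[%classic : set (subspace E)).
  exact/cf/interval_open.
move=> /open_subspaceP[V oV VE].
rewrite (_ : _ `&` _ = D `&` g @^-1` V); first exact: mg.
apply/seteqP; split => x [Dx /= abx]; split => //.
  have : (f @^-1` `]a, b[%classic `&` E) (g x) by split => //; exact: DE.
  by rewrite -VE => -[].
have : (V `&` E) (g x) by split => //; exact: DE.
by rewrite VE => -[].
Qed.

Lemma within_continuous_measurable_rV n (E : set 'rV[R]_n) (f : 'rV[R]_n -> R) :
  measurable E -> {within E, continuous f} -> measurable_fun E f.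
Proof.
move=> mE cf; apply: (@within_continuous_measurable _ _ _ E f id E) => //.
by move=> O oO; apply: measurableI => //; exact: measurable_open_rV.
Qed.

Lemma within_continuous_measurable_prod n (E : set ('rV[R]_n * R))
    (f : 'rV[R]_n * R -> R) :
  measurable E -> {within E, continuous f} -> measurable_fun E f.
Proof.
move=> mE cf; apply: (@within_continuous_measurable _ _ _ E f id E) => //.
by move=> O oO; apply: measurableI => //; exact: measurable_open_prod.
Qed.

End borel.

(** * Change of variables for nonnegative functions *)

Section ge0_change_of_variables.
Local Open Scope ereal_scope.
Context d1 d2 (T1 : measurableType d1) (T2 : measurableType d2) (R : realType).
Variables (mu1 : {measure set T1 -> \bar R}) (mu2 : {measure set T2 -> \bar R}).
Variables (D : set T1) (h : T1 -> T2) (J : T1 -> R).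
Hypotheses (mD : measurable D) (mhD : measurable (h @` D)).
Hypotheses (mh : measurable_fun D h) (mJ : measurable_fun D J).
Hypothesis J0 : forall x, D x -> (0 <= J x)%R.
Hypothesis muh : forall E, measurable E -> E `<=` D ->
  mu2 (h @` E) = \int[mu1]_(x in E) (J x)%:E.

Import HBNNSimple.

Let integral_indic_image (A : set T2) : measurable A ->
  \int[mu2]_(y in h @` D) (\1_A y)%:E =
  \int[mu1]_(x in D) ((\1_A (h x))%:E * (J x)%:E).
Proof.
move=> mA; rewrite integral_indic//.
have -> : A `&` h @` D = h @` (D `&` h @^-1` A).
  apply/seteqP; split => [y [Ay [x Dx xy]]|_ [x [Dx Ax] <-]].
    by exists x => //; split => //=; rewrite xy.
  by split => //; exists x.
rewrite muh//; last exact: mh.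
rewrite integral_mkcondr; apply: eq_integral => x xD; rewrite patchE.
rewrite indicE; have [/set_mem xA|/negP xA] := boolP (x \in h @^-1` A).
  by rewrite mem_set//= mul1e.
by rewrite memNset ?mul0e// => ?; apply: xA; exact: mem_set.
Qed.

(** Since the part of A in h(D) is the image of D intersected with the preimage of A, [muh] is
    already the case of an indicator; linearity and monotone convergence do the rest. It serves for
    powers on the half line, polar coordinates, the collar and the charts. *)
Lemma ge0_change_of_variables (f : T2 -> \bar R) :
  measurable_fun (h @` D) f -> (forall y, (h @` D) y -> 0 <= f y) ->
  \int[mu2]_(y in h @` D) f y = \int[mu1]_(x in D) (f (h x) * (J x)%:E).
Proof.
move=> mf f0; pose f_ := nnsfun_approx mhD mf.
have mfh n : measurable_fun D (fun x => (f_ n (h x))%:E).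
  apply/measurable_EFinP; apply: (measurable_comp measurableT) => //.
transitivity (limn (fun n => \int[mu2]_(y in h @` D) (f_ n y)%:E)).
  rewrite -monotone_convergence//.
  - apply: eq_integral => y /[!inE] yD; apply/esym/cvg_lim => //.
    by apply: cvg_nnsfun_approx => // *; apply: f0; rewrite inE.
  - by move=> n; exact/measurable_EFinP/measurable_funP.
  - by move=> n y _; rewrite lee_fin.
  - by move=> y _ m n mn; rewrite lee_fin; exact/lefP/nd_nnsfun_approx.
rewrite [X in limn X](_ : _ =
    (fun n => \int[mu1]_(x in D) ((f_ n (h x))%:E * (J x)%:E))).
  rewrite -monotone_convergence//.
  - apply: eq_integral => x /[!inE] xD; apply/cvg_lim => //.
    apply: cvgeZr => //; apply: cvg_nnsfun_approx => //.
  - by move=> n; apply: emeasurable_funM => //; exact/measurable_EFinP.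
  - by move=> n x Dx; rewrite mule_ge0// lee_fin// J0.
  - move=> x Dx m n mn; rewrite lee_wpmul2r ?lee_fin// ?J0//.
    exact/lefP/nd_nnsfun_approx.
apply/funext => n.
under eq_integral do rewrite fimfunE -fsumEFin//.
rewrite ge0_integral_fsum//; last 2 first.
- by move=> y; exact/measurable_EFinP/measurable_funM.
- by move=> y x _; rewrite nnfun_muleindic_ge0.
under [RHS]eq_integral => x xD.
  rewrite fimfunE -fsumEFin// ge0_mule_fsuml; last first.
    by move=> y; rewrite nnfun_muleindic_ge0.
  over.
rewrite /= ge0_integral_fsum//; last 2 first.
- move=> y; apply: emeasurable_funM; last exact/measurable_EFinP.
  apply/measurable_EFinP; apply: measurable_funM => //.
  by apply: (measurable_comp measurableT) => //.
- move=> y x Dx; rewrite mule_ge0//; first by rewrite nnfun_muleindic_ge0.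
  by rewrite lee_fin J0.
apply: eq_fsbigr => r /[!inE] -[y _ yr].
under eq_integral do rewrite EFinM.
rewrite ge0_integralZl_EFin//; last 2 first.
- exact/measurable_EFinP.
- by rewrite -yr.
rewrite integral_indic_image//.
under [RHS]eq_integral do rewrite EFinM -muleA.
rewrite ge0_integralZl_EFin//.
- by move=> x Dx; rewrite mule_ge0// lee_fin// J0.
- apply: emeasurable_funM; last exact/measurable_EFinP.
  by apply/measurable_EFinP; apply: (measurable_comp measurableT) => //.
- by rewrite -yr.
Qed.

End ge0_change_of_variables.

(** * Lebesgue measure under scaling *)

Section lebesgue_scaling.
Local Open Scope ereal_scope.
Context {R : realType}.
Notation leb := (@lebesgue_measure R).

Lemma lebesgue_measure_affine (a b : R) (A : set R) : (0 < a)%R ->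
  measurable A ->
  leb A = a%:E * leb ((fun x => a * x + b)%R @^-1` A).
Proof.
move=> a0 mA.
have ma : @measurable_fun _ _ (measurableTypeR R) (measurableTypeR R) setT
    (fun x => a * x + b)%R.
  by apply: measurable_funD => //; exact: measurable_funM.
pose g : {mfun measurableTypeR R >-> measurableTypeR R} :=
  HB.pack (fun x : measurableTypeR R => (a * x + b)%R : measurableTypeR R)
    (isMeasurableFun.Build _ _ _ _ _ ma).
have -> := @lebesgue_measure_unique R
  (mscale (NngNum (ltW a0)) (pushforward leb g)) _ A mA.
  by [].
move=> _ [[c e] _ <-] /=; rewrite /mscale/= /pushforward/=.
rewrite (_ : _ @^-1` _ = `](c - b) / a, (e - b) / a]%classic)%R; last first.
  apply/seteqP; split => x /=; rewrite !in_itv/= ltr_pdivrMr// ler_pdivlMr//.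
    by rewrite ltrBlDr lerBrDr (mulrC x).
  by rewrite ltrBlDr lerBrDr (mulrC x).
rewrite !lebesgue_measure_itv/= !lte_fin ltr_pM2r ?invr_gt0// ltrD2r.
case: ifP => _; last by rewrite mule0.
rewrite !EFinN -!EFinB -EFinM -mulrBl opprB addrA subrK mulrCA divff ?gt_eqF//.
by rewrite mulr1.
Qed.

Lemma ge0_integral_affine (a b : R) (D : set R) (f : R -> \bar R) :
  (0 < a)%R -> measurable D -> measurable_fun D f ->
  (forall y, D y -> 0 <= f y) ->
  \int[leb]_(y in D) f y =
  a%:E * \int[leb]_(x in (fun x => a * x + b)%R @^-1` D) f (a * x + b)%R.
Proof.
move=> a0 mD mf f0.
have ma : @measurable_fun _ _ (measurableTypeR R) (measurableTypeR R) setT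
    (fun x => a * x + b)%R.
  by apply: measurable_funD => //; exact: measurable_funM.
pose g : {mfun measurableTypeR R >-> measurableTypeR R} :=
  HB.pack (fun x : measurableTypeR R => (a * x + b)%R : measurableTypeR R)
    (isMeasurableFun.Build _ _ _ _ _ ma).
rewrite (eq_measure_integral
  (mscale (NngNum (ltW a0)) (pushforward leb g))); last first.
  by move=> /= A mA _; exact: lebesgue_measure_affine.
rewrite ge0_integral_mscale// ge0_integral_pushforward//.
by move=> y /[!inE]; exact: f0.
Qed.

Lemma ge0_integral_lebesgue_rVS n (f : 'rV[R]_n.+1 -> \bar R) :
  measurable_fun setT f -> (forall v, 0 <= f v) ->
  \int[lebesgue_rV n.+1]_v f v =
  \int[leb]_x \int[lebesgue_rV n]_v f (cons_rV (x, v)).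
Proof.
move=> mf f0.
transitivity (\int[leb \x lebesgue_rV n]_p f (cons_rV p)).
  exact: (@ge0_integral_pushforward _ _ _ _ _ _ (@measurable_cons_rV R n) (leb \x lebesgue_rV n) setT f).
rewrite (@fubini_tonelli1 _ _ _ _ _ leb (lebesgue_rV n)
  (fun p => f (cons_rV p)))//.
by apply: measurableT_comp => //; exact: measurable_cons_rV.
Qed.

Lemma measurable_scale_rV n (a : R) :
  measurable_fun setT (fun v : 'rV[R]_n => a *: v).
Proof.
apply: measurable_fun_rV => i.
rewrite (_ : (fun _ => _) = fun v : 'rV[R]_n => (a * v ord0 i)%R); last first.
  by apply/funext => v; rewrite mxE.
by apply: measurable_funM => //; exact: measurable_coord.
Qed.

Lemma ge0_integral_lebesgue_rV_scale n (a : R) (f : 'rV[R]_n -> \bar R) :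
  (0 < a)%R -> measurable_fun setT f -> (forall v, 0 <= f v) ->
  \int[lebesgue_rV n]_v f v = (a ^+ n)%:E * \int[lebesgue_rV n]_v f (a *: v).
Proof.
move=> a0; elim: n => [|n IH] in f *; move=> mf f0.
  rewrite expr0 mul1e /=; apply: eq_integral => v _.
  by congr f; apply/rowP => -[].
have mfa : measurable_fun setT (fun v : 'rV[R]_n.+1 => f (a *: v)).
  by apply: measurableT_comp => //; exact: measurable_scale_rV.
rewrite !ge0_integral_lebesgue_rVS//.
have mfc x : measurable_fun setT (fun v : 'rV[R]_n => f (cons_rV (x, v))).
  by apply: (measurableT_comp mf); apply: (measurableT_comp (@measurable_cons_rV R n));
    exact: measurable_pair1.
have mF : measurable_fun setT (fun x : measurableTypeR R =>
    \int[lebesgue_rV n]_v f (cons_rV (x, a *: v))).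
  apply: (@measurable_fun_fubini_tonelli_F _ _ _ _ _ (lebesgue_rV n)
    (fun p : measurableTypeR R * 'rV[R]_n => f (cons_rV (p.1, a *: p.2)))).
    apply: (measurableT_comp mf); apply: (measurableT_comp (@measurable_cons_rV R n)).
    apply: measurable_fun_pair => //=.
    by apply: measurableT_comp => //; exact: measurable_scale_rV.
  by move=> ?; exact: f0.
have F0 x : 0 <= \int[lebesgue_rV n]_v f (cons_rV (x, a *: v)).
  by apply: integral_ge0 => v _; exact: f0.
have mF' : measurable_fun setT (fun x : measurableTypeR R =>
    \int[lebesgue_rV n]_v f (cons_rV (x, v))).
  apply: (@measurable_fun_fubini_tonelli_F _ _ _ _ _ (lebesgue_rV n)
    (fun p : measurableTypeR R * 'rV[R]_n => f (cons_rV p))).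
    by apply: (measurableT_comp mf); exact: measurable_cons_rV.
  by move=> ?; exact: f0.
transitivity (\int[leb]_x
    ((a ^+ n)%:E * \int[lebesgue_rV n]_v f (cons_rV (x, a *: v)))).
  by apply: eq_integral => x _; rewrite IH.
transitivity ((a ^+ n)%:E *
    \int[leb]_x \int[lebesgue_rV n]_v f (cons_rV (x, a *: v))).
  apply: ge0_integralZl => //.
  by rewrite lee_fin exprn_ge0// ltW.
rewrite (@ge0_integral_affine a 0 setT _ a0 measurableT mF) => [|x _]; last exact: F0.
rewrite preimage_setT muleA -EFinM -exprSr; congr (_ * _).
apply: eq_integral => x _; apply: eq_integral => v _; congr f.
apply/rowP => i; rewrite !mxE /= addr0.
by case: unliftP => [j _|_] //=; rewrite mxE.
Qed.

End lebesgue_scaling.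

(** * Polar coordinates *)

Section measures_on_the_half_line.
Local Open Scope ereal_scope.
Context {R : realType}.
Notation leb := (@lebesgue_measure R).

(** Turns an indefinite integral into a measure, so that uniqueness theorems for measures apply to
    it. *)
Lemma density_measure d (T : measurableType d) (mu : {measure set T -> \bar R})
    (f : T -> \bar R) :
  measurable_fun setT f -> (forall x, 0 <= f x) ->
  exists nu : {measure set T -> \bar R}, forall A, nu A = \int[mu]_(x in A) f x.
Proof.
move=> mf f0; pose nu (A : set T) := \int[mu]_(x in A) f x.
have nu0 : nu set0 = 0 by rewrite /nu integral_set0.
have nu_ge0 A : 0 <= nu A by exact: integral_ge0.
have nu_sigma : semi_sigma_additive nu.
  move=> /= F mF tF mUF; rewrite /nu; apply: cvg_toP.
    apply: ereal_nondecreasing_is_cvgn => m n mn.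
    by apply: lee_sum_nneg_natr => // k _ _; exact: integral_ge0.
  by rewrite ge0_integral_bigcup//; exact: measurable_funTS.
pose nu' : {measure set T -> \bar R} :=
  HB.pack nu (isMeasure.Build _ _ _ nu nu0 nu_ge0 nu_sigma).
by exists nu'.
Qed.

(** An interval ]a, b] with a > 0 is a difference of intervals starting at 0, and these are the ones
    whose measure is computed directly, both for powers and for truncated cones. *)
Lemma measure_unique_half_line
    (m1 m2 : {measure set (measurableTypeR R) -> \bar R}) :
  m1 `]-oo, 0%R]%classic = 0 -> m2 `]-oo, 0%R]%classic = 0 ->
  (forall b, (0 < b)%R -> m1 `]0%R, b]%classic = m2 `]0%R, b]%classic) ->
  (forall b, (0 < b)%R -> m1 `]0%R, b]%classic < +oo) ->
  forall A, measurable A -> m1 A = m2 A.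
Proof.
move=> m10 m20 m12 m1oo.
have mI (m : {measure set (measurableTypeR R) -> \bar R}) (a b : R) :
    m `]-oo, 0%R]%classic = 0 -> (0 < b)%R -> (forall b, (0 < b)%R -> m `]0%R, b]%classic < +oo) ->
    (a < b)%R -> m `]a, b]%classic = m `]0%R, b]%classic - (if (0 < a)%R then m `]0%R, a]%classic else 0).
  move=> m0 b0 moo ab; case: ifPn => [a0|]; last first.
    rewrite -leNgt sube0 => a0.
    rewrite (_ : `]a, b]%classic = `]a, 0%R] `|` `]0%R, b]); last first.
      by rewrite -itv_bndbnd_setU// bnd_simp// ltW.
    rewrite measureU//.
      rewrite (subset_measure0 _ _ _ m0) ?add0e//.
      by apply: subset_itv => //.
    by apply/seteqP; split => // x [/=]; rewrite !in_itv/= => /andP[_ /le_gtF ->].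
  rewrite (_ : `]0%R, b]%classic = `]0%R, a] `|` `]a, b]); last first.
    by rewrite -itv_bndbnd_setU// bnd_simp ltW.
  rewrite measureU//.
    by rewrite addeAC subee ?add0e// ge0_fin_numE ?moo.
  by apply/seteqP; split => // x [/=]; rewrite !in_itv/= => /andP[_ /le_gtF ->].
have m2oo b : (0 < b)%R -> m2 `]0%R, b]%classic < +oo by move=> b0; rewrite -m12// m1oo.
have mN (m : {measure set (measurableTypeR R) -> \bar R}) (a b : R) :
    m `]-oo, 0%R]%classic = 0 -> (b <= 0)%R -> m `]a, b]%classic = 0.
  move=> m0 b0; apply: subset_measure0 m0 => //.
  by apply: subset_itv; rewrite // bnd_simp.
move=> A mA; pose g k : set (measurableTypeR R) := `](- k%:R)%R, k%:R]%classic.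
apply: (@measure_unique _ R (measurableTypeR R) (@ocitv R) g erefl (@ocitvI R) _ _ m1 m2 _ _ A mA).
- by move=> k; exact: is_ocitv.
- apply/seteqP; split => // x _; exists (Num.bound x) => //=.
  by rewrite /g /= in_itv/= ltrNl unstable.ltrNbound ltW// unstable.ltr_bound.
- move=> _ [[a b] _ <-] /=.
  have [b0|b0] := leP b 0%R; first by rewrite !mN.
  have [ab|ba] := ltP a b; last by rewrite set_itv_ge ?measure0// bnd_simp -leNgt.
  rewrite (mI m1 a b m10 b0 m1oo ab) (mI m2 a b m20 b0 m2oo ab) (m12 _ b0).
  by case: ifPn => // a0; rewrite (m12 _ a0).
- rewrite /g; case=> [|k]; first by rewrite mN.
  have k0 : (0 < k.+1%:R :> R)%R by rewrite ltr0n.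
  rewrite (mI m1 _ _ m10 k0 m1oo) ?ifN ?sube0 ?m1oo//.
    by rewrite -leNgt oppr_le0.
  by rewrite (@lt_trans _ _ 0%R)// oppr_lt0.
Qed.

End measures_on_the_half_line.

(** * The substitution of a power on the half line *)

Section power_substitution.
Local Open Scope ereal_scope.
Context {R : realType}.
Notation leb := (@lebesgue_measure R).

Lemma continuous_powR (p x : R) : (0 < x)%R -> {for x, continuous (@powR R ^~ p)}.
Proof.
move=> x0; apply: differentiable_continuous; apply/derivable1_diffP.
by apply: derivable_powR; rewrite in_itv/= x0.
Qed.

Lemma integral_powR_cc (p a b : R) : (0 < a < b)%R ->
  \int[leb]_(s in `[a, b]) (p * s `^ (p - 1))%:E = (b `^ p - a `^ p)%:E.
Proof.
move=> /andP[a0 ab]; rewrite (@continuous_FTC2 _ _ (@powR R ^~ p))//.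
- apply: derivable_within_continuous => x; rewrite in_itv/= => /andP[ax _].
  apply: derivableM => //; apply: derivable_powR.
  by rewrite in_itv/= andbT (lt_le_trans a0).
- split.
  + move=> x; rewrite in_itv/= => /andP[ax _]; apply: derivable_powR.
    by rewrite in_itv/= andbT (lt_trans a0).
  + by apply: cvg_at_right_filter; apply: continuous_powR.
  + by apply: cvg_at_left_filter; apply: continuous_powR; exact: lt_trans ab.
- move=> x; rewrite in_itv/= => /andP[ax _]; apply: powR_derive1.
  by rewrite in_itv/= andbT (lt_trans a0).
Qed.

(** For p < 1 the integrand is unbounded at 0. The fundamental theorem is applied on closed
    intervals away from 0, which then increase to ]0, b]. *)
Lemma integral_powR_oc (p b : R) : (0 < p)%R -> (0 < b)%R ->
  \int[leb]_(s in `]0%R, b]) (p * s `^ (p - 1))%:E = (b `^ p)%:E.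
Proof.
move=> p0 b0.
have mf D : measurable_fun D (fun s : R => (p * s `^ (p - 1))%:E).
  apply/measurable_EFinP; apply: measurable_funM => //.
  by apply: measurable_funTS; exact: measurable_powR.
(* With [n.+2] the left end stays strictly below b already for n = 0. *)
have bn0 n : (0 < b / n.+2%:R)%R by rewrite divr_gt0.
have bnb n : (b / n.+2%:R < b)%R by rewrite ltr_pdivrMr// ltr_pMr// ltr1n.
have := @ge0_nondecreasing_set_cvg_integral _ (measurableTypeR R) R
  (fun n => `[b / n.+2%:R, b]%classic)%R (fun s => (p * s `^ (p - 1))%:E) leb.
rewrite (_ : \bigcup_i _ = `]0%R, b]%classic); last first.
  apply/seteqP; split => [x [n _]|x]/=; rewrite !in_itv/= => /andP[].
    by move=> bnx ->; rewrite (lt_le_trans (bn0 n)).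
  move=> x0 xb; exists (Num.bound (b / x)) => //=; rewrite in_itv/= xb andbT.
  rewrite ler_pdivrMr// mulrC -ler_pdivrMr// ltW//.
  by rewrite (lt_trans (unstable.ltr_bound _))// ltr_nat.
move=> H; apply/esym; apply: cvg_unique (H _ _ _ _).
- by [].
- rewrite /= (_ : (fun i : nat => _) =
      fun i => (b `^ p - (b / i.+2%:R) `^ p)%:E); last first.
    by apply/funext => n; apply: integral_powR_cc; rewrite bn0 bnb.
  apply: cvg_EFin; first by near=> n.
  rewrite -[X in _ --> X]subr0 /comp /=.
  apply: cvgB; first exact: cvg_cst.
  have bn : (fun n => b / n.+2%:R)%R @ \oo --> (0%R : R).
    rewrite -[X in _ --> X](mulr0 b); apply: cvgMr.
    rewrite (cvg_shiftS (@harmonic R)).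
    exact: cvg_harmonic.
  by have /cvg_at_rightP := powR_cvg0 p0; apply; split.
- apply/nondecreasing_seqP => n; apply/subsetPset.
  apply: subset_itvr; rewrite bnd_simp ler_pM2l// lef_pV2 ?posrE//.
  by rewrite ler_nat.
- by move=> i; exact: measurable_itv.
- by move=> i; exact: mf.
- by move=> i x _; rewrite lee_fin mulr_ge0 ?powR_ge0// ltW.
Unshelve. all: by end_near.
Qed.

Lemma powR_invK (x p : R) : (0 <= x)%R -> (p == 0)%R = false ->
  ((x `^ p) `^ p^-1)%R = x.
Proof. by move=> x0 p0; rewrite -powRrM mulfV ?p0// powRr1. Qed.

Lemma ge0_integral_powR (p : R) (f : R -> \bar R) : (0 < p)%R ->
  measurable_fun (`]0%R, +oo[ : set R) f -> (forall s, (0 < s)%R -> 0 <= f s) ->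
  \int[leb]_(s in `]0%R, +oo[) f s =
  \int[leb]_(s in `]0%R, +oo[) (f (s `^ p)%R * (p * s `^ (p - 1))%:E).
Proof.
move=> p0 mf f0.
pose D : set R := `]0%R, +oo[%classic.
have hD : (@powR R ^~ p) @` D = D.
  apply/seteqP; split => [_ [x + <-]|x]; rewrite /D/= !in_itv/= !andbT.
    exact: powR_gt0.
  move=> x0; exists (x `^ p^-1)%R; first by rewrite in_itv/= andbT powR_gt0.
  by rewrite -powRrM mulVf ?gt_eqF// powRr1// ltW.
have mD : measurable D by exact: measurable_itv.
rewrite -/D -{1}hD.
apply: (@ge0_change_of_variables _ _ _ _ _ leb leb) => //.
- by rewrite hD.
- by apply: measurable_funTS; exact: measurable_powR.
- apply: measurable_funM => //.
  by apply: measurable_funTS; exact: measurable_powR.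
- by move=> x _; rewrite mulr_ge0 ?powR_ge0// ltW.
- move=> E mE ED.
  (* [powR] takes default values at negative bases, so the density is cut off outside the half
     line. *)
  have mJ : measurable_fun setT (fun s : measurableTypeR R =>
     ((p * s `^ (p - 1)) * \1_D s)%:E).
    apply/measurable_EFinP; apply: measurable_funM => //.
    by apply: measurable_funM => //; exact: measurable_powR.
  have [|nu nuE] := @density_measure R _ _ leb _ mJ.
    by move=> x; rewrite lee_fin !mulr_ge0 ?powR_ge0// ltW.
  have mpow : @measurable_fun _ _ (measurableTypeR R) (measurableTypeR R) setT
     ((@powR R)^~ (p^-1)%R) by exact: measurable_powR.
  pose g : {mfun measurableTypeR R >-> measurableTypeR R} :=
    HB.pack ((@powR R)^~ (p^-1)%R : measurableTypeR R -> measurableTypeR R)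
      (isMeasurableFun.Build _ _ _ _ _ mpow).
  (* On the half line the image under the p-th power is the preimage under the power 1 / p. Hence
     the measure of the image is a pushforward, to be compared with the measure [nu] of density p *
     s ^ (p - 1). *)
  have preE (A : set R) : A `<=` D ->
      g @^-1` A `&` D = (@powR R ^~ p) @` A.
    move=> AD; apply/seteqP; split => [x [/= Ax Dx]|_ [x Ax <-]] /=.
      exists (x `^ p^-1)%R => //.
      rewrite -powRrM mulVf ?gt_eqF// powRr1// ltW//.
      by move: Dx; rewrite /D/= in_itv/= andbT.
    have x0 : (0 < x)%R by have := AD _ Ax; rewrite /D/= in_itv/= andbT.
    rewrite /D/= in_itv/= andbT powR_gt0//; split => //.
    by rewrite -powRrM mulfV ?gt_eqF// powRr1// ltW.
  transitivity (pushforward (mrestr leb mD) g E).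
    by rewrite /pushforward /mrestr preE.
  have nuD (A : set R) : measurable A -> A `<=` D ->
      nu A = \int[leb]_(s in A) (p * s `^ (p - 1))%:E.
    move=> mA AD; rewrite nuE; apply: eq_integral => x /[!inE] Ax.
    by rewrite indicE mem_set ?mulr1//; exact: AD.
  have imE b : (0 < b)%R ->
      (@powR R ^~ p) @` `]0%R, b]%classic = `]0%R, (b `^ p)%R]%classic.
    move=> b0.
    apply/seteqP; split => [_ [x + <-]|x]/=; rewrite !in_itv/=.
      move=> /andP[x0 xb]; rewrite powR_gt0//=.
      by rewrite ge0_ler_powR ?nnegrE// ltW.
    move=> /andP[x0 xb]; exists (x `^ p^-1)%R.
      rewrite in_itv/= powR_gt0//=.
      rewrite -[leRHS](powR_invK (ltW b0) (gt_eqF p0)).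
      by rewrite ge0_ler_powR ?nnegrE// ?invr_ge0 ?powR_ge0// ltW.
    by rewrite -powRrM mulVf ?gt_eqF// powRr1// ltW.
  rewrite -nuD//; apply: measure_unique_half_line => //.
  + transitivity (leb (g @^-1` `]-oo, 0%R]%classic `&` D)) => //.
    rewrite (_ : _ `&` _ = set0) ?measure0//.
    apply/seteqP; split => // x []; rewrite /D/= !in_itv/= andbT.
    by move=> xp x0; have := powR_gt0 p^-1%R x0; rewrite ltNge xp.
  + rewrite nuE integral_mkcond; apply: integral0_eq => x _; rewrite patchE.
    case: ifPn => // /[!inE]; rewrite /= in_itv/= => x0.
    rewrite indicE memNset ?mulr0// /D/= in_itv/= andbT; apply/negP.
    by rewrite -leNgt.
  + move=> b b0; rewrite nuD//; last first.
      by rewrite /D; apply: subset_itvl.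
    rewrite integral_powR_oc//.
    transitivity (leb (g @^-1` `]0%R, b]%classic `&` D)) => //.
    rewrite preE; last by rewrite /D; apply: subset_itvl.
    by rewrite imE// lebesgue_measure_itv/= lte_fin powR_gt0// sube0.
  + move=> b b0.
    apply: (@le_lt_trans _ _ (leb (g @^-1` `]0%R, b]%classic `&` D))) => //.
    rewrite preE; last by rewrite /D; apply: subset_itvl.
    by rewrite (imE b b0) lebesgue_measure_itv/= lte_fin powR_gt0// sube0 ltry.
- by rewrite hD.
- by move=> y; rewrite hD /D/= in_itv/= andbT; exact: f0.
Qed.

End power_substitution.

(** * Cones and the polar decomposition of Lebesgue measure *)

Section polar_coordinates.
Local Open Scope ereal_scope.
Context {R : realType}.
Notation leb := (@lebesgue_measure R).

Lemma enormZ n (a : R) (v : 'rV[R]_n) : (0 <= a)%R ->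
  enorm (a *: v) = (a * enorm v)%R.
Proof.
move=> a0; rewrite /enorm /dotmul linearZ/= -scalemxAl -scalemxAr !mxE mulrA.
by rewrite sqrtrM ?mulr_ge0// -expr2 sqrtr_sqr ger0_norm.
Qed.

Lemma enorm_ge0 n (v : 'rV[R]_n) : (0 <= enorm v)%R.
Proof. exact: sqrtr_ge0. Qed.

Lemma dotmulvv n (v : 'rV[R]_n) : dotmul v v = (\sum_i v ord0 i ^+ 2)%R.
Proof. by rewrite /dotmul mxE; apply: eq_bigr => i _; rewrite !mxE expr2. Qed.

Lemma enorm_gt0 n (v : 'rV[R]_n) : (0 < enorm v)%R = (v != 0%R).
Proof.
rewrite lt_neqAle enorm_ge0 andbT eq_sym; congr (~~ _).
rewrite /enorm sqrtr_eq0 dotmulvv le_eqVlt ltNge sumr_ge0/= ?orbF; last first.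
  by move=> i _; exact: sqr_ge0.
rewrite psumr_eq0; last by move=> i _; exact: sqr_ge0.
apply/allP/eqP => [v0|-> i _]; last by rewrite mxE expr0n eqxx.
apply/rowP => i; apply/eqP; rewrite mxE -sqrf_eq0.
exact: (v0 i (mem_index_enum i)).
Qed.

Lemma le_coord_enorm n (v : 'rV[R]_n) i : (`|v ord0 i| <= enorm v)%R.
Proof.
rewrite -sqrtr_sqr /enorm ler_wsqrtr// dotmulvv (bigD1 i)//= lerDl.
by apply: sumr_ge0 => j _; exact: sqr_ge0.
Qed.

Lemma radialZ n (a : R) (v : 'rV[R]_n) : (0 < a)%R -> radial (a *: v) = radial v.
Proof.
move=> a0; rewrite /radial enormZ ?ltW// scalerA invfM.
by rewrite mulrAC mulVf ?gt_eqF// mul1r.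
Qed.

Lemma sphere_radial n (v : 'rV[R]_n) : (0 < enorm v)%R -> sphere n (radial v).
Proof.
move=> v0; rewrite /sphere/= /radial enormZ ?invr_ge0 ?enorm_ge0//.
by rewrite mulVf ?gt_eqF.
Qed.

Lemma radial_sphere n (v : 'rV[R]_n) : sphere n v -> radial v = v.
Proof. by rewrite /radial => ->; rewrite invr1 scale1r. Qed.

Lemma enorm_radial n (v : 'rV[R]_n) : (0 < enorm v)%R -> enorm v *: radial v = v.
Proof. by move=> v0; rewrite /radial scalerA divff ?gt_eqF// scale1r. Qed.

Lemma measurable_sphere n : measurable (sphere n : set 'rV[R]_n).
Proof.
rewrite (_ : sphere n = @enorm R n @^-1` [set 1%R])//.
by rewrite -[X in measurable X]setTI; exact: measurable_enorm.
Qed.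

Lemma lebesgue_rV_scale n (a : R) (A : set 'rV[R]_n) : (0 < a)%R ->
  measurable A ->
  lebesgue_rV n A = (a ^+ n)%:E * lebesgue_rV n ((fun v => a *: v) @^-1` A).
Proof.
move=> a0 mA.
have mA' : measurable ((fun v : 'rV[R]_n => a *: v) @^-1` A).
  by rewrite -[X in measurable X]setTI; exact: measurable_scale_rV.
rewrite -[in LHS](setIT A) -[in RHS](setIT (_ @^-1` A)).
rewrite -!integral_indic// (ge0_integral_lebesgue_rV_scale a0)//.
by apply/measurable_EFinP; exact: measurable_indic.
Qed.

(** A set of computable volume containing the unit ball and the origin; it only serves to prove
    finiteness of their measures. *)
Let cube n : set 'rV[R]_n := [set v | forall i, (`|v ord0 i| <= 1)%R].

Let measurable_cube n : measurable (@cube n).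
Proof.
rewrite (_ : @cube n = \bigcap_(i in [set: 'I_n])
    (fun v : 'rV[R]_n => v ord0 i) @^-1` `[(-1)%R, 1%R]%classic); last first.
  apply/seteqP; split => v /=.
    by move=> v1 i _ /=; rewrite in_itv/= -ler_norml.
  by move=> v1 i; have := v1 i Logic.I; rewrite /= in_itv/= -ler_norml.
apply: fin_bigcap_measurable => // i _.
rewrite -[X in measurable X]setTI.
by apply: measurable_coord => //; exact: measurable_itv.
Qed.

Let lebesgue_rV_cube_fin n : lebesgue_rV n (@cube n) < +oo.
Proof.
elim: n => [|n IH] /=.
  by rewrite diracE ltry.
rewrite /lebesgue_step /pushforward.
rewrite (_ : @cons_rV R n @^-1` @cube n.+1 =
    (`[(-1)%R, 1%R]%classic : set (measurableTypeR R)) `*` @cube n); last first.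
  apply/seteqP; split => [[x v] /= xv|[x v]/=].
    split => [|i] /=.
      by have := xv ord0; rewrite mxE unlift_none/= in_itv/= ler_norml.
    by have := xv (lift ord0 i); rewrite mxE liftK.
  rewrite in_itv/= -ler_norml => -[x1 v1] i; rewrite mxE.
  by case: unliftP => [j _|_] //=; exact: v1.
rewrite product_measure1E//.
  have I1 : leb `[(-1)%R, 1%R]%classic \is a fin_num.
    by rewrite lebesgue_measure_itv/= lte_fin; case: ifP.
  by rewrite lte_mul_pinfty.
exact: measurable_cube.
Qed.

Definition cone n (E : set 'rV[R]_n) := @radial R n @^-1` E `&` @punctured_ball R n.

Lemma measurable_cone n (E : set 'rV[R]_n) : measurable E -> measurable (cone E).
Proof.
move=> mE; apply: measurableI; last exact: (@measurable_punctured_ball R n).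
by rewrite -[X in measurable X]setTI; exact: measurable_radial.
Qed.

Lemma cone_measure_fin n (E : set 'rV[R]_n) : measurable E ->
  cone_measure E \is a fin_num.
Proof.
move=> mE; rewrite ge0_fin_numE//.
apply: le_lt_trans (lebesgue_rV_cube_fin n).
apply: le_measure; rewrite ?inE.
- exact: measurable_cone.
- exact: measurable_cube.
- by move=> v [_ /andP[_ v1]] i; exact: le_trans (le_coord_enorm v i) v1.
Qed.


(** Scaling by a = b ^ (1 / n) maps the cone in the unit ball onto this set and multiplies volumes
    by a ^ n = b. *)
Lemma lebesgue_rV_cone_ball n (b : R) (E : set 'rV[R]_n) : (0 < n)%N ->
  (0 < b)%R -> measurable E ->
  lebesgue_rV n [set v | [/\ (0 < enorm v)%R, (enorm v ^+ n <= b)%R & E (radial v)]]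
  = b%:E * cone_measure E.
Proof.
move=> n0 b0 mE; pose a := (b `^ n%:R^-1)%R.
have a0 : (0 < a)%R by exact: powR_gt0.
have an : (a ^+ n = b)%R.
  rewrite -powR_mulrn ?ltW// -powRrM mulVf ?pnatr_eq0 -?lt0n//.
  by rewrite powRr1// ltW.
rewrite (@lebesgue_rV_scale _ a)//.
  rewrite an; congr (_ * lebesgue_rV n _).
  apply/seteqP; split => v /=.
    rewrite (enormZ _ (ltW a0)) (radialZ _ a0) pmulr_rgt0//; move=> [v0 vb Ev]; split => //.
    rewrite /punctured_ball/= v0/=; move: vb; rewrite exprMn an ger_pMr//.
    by rewrite expr_le1 ?enorm_ge0// -lt0n.
  move=> [Ev /andP[v0 v1]]; rewrite (enormZ _ (ltW a0)) (radialZ _ a0) pmulr_rgt0//.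
  by split => //; rewrite exprMn an ger_pMr// exprn_ile1// enorm_ge0.
have mS : measurable (@enorm R n @^-1` `]0%R, a] `&` @radial R n @^-1` E).
  apply: measurableI; rewrite -[X in measurable X]setTI.
    by apply: measurable_enorm => //; exact: measurable_itv.
  exact: measurable_radial.
rewrite (_ : [set v | _] = @enorm R n @^-1` `]0%R, a] `&` @radial R n @^-1` E)//.
apply/seteqP; split => v /=; rewrite in_itv/=.
  move=> [v0 vb Ev]; rewrite v0/=; split => //.
  by move: vb; rewrite -an ler_pXn2r ?nnegrE ?enorm_ge0 ?(ltW a0).
by move=> [/andP[v0 va] Ev]; rewrite -an ler_pXn2r ?nnegrE ?enorm_ge0 ?(ltW a0).
Qed.

(** The origin is invariant under doubling, so its finite measure r satisfies r = 2 ^ n * r with n >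
    0. *)
Lemma lebesgue_rV_set0 n : (0 < n)%N -> lebesgue_rV n [set 0%R : 'rV[R]_n] = 0.
Proof.
move=> n0.
have m0 : measurable [set 0%R : 'rV[R]_n].
  by apply: measurable_closed_rV; apply: accessible_closed_set1;
    apply: hausdorff_accessible; exact: norm_hausdorff.
have fin0 : lebesgue_rV n [set 0%R : 'rV[R]_n] \is a fin_num.
  rewrite ge0_fin_numE//; apply: le_lt_trans (lebesgue_rV_cube_fin n).
  apply: le_measure; rewrite ?inE//; first exact: measurable_cube.
  by move=> v -> i; rewrite mxE normr0.
have := @lebesgue_rV_scale n 2%R _ (ltr0n _ 2) m0.
rewrite (_ : _ @^-1` _ = [set 0%R]); last first.
  apply/seteqP; split => v /= => [/eqP|->]; last by rewrite scaler0.
  by rewrite scaler_eq0 pnatr_eq0/= => /eqP.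
move: fin0; move: (lebesgue_rV n [set 0%R]) => [r| |]// _.
rewrite -EFinM => -[] /eqP; rewrite -subr_eq0 -{1}(mul1r r) -mulrBl mulf_eq0.
rewrite subr_eq0 lt_eqF//= => [/eqP -> //|].
by rewrite exprn_egt1 ?ltr1n// -lt0n.
Qed.

Let polar n (v : 'rV[R]_n) : 'rV[R]_n * measurableTypeR R :=
  (radial v, (enorm v ^+ n)%R).

Let measurable_polar n : measurable_fun setT (@polar n).
Proof.
apply: measurable_fun_pair => /=; first exact: measurable_radial.
by apply: measurable_funX; exact: measurable_enorm.
Qed.

Let punctured n : set 'rV[R]_n := [set v | (0 < enorm v)%R].

Let measurable_punctured n : measurable (@punctured n).
Proof.
rewrite (_ : @punctured n = @enorm R n @^-1` `]0%R, +oo[).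
  rewrite -[X in measurable X]setTI.
  by apply: measurable_enorm => //; exact: measurable_itv.
by apply/seteqP; split => v; rewrite /punctured/= in_itv/= andbT.
Qed.

Let pos : set (measurableTypeR R) := `]0%R, +oo[%classic.

Lemma pushforward_measure d1 d2 (T1 : measurableType d1) (T2 : measurableType d2)
    (m : {measure set T1 -> \bar R}) (f : T1 -> T2) : measurable_fun setT f ->
  exists nu : {measure set T2 -> \bar R}, forall A, nu A = m (f @^-1` A).
Proof.
move=> mf.
by exists (measure_function_pushforward__canonical__measure_function_Measure m mf).
Qed.

(** For fixed E both sides are measures in B without mass on ]-oo, 0], so only B = ]0, b] remains,
    which is the volume of a truncated cone. *)
Lemma lebesgue_rV_polar_rect n (E : set 'rV[R]_n) (B : set (measurableTypeR R)) :
  (0 < n)%N -> measurable E -> measurable B ->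
  lebesgue_rV n (@polar n @^-1` (E `*` B) `&` @punctured n) =
  cone_measure E * leb (B `&` pos).
Proof.
move=> n0 mE mB.
have mpos : measurable pos by exact: measurable_itv.
have mD : measurable (@radial R n @^-1` E `&` @punctured n).
  by apply: measurableI => //; rewrite -[X in measurable X]setTI; exact: measurable_radial.
have mX : @measurable_fun _ _ _ (measurableTypeR R) setT
    (fun v : 'rV[R]_n => enorm v ^+ n)%R.
  by apply: measurable_funX; exact: measurable_enorm.
have c0 : (0 <= fine (cone_measure E))%R by rewrite fine_ge0.
pose m2 : {measure set (measurableTypeR R) -> \bar R} :=
  mscale (NngNum c0) (mrestr leb mpos).
have [m1 m1E] : exists m1 : {measure set (measurableTypeR R) -> \bar R},
    forall B', m1 B' = lebesgue_rV n (@polar n @^-1` (E `*` B') `&` @punctured n).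
  have [m1 m1E] := pushforward_measure (mrestr (lebesgue_rV n) mD) mX.
  exists m1 => B'; rewrite m1E [LHS](_ : _ = lebesgue_rV n
    ((fun v => enorm v ^+ n)%R @^-1` B' `&` (@radial R n @^-1` E `&` @punctured n)))//.
  by rewrite setIA (setIC (_ @^-1` B')).
have m2E B' : m2 B' = cone_measure E * leb (B' `&` pos).
  rewrite [LHS](_ : _ = (fine (cone_measure E))%:E * leb (B' `&` pos))//.
  by rewrite fineK// cone_measure_fin.
rewrite -m1E -m2E; apply: measure_unique_half_line => //.
- rewrite m1E (_ : _ `&` _ = set0) ?measure0//.
  apply/seteqP; split => // v [[_ /=]]; rewrite in_itv/= /punctured/=.
  by move=> + v0; rewrite leNgt exprn_gt0.
- rewrite m2E (_ : _ `&` _ = set0) ?measure0 ?mule0//.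
  apply/seteqP; split => // x []; rewrite /pos/= !in_itv/= andbT.
  by move=> /le_gtF ->.
- move=> b b0; rewrite m1E m2E.
  rewrite (_ : `]0%R, b]%classic `&` pos = `]0%R, b]%classic); last first.
    apply/setIidPl; rewrite /pos; apply: subset_itvl; exact.
  rewrite lebesgue_measure_itv/= lte_fin b0 sube0 muleC -lebesgue_rV_cone_ball//.
  congr (lebesgue_rV n _); apply/seteqP; split => v /=; rewrite /punctured/=.
    by move=> [[Ev]]; rewrite in_itv/= => /andP[_ vb] v0.
  by move=> [v0 vb Ev]; rewrite in_itv/= exprn_gt0.
- move=> b b0; rewrite m1E.
  apply: (@le_lt_trans _ _ (lebesgue_rV n [set v |
    [/\ (0 < enorm v)%R, (enorm v ^+ n <= b)%R & E (radial v)]])).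
    rewrite le_eqVlt; apply/orP; left; apply/eqP.
    congr (lebesgue_rV n _); apply/seteqP; split => v /=; rewrite /punctured/=.
      by move=> [[Ev]]; rewrite in_itv/= => /andP[_ vb] v0.
    by move=> [v0 vb Ev]; rewrite in_itv/= exprn_gt0.
  by rewrite lebesgue_rV_cone_ball// lte_mul_pinfty ?lee_fin ?ltW// ltey_eq cone_measure_fin.
Qed.

End polar_coordinates.

Section sigma_finite_pack.
Context d (T : measurableType d) (R : realType).
Variables (m : {measure set T -> \bar R}) (m_sf : sigma_finite setT m).

Let m_copy : set T -> \bar R := m.

HB.instance Definition _ := isMeasure.Build _ _ _ m_copy (measure0 m)
  (measure_ge0 m) (@measure_semi_sigma_additive _ _ _ m).

HB.instance Definition _ := Measure_isSigmaFinite.Build _ _ _ m_copy m_sf.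

(* Gives access to results stated for the structure of sigma-finite measures. *)
Lemma sigma_finite_measure_pack :
  exists m' : {sigma_finite_measure set T -> \bar R},
    m = (m' : {measure set T -> \bar R}).
Proof. by exists m_copy; exact/eq_measure. Qed.

End sigma_finite_pack.

(** * Integration over rectangles and in polar coordinates *)

Section fubini_on_rectangles.
Local Open Scope ereal_scope.
Context d1 d2 (T1 : measurableType d1) (T2 : measurableType d2) (R : realType).
Variables (m1 : {measure set T1 -> \bar R}) (m2 : {sigma_finite_measure set T2 -> \bar R}).
Variables (A : set T1) (B : set T2) (f : T1 * T2 -> \bar R).
Hypotheses (mA : measurable A) (mB : measurable B).
Hypotheses (mf : measurable_fun (A `*` B) f)
  (f0 : forall x y, A x -> B y -> 0 <= f (x, y)).

Let mfAB : measurable_fun setT (f \_ (A `*` B)).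
Proof. by apply/(measurable_restrictT f) => //; exact: measurableX. Qed.

Let fAB_ge0 p : 0 <= (f \_ (A `*` B)) p.
Proof.
rewrite patchE; case: ifPn => // /[!inE] -[]; case: p => x y /=; exact: f0.
Qed.

Let fABE x : A x -> \int[m2]_y (f \_ (A `*` B)) (x, y) = \int[m2]_(y in B) f (x, y).
Proof.
move=> Ax; rewrite [RHS]integral_mkcond; apply: eq_integral => y _.
by rewrite !patchE in_setX mem_set.
Qed.

Lemma measurable_fun_integral_setX :
  measurable_fun A (fun x => \int[m2]_(y in B) f (x, y)).
Proof.
apply: (eq_measurable_fun (fun x => \int[m2]_y (f \_ (A `*` B)) (x, y))).
  by move=> x /[!inE]; exact: fABE.
apply: measurable_funTS.
exact: (@measurable_fun_fubini_tonelli_F _ _ _ _ _ m2 (f \_ (A `*` B))).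
Qed.

(** Sigma-finiteness of [m1] is a premise rather than a structure because the lemma is applied to
    [cone_measure] and to the measure on B, which are plain measures. Extension of [f] by zero
    reduces to Tonelli's theorem on the whole product. *)
Lemma ge0_fubini_setX : sigma_finite setT m1 ->
  \int[m1 \x m2]_(p in A `*` B) f p = \int[m1]_(x in A) \int[m2]_(y in B) f (x, y).
Proof.
move=> /sigma_finite_measure_pack[m1' ->].
rewrite [LHS]integral_mkcond.
transitivity (\int[m1']_x \int[m2]_y (f \_ (A `*` B)) (x, y)).
  exact: (@fubini_tonelli1 _ _ _ _ _ m1' m2 (f \_ (A `*` B))).
rewrite [RHS]integral_mkcond; apply: eq_integral => x _.
rewrite patchE; case: ifPn => [/[!inE]|/negP Ax]; first exact: fABE.
by apply: integral0_eq => y _; rewrite patchE in_setX; case: ifPn => // /andP[].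
Qed.

End fubini_on_rectangles.

Section polar_integral.
Local Open Scope ereal_scope.
Context {R : realType}.
Notation leb := (@lebesgue_measure R).

Let polar n (v : 'rV[R]_n) : 'rV[R]_n * measurableTypeR R :=
  (radial v, (enorm v ^+ n)%R).

Let measurable_polar n : measurable_fun setT (@polar n).
Proof.
apply: measurable_fun_pair => /=; first exact: measurable_radial.
by apply: measurable_funX; exact: measurable_enorm.
Qed.

Let punctured n : set 'rV[R]_n := [set v | (0 < enorm v)%R].

Let measurable_punctured n : measurable (@punctured n).
Proof.
rewrite (_ : @punctured n = @enorm R n @^-1` `]0%R, +oo[).
  rewrite -[X in measurable X]setTI.
  by apply: measurable_enorm => //; exact: measurable_itv.
by apply/seteqP; split => v; rewrite /punctured/= in_itv/= andbT.
Qed.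

Let pos : set (measurableTypeR R) := `]0%R, +oo[%classic.

Let measurable_pos : measurable pos. Proof. exact: measurable_itv. Qed.

Lemma sigma_finite_cone_measure n : sigma_finite setT (@cone_measure R n).
Proof.
exists (fun=> setT); first by rewrite bigcup_const.
by move=> k; split => //; rewrite ltey_eq cone_measure_fin.
Qed.

Let product_polar n (E : set ('rV[R]_n * measurableTypeR R)) : (0 < n)%N ->
  measurable E -> E `<=` setT `*` pos ->
  (@cone_measure R n \x leb) E = lebesgue_rV n (@polar n @^-1` E `&` @punctured n).
Proof.
move=> n0 mE ED.
have [cm cmE] := sigma_finite_measure_pack (@sigma_finite_cone_measure n).
have [m1 m1E] := pushforward_measure (mrestr (lebesgue_rV n) (@measurable_punctured n))
  (@measurable_polar n).
have mN : measurable ([set: 'rV[R]_n] `*` ~` pos).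
  by apply: measurableX => //; exact: measurableC.
(* [product_measure_unique] tests every rectangle, also those leaving the half line, where the
   pushforward [m1] has no mass. Adding the product measure there makes both sides agree on all
   rectangles. *)
pose m' := measure_add m1 (mrestr (cm \x leb) mN).
have m'E X : measurable X -> m' X = m1 X + (cm \x leb) (X `&` ([set: 'rV[R]_n] `*` ~` pos)).
  by move=> mX; rewrite /m' measure_addE.
have cmE' X : cm X = cone_measure X by rewrite [RHS](congr1 (fun m : {measure set _ -> \bar R} => m X) cmE).
transitivity ((cm \x leb) E).
  exact: (congr1 (fun m : {measure set 'rV[R]_n -> \bar R} => (m \x leb) E) cmE).
rewrite (@product_measure_unique _ _ _ _ _ cm leb m')//.
  apply: etrans (m'E _ mE) _; rewrite m1E (_ : E `&` _ = set0) ?measure0 ?adde0//.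
  by apply/seteqP; split => // p [/ED[_ p2] [_ /(_ p2)]].
move=> A B mA mB; apply: etrans (m'E _ (measurableX mA mB)) _; rewrite m1E.
transitivity (cone_measure A * leb (B `&` pos) +
    (cm \x leb) (A `*` B `&` [set: 'rV[R]_n] `*` ~` pos)).
  by congr (_ + _); exact: lebesgue_rV_polar_rect.
rewrite -setXI setIT product_measure1E//; last first.
  by apply: measurableI => //; exact: measurableC.
rewrite -cmE' -ge0_muleDr// -measureU//.
- by rewrite -setIUr setUv setIT.
- exact: measurableI.
- by apply: measurableI => //; exact: measurableC.
- by rewrite setIACA setICr setI0.
Qed.

Lemma ge0_integral_polar n (f : 'rV[R]_n -> \bar R) : (0 < n)%N ->
  measurable_fun setT f -> (forall v, 0 <= f v) ->
  \int[lebesgue_rV n]_v f v =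
  \int[@cone_measure R n]_(t in sphere n)
    \int[leb]_(w in `]0%R, +oo[) f ((w `^ n%:R^-1)%R *: t).
Proof.
move=> n0 mf f0; pose D : set ('rV[R]_n * measurableTypeR R) := sphere n `*` pos.
pose h (p : 'rV[R]_n * measurableTypeR R) : 'rV[R]_n := (p.2 `^ n%:R^-1)%R *: p.1.
have mh : measurable_fun setT h.
  apply: measurable_fun_rV => i; rewrite (_ : (fun x => _) =
      fun p : 'rV[R]_n * measurableTypeR R => (p.2 `^ n%:R^-1 * p.1 ord0 i)%R).
    apply: measurable_funM.
      by apply: (measurableT_comp (measurable_powR _)); exact: measurable_snd.
    by apply: (measurableT_comp (measurable_coord i)); exact: measurable_fst.
  by apply/funext => p; rewrite mxE.
have mD : measurable D by apply: measurableX => //; exact: measurable_sphere.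
have polarh p : D p -> polar (h p) = p /\ punctured (h p).
  case: p => t w [/= t1]; rewrite /pos/= in_itv/= andbT => w0.
  have a0 := powR_gt0 n%:R^-1 w0.
  rewrite /polar /h /punctured/= radialZ// radial_sphere// enormZ ?ltW// t1 mulr1.
  split => //; congr pair.
  by rewrite -powR_mulrn ?ltW// -powRrM mulVf ?pnatr_eq0 -?lt0n// powRr1// ltW.
have hpolar v : punctured v -> h (polar v) = v /\ D (polar v).
  move=> v0; rewrite /h/= -powR_mulrn ?enorm_ge0// -powRrM mulfV ?pnatr_eq0 -?lt0n//.
  rewrite powRr1 ?enorm_ge0// enorm_radial//; split => //; split => /=.
    exact: sphere_radial.
  by rewrite /pos/= in_itv/= andbT exprn_gt0.
have hE E : E `<=` D -> h @` E = @polar n @^-1` E `&` @punctured n.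
  move=> ED; apply/seteqP; split => [_ [p Ep <-]|v [Ev v0]].
    by have [pE hp] := polarh _ (ED _ Ep); split; rewrite //= pE.
  by exists (polar v) => //; have [] := hpolar _ v0.
have hD : h @` D = @punctured n.
  rewrite hE//; apply/seteqP; split => [v []//|v v0]; split => //.
  by have [] := hpolar _ v0.
(* The origin, where the direction is undefined, is a null set. *)
transitivity (\int[lebesgue_rV n]_(v in @punctured n) f v).
  rewrite [RHS]integral_mkcond; apply: ge0_ae_eq_integral => //.
  - apply/(measurable_restrictT f); last exact: measurable_funTS.
    exact: measurable_punctured.
  - by move=> v _; apply: erestrict_ge0.
  - exists [set 0%R]; split.
    + by apply: measurable_closed_rV; apply: accessible_closed_set1;
        apply: hausdorff_accessible; exact: norm_hausdorff.
    + exact: lebesgue_rV_set0.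
    + move=> v /=; apply: contra_notP => v0 _; rewrite patchE mem_set//.
      by rewrite /punctured/= enorm_gt0; apply/eqP.
rewrite -hD (@ge0_change_of_variables _ _ _ _ R (@cone_measure R n \x leb) _ D h (fun=> 1%R))//.
- apply: etrans; first apply: (@ge0_fubini_setX _ _ _ _ R (@cone_measure R n)
      leb (sphere n) pos (fun p => f (h p) * 1)) => //.
  + exact: measurable_sphere.
  + apply: emeasurable_funM => //; apply: measurable_funTS.
    exact: (measurableT_comp mf).
  + by move=> *; rewrite mule1.
  + exact: sigma_finite_cone_measure.
  + by apply: eq_integral => t _; apply: eq_integral => w _; rewrite mule1.
- by rewrite hD; exact: measurable_punctured.
- exact: measurable_funTS.
- move=> E mE ED; rewrite integral_cst// mul1e hE//.
  by apply/esym; apply: product_polar => // p /ED[].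
- exact: measurable_funTS.
Qed.

Lemma ge0_integral_surface_measure n (D : set 'rV[R]_n) (f : 'rV[R]_n -> \bar R) :
  measurable D -> measurable_fun D f -> (forall v, D v -> 0 <= f v) ->
  \int[@surface_measure R n]_(t in D) f t = n%:R%:E * \int[@cone_measure R n]_(t in D) f t.
Proof.
move=> mD mf f0.
rewrite (eq_measure_integral (mscale (NngNum (ler0n R n)) (@cone_measure R n)))//.
by rewrite ge0_integral_mscale.
Qed.

End polar_integral.

(** * The upper incomplete gamma function *)

Section gamma_integrals.
Context {R : realType}.
Notation leb := (@lebesgue_measure R).

Lemma dominated_cvg_seq d (T : measurableType d) (mu : {measure set T -> \bar R})
    (D : set T) (f_ : nat -> T -> R) (f h : T -> R) : measurable D ->
  (forall n, measurable_fun D (f_ n)) ->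
  (forall x, D x -> f_ n x @[n --> \oo] --> f x) ->
  mu.-integrable D (EFin \o h) ->
  (forall n x, D x -> `|f_ n x| <= h x) ->
  mu.-integrable D (EFin \o f) /\
  (\int[mu]_(x in D) (f_ n x)%:E @[n --> \oo] --> \int[mu]_(x in D) (f x)%:E)%E.
Proof.
move=> mD mf_ f_f ih f_h.
have mf : measurable_fun D f by exact: measurable_fun_cvg f_f.
have [] := @dominated_convergence _ _ _ mu _ mD (fun n x => (f_ n x)%:E)
  (EFin \o f) (EFin \o h).
- by move=> n; exact/measurable_EFinP.
- exact/measurable_EFinP.
- by apply: aeW => x Dx; apply: cvg_EFin; [exact: nearW|exact: f_f].
- exact: ih.
- by apply: aeW => x n Dx; rewrite lee_fin; exact: f_h.
by [].
Qed.

Lemma integral_expRN (a : R) : 0 < a ->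
  (\int[leb]_(t in `[0%R, +oo[) (expR (- (a * t)))%:E = (a^-1)%:E)%E.
Proof.
move=> a0.
have dF (t : R) : is_derive t (1:R) (fun t => - a^-1 * expR (- (a * t))) (expR (- (a * t))).
  have -> : expR (- (a * t)) = - a^-1 * (expR (- (a * t)) * (- (a * 1))).
    by rewrite mulr1 mulrN mulrNN mulrCA mulVf ?gt_eqF// mulr1.
  by apply: is_deriveZ.
rewrite (@ge0_continuous_FTC2y _ _ (fun t => - a^-1 * expR (- (a * t))) 0 0).
- by rewrite mulr0 oppr0 expR0 mulr1 -EFinB sub0r opprK.
- by move=> t _; exact: expR_ge0.
- apply: continuous_subspaceT => t.
  apply: continuous_comp; last exact: continuous_expR.
  by apply: cvgN; apply: cvgMr; exact: cvg_id.
- rewrite -[X in _ --> X](mulr0 (- a^-1)); apply: cvgMr.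
  apply: (cvg_comp (fun t => a * t) (fun t => expR (- t))); last exact: cvgr_expR.
  by apply: gt0_cvgMry => //; exact: cvg_id.
- by move=> t _; exact: (@ex_derive _ _ _ _ _ _ _ (dF t)).
- have /derivable1_diffP/differentiable_continuous := @ex_derive _ _ _ _ _ _ _ (dF 0).
  exact: cvg_at_right_filter.
- by move=> t _; rewrite derive1E; exact: (@derive_val _ _ _ _ _ _ _ (dF t)).
Qed.

(** For p > 0 raise x <= exp x, at x = a * t / p, to the power p; this is where the constant (p / a)
    ^ p comes from. *)
Lemma powR_le_expR (p a : R) : 0 < a ->
  exists2 K : R, 0 < K & forall t, 1 <= t -> t `^ p <= K * expR (a * t).
Proof.
move=> a0; have [p0|p0] := leP p 0.
  exists 1 => // t t1; rewrite mul1r (@le_trans _ _ 1)//.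
    by rewrite -(powRr0 t) ler_powR.
  rewrite -expR0 ler_expR mulr_ge0 ?(ltW a0)//; exact: le_trans t1.
exists ((p / a) `^ p); first by rewrite powR_gt0// divr_gt0.
move=> t t1; have t0 : 0 < t by exact: lt_le_trans t1.
rewrite (_ : expR (a * t) = expR (a * t / p) `^ p); last first.
  by rewrite -expRM mulrC divfK ?gt_eqF.
rewrite -powRM ?divr_ge0 ?expR_ge0 ?(ltW p0) ?(ltW a0)//.
rewrite ge0_ler_powR ?nnegrE ?(ltW p0) ?(ltW t0)//.
  by rewrite mulr_ge0 ?divr_ge0 ?expR_ge0 ?(ltW p0) ?(ltW a0).
apply: (@le_trans _ _ (p / a * (a * t / p))).
  rewrite [leRHS](_ : _ = t)//; field.
  by rewrite !gt_eqF.
rewrite ler_pM2l ?divr_gt0//.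
by rewrite (le_trans _ (expR_ge1Dx _))// lerDr.
Qed.


Definition gamma_fun (s t : R) := t `^ (s - 1) * expR (- t).

Lemma gamma_fun_ge0 s t : 0 <= gamma_fun s t.
Proof. by rewrite mulr_ge0 ?powR_ge0 ?expR_ge0. Qed.

Lemma gamma_fun_gt0 s t : 0 < t -> 0 < gamma_fun s t.
Proof. by move=> t0; rewrite mulr_gt0 ?powR_gt0 ?expR_gt0. Qed.

Lemma measurable_gamma_fun s D : measurable_fun D (gamma_fun s).
Proof.
apply: measurable_funTS; apply: measurable_funM; first exact: measurable_powR.
by apply: measurableT_comp => //; exact: measurable_expR.
Qed.

Lemma integrable_gamma_fun s : 0 < s ->
  leb.-integrable `]0, +oo[ (EFin \o gamma_fun s).
Proof.
move=> s0; rewrite (_ : `]0, +oo[%classic = `]0, 1] `|` `]1, +oo[); last first.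
  by rewrite -itv_bndbnd_setU// bnd_simp.
have mg D : measurable_fun D (EFin \o gamma_fun s).
  by apply/measurable_EFinP; exact: measurable_gamma_fun.
have mga D : measurable_fun D (fun t => `|gamma_fun s t|%:E).
  apply/measurable_EFinP; apply: measurableT_comp => //.
  exact: measurable_gamma_fun.
apply/integrableP; split; first exact: mg.
rewrite ge0_integral_setU//=; last 2 first.
- exact: mga.
- apply/disj_setPS => t [/=]; rewrite !in_itv/= andbT => /andP[_ t1].
  by rewrite ltNge t1.
apply: lte_add_pinfty.
(* Near 0 the exponential is at most 1. The factor s / s brings the power into the form of
   [integral_powR_oc]. *)
- apply: (@le_lt_trans _ _ (\int[leb]_(t in `]0%R, 1%R]) (s * t `^ (s - 1) / s)%:E)%E).
    apply: ge0_le_integral => //.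
    + exact: mga.
    + apply/measurable_EFinP; apply: measurable_funM => //; apply: measurable_funM => //.
      by apply: measurable_funTS; exact: measurable_powR.
    + move=> t /=; rewrite in_itv/= => /andP[t0 _].
      rewrite lee_fin ger0_norm ?gamma_fun_ge0// mulrAC mulfV ?gt_eqF// mul1r.
      by rewrite /gamma_fun ler_piMr ?powR_ge0// -expR0 ler_expR oppr_le0 ltW.
  apply: (@le_lt_trans _ _ (s^-1%:E * \int[leb]_(t in `]0%R, 1%R]) (s * t `^ (s - 1))%:E)%E); last first.
    by rewrite integral_powR_oc// -EFinM ltry.
  under eq_integral do rewrite EFinM muleC.
  rewrite le_eqVlt; apply/orP; left; apply/eqP.
  apply: ge0_integralZl_EFin => //.
  + by move=> t _; rewrite lee_fin mulr_ge0 ?powR_ge0// ltW.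
  + apply/measurable_EFinP; apply: measurable_funM => //.
    by apply: measurable_funTS; exact: measurable_powR.
  + by rewrite invr_ge0 ltW.
(* Beyond 1, half of the exponential pays for the power and the other half is integrable. *)
- have h0 : 0 < 2^-1 :> R by rewrite invr_gt0.
  have [K K0 hK] := powR_le_expR (s - 1) h0.
  have mE D : measurable_fun D (fun t : R => (expR (- (2^-1 * t)))%:E).
    apply/measurable_EFinP; apply: measurable_funTS; apply: measurableT_comp => //.
    by apply: measurableT_comp => //; exact: measurable_funM.
  have mKE D : measurable_fun D (fun t : R => (K * expR (- (2^-1 * t)))%:E).
    by apply/measurable_EFinP; apply: measurable_funM => //; apply/measurable_EFinP.
  apply: (@le_lt_trans _ _ (\int[leb]_(t in `[0%R, +oo[) (K * expR (- (2^-1 * t)))%:E)%E).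
    apply: (@le_trans _ _ (\int[leb]_(t in `]1%R, +oo[) (K * expR (- (2^-1 * t)))%:E)%E).
      apply: ge0_le_integral => //.
      + exact: mga.
      + exact: mKE.
      + move=> t /=; rewrite in_itv/= andbT => t1.
        rewrite lee_fin ger0_norm ?gamma_fun_ge0// /gamma_fun.
        apply: (@le_trans _ _ (K * expR (2^-1 * t) * expR (- t))).
          by rewrite ler_pM2r ?expR_gt0// hK// ltW.
        by rewrite -mulrA -expRD ler_pM2l// ler_expR; lra.
    apply: ge0_subset_integral => //.
    + exact: mKE.
    + by move=> t _; rewrite lee_fin mulr_ge0 ?expR_ge0// ltW.
    + by apply: subset_itvr; rewrite bnd_simp.
  apply: (@le_lt_trans _ _ (K%:E * \int[leb]_(t in `[0%R, +oo[) (expR (- (2^-1 * t)))%:E)%E).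
    under eq_integral do rewrite EFinM.
    rewrite le_eqVlt; apply/orP; left; apply/eqP.
    apply: ge0_integralZl_EFin => //; last exact: ltW.
    exact: mE.
  by rewrite integral_expRN// -EFinM ltry.
Qed.

Lemma GammaE s : 0 < s ->
  (\int[leb]_(t in `]0%R, +oo[) (gamma_fun s t)%:E = (Gamma s)%:E)%E.
Proof.
move=> s0; rewrite /Gamma /Rintegral fineK//.
exact: integrable_fin_num (integrable_gamma_fun s0).
Qed.

(** The upper incomplete gamma function; at y = 0 it is [Gamma s]. *)
Definition igamma (s y : R) : R := \int[leb]_(t in `]y, +oo[) gamma_fun s t.

Lemma igammaE s y : 0 < s -> 0 <= y ->
  (\int[leb]_(t in `]y, +oo[) (gamma_fun s t)%:E = (igamma s y)%:E)%E.
Proof.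
move=> s0 y0; rewrite /igamma /Rintegral fineK//.
apply: integrable_fin_num => //.
apply: integrableS (integrable_gamma_fun s0) => //.
by apply: subset_itvr; rewrite bnd_simp.
Qed.

Lemma igamma_ge0 s y : 0 <= igamma s y.
Proof. by apply: Rintegral_ge0 => t _; exact: gamma_fun_ge0. Qed.

Lemma ler_igamma s y y' : 0 < s -> 0 <= y -> y <= y' -> igamma s y' <= igamma s y.
Proof.
move=> s0 y0 yy'; rewrite -lee_fin -!igammaE//; last exact: le_trans yy'.
apply: ge0_subset_integral => //.
- by apply/measurable_EFinP; exact: measurable_gamma_fun.
- by move=> t _; rewrite lee_fin gamma_fun_ge0.
- by apply: subset_itvr; rewrite bnd_simp.
Qed.

(** A vanishing integral would force the integrand to vanish almost everywhere, whereas it is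
    positive on ]0, 1]. *)
Lemma Gamma_gt0 (s : R) : 0 < s -> 0 < Gamma s.
Proof.
move=> s0; rewrite lt_neqAle; apply/andP; split; last first.
  by apply: Rintegral_ge0 => t _; exact: gamma_fun_ge0.
apply/eqP => G0.
have := GammaE s0; rewrite -G0 => I0.
have /ae_eq_integral_abs : measurable_fun (`]0, +oo[ : set (measurableTypeR R)) (EFin \o gamma_fun s).
  by apply/measurable_EFinP; exact: measurable_gamma_fun.
move=> /(_ leb (measurable_itv _))[+ _].
under eq_integral do rewrite gee0_abs ?lee_fin ?gamma_fun_ge0//.
move=> /(_ I0)[N [mN N0 subN]].
have : leb `]0, 1] = 0%E.
  apply: (subset_measure0 _ mN _ N0) => //.
  move=> t /=; rewrite in_itv/= => /andP[t0 _]; apply: subN => /=.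
  rewrite in_itv/= andbT => /(_ t0)[] /eqP.
  by rewrite gt_eqF// gamma_fun_gt0.
by rewrite lebesgue_measure_itv/= lte_fin ltr01 sube0 => -[] /eqP; rewrite oner_eq0.
Qed.

End gamma_integrals.

Section incomplete_gamma.
Context {R : realType}.
Notation leb := (@lebesgue_measure R).

Lemma integrable_dominated d (T : measurableType d) (mu : {measure set T -> \bar R})
    (D : set T) (f g : T -> R) : measurable D -> measurable_fun D f ->
  (forall x, D x -> `|f x| <= g x) -> mu.-integrable D (EFin \o g) ->
  mu.-integrable D (EFin \o f).
Proof.
move=> mD mf fg; apply: le_integrable => //; first exact/measurable_EFinP.
by move=> x Dx; rewrite lee_fin (le_trans (fg _ Dx))// ler_norm.
Qed.

Lemma integrable_expRN (a : R) : 0 < a ->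
  leb.-integrable `]0, +oo[ (fun t : R => (expR (- (a * t)))%:E).
Proof.
move=> a0.
have mE D : measurable_fun D (fun t : R => (expR (- (a * t)))%:E).
  apply/measurable_EFinP; apply: measurable_funTS; apply: measurableT_comp => //.
  by apply: measurableT_comp => //; exact: measurable_funM.
apply/integrableP; split; first exact: mE.
apply: (@le_lt_trans _ _ (\int[leb]_(t in `[0%R, +oo[) (expR (- (a * t)))%:E)%E).
  under eq_integral do rewrite gee0_abs ?lee_fin ?expR_ge0//.
  apply: ge0_subset_integral => //; first exact: mE.
  by apply: subset_itvr; rewrite bnd_simp.
by rewrite integral_expRN// ltry.
Qed.

Lemma cvg_powR (T : Type) (F : set_system T) (FF : Filter F) (p l : R) (w : T -> R) :
  0 < l -> w x @[x --> F] --> l -> w x `^ p @[x --> F] --> l `^ p.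
Proof.
move=> l0 wl; apply: (cvg_comp w (fun x => x `^ p)); first exact: wl.
exact: continuous_powR.
Qed.

(* What is left of igamma s y after translating the integration variable by y and
   factoring out the leading term y ^ (s - 1) * exp (- y). *)
Definition igamma_ratio (s y : R) : R :=
  \int[leb]_(t in `]0, +oo[) ((1 + t / y) `^ (s - 1) * expR (- t)).

Let ratio_fun (s y t : R) := (1 + t / y) `^ (s - 1) * expR (- t).

Let measurable_ratio_fun s y D : measurable_fun D (ratio_fun s y).
Proof.
apply: measurable_funTS; apply: measurable_funM.
  apply: (measurableT_comp (measurable_powR _)).
  by apply: measurable_funD => //; exact: measurable_funM.
by apply: measurableT_comp => //; exact: measurable_expR.
Qed.

Let ratio_fun_ge0 s y t : 0 <= ratio_fun s y t.
Proof. by rewrite mulr_ge0 ?powR_ge0 ?expR_ge0. Qed.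

(** A majorant common to all y >= y0; since 1 + t / y >= 1, the absolute value of the exponent
    covers both signs of s - 1. *)
Let ratio_dom (s y0 t : R) := (1 + t / y0) `^ `|s - 1| * expR (- t).

Let ratio_fun_le s y0 y t : 0 < y0 -> y0 <= y -> 0 <= t ->
  `|ratio_fun s y t| <= ratio_dom s y0 t.
Proof.
move=> y00 y0y t0; rewrite ger0_norm ?ratio_fun_ge0// /ratio_fun /ratio_dom.
have y_gt0 : 0 < y by exact: lt_le_trans y0y.
rewrite ler_pM2r ?expR_gt0//.
have t1 : 1 <= 1 + t / y by rewrite lerDl divr_ge0// ltW.
apply: (@le_trans _ _ ((1 + t / y) `^ `|s - 1|)).
  by rewrite ler_powR// ler_norm.
rewrite ge0_ler_powR ?nnegrE//; first by rewrite (le_trans _ t1).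
  by rewrite addr_ge0// divr_ge0// ltW.
by rewrite lerD2l ler_wpM2l// lef_pV2 ?posrE.
Qed.

Let integrable_ratio_dom s y0 : 0 < y0 ->
  leb.-integrable `]0, +oo[ (EFin \o ratio_dom s y0).
Proof.
move=> y00.
(* At the rate y0 / 2 the bound exp (y0 / 2 * (1 + t / y0)) grows only like exp (t / 2), and exp (-
   t / 2) is left over. *)
have h0 : 0 < y0 / 2 by rewrite divr_gt0.
have h0' : 0 < 2^-1 :> R by rewrite invr_gt0.
have [K K0 hK] := powR_le_expR `|s - 1| h0.
have hb t : 0 <= t -> ratio_dom s y0 t <= K * expR (y0 / 2) * expR (- (2^-1 * t)).
  move=> t0; rewrite /ratio_dom.
  have t1 : 1 <= 1 + t / y0 by rewrite lerDl divr_ge0// ltW.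
  apply: (@le_trans _ _ (K * expR (y0 / 2 * (1 + t / y0)) * expR (- t))).
    by rewrite ler_pM2r ?expR_gt0// hK.
  rewrite -!mulrA -!expRD ler_pM2l// ler_expR le_eqVlt; apply/orP; left.
  by apply/eqP; field; rewrite gt_eqF.
apply: (integrable_dominated
  (g := fun t : measurableTypeR R => K * expR (y0 / 2) * expR (- (2^-1 * t)))) => //.
- apply: measurable_funTS; apply: measurable_funM.
    apply: (measurableT_comp (measurable_powR _)).
    by apply: measurable_funD => //; exact: measurable_funM.
  by apply: measurableT_comp => //; exact: measurable_expR.
- move=> t /=; rewrite in_itv/= andbT => t0.
  rewrite ger0_norm ?mulr_ge0 ?expR_ge0 ?powR_ge0//.
  by rewrite hb// ltW.
- have i1 := integrable_expRN h0'.
  have mI : measurable (`]0, +oo[ : set (measurableTypeR R)) by exact: measurable_itv.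
  exact: (integrableZl mI (K * expR (y0 / 2)) i1).
Qed.

Let ratio_cvg (s : R) (u : nat -> R) (y0 : R) (v : R -> R) : 0 < y0 ->
  (forall n, y0 <= u n) ->
  (forall t, 0 < t -> ratio_fun s (u n) t @[n --> \oo] --> v t) ->
  igamma_ratio s (u n) @[n --> \oo] --> \int[leb]_(t in `]0, +oo[) v t.
Proof.
move=> y00 uy0 uv.
have [|||||iv] := @dominated_cvg_seq R _ _ leb `]0, +oo[%classic
  (fun n => ratio_fun s (u n)) v (ratio_dom s y0).
- exact: measurable_itv.
- by move=> n; exact: measurable_ratio_fun.
- by move=> t /=; rewrite in_itv/= andbT; exact: uv.
- exact: integrable_ratio_dom.
- move=> n t /=; rewrite in_itv/= andbT => t0; apply: ratio_fun_le => //.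
  exact: ltW.
have fv := integrable_fin_num (measurable_itv _ : measurable (_ : set (measurableTypeR R))) iv.
by rewrite -(fineK fv) => /fine_cvg.
Qed.


(** Replacing u n by its maximum with y0 changes only finitely many terms. *)
Let ratio_cvg_near (s : R) (u : nat -> R) (y0 : R) (v : R -> R) : 0 < y0 ->
  (\forall n \near \oo, y0 <= u n) ->
  (forall t, 0 < t -> ratio_fun s (u n) t @[n --> \oo] --> v t) ->
  igamma_ratio s (u n) @[n --> \oo] --> \int[leb]_(t in `]0, +oo[) v t.
Proof.
move=> y00 uy0 uv; pose u' n := Num.max y0 (u n).
have u'u : \forall n \near \oo, u' n = u n.
  by apply: filterS uy0 => n y0u; rewrite /u'; apply/max_idPr.
have := @ratio_cvg s u' y0 v y00.
move=> H; apply: cvg_trans (H _ _).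
- by apply: near_eq_cvg; apply: filterS u'u => n ->.
- by move=> n; rewrite le_max lexx.
- move=> t t0; apply: cvg_trans (uv _ t0).
  by apply: near_eq_cvg; apply: filterS u'u => n ->.
Qed.

Lemma igamma_ratioE s y : 0 < s -> 0 < y ->
  igamma s y = y `^ (s - 1) * expR (- y) * igamma_ratio s y.
Proof.
move=> s0 y0; rewrite /igamma /igamma_ratio /Rintegral.
have c0 : 0 <= y `^ (s - 1) * expR (- y) by rewrite mulr_ge0 ?powR_ge0 ?expR_ge0.
rewrite (_ : (\int[leb]_(x in `]y, +oo[) (gamma_fun s x)%:E)%E =
  ((y `^ (s - 1) * expR (- y))%:E * \int[leb]_(t in `]0%R, +oo[) (ratio_fun s y t)%:E)%E).
  rewrite fineM//.
  apply: integrable_fin_num; first exact: measurable_itv.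
  apply: (@integrable_dominated _ _ leb _ (ratio_fun s y) (ratio_dom s y)) => //.
  - exact: measurable_ratio_fun.
  - move=> t /=; rewrite in_itv/= andbT => t0.
    exact: (ratio_fun_le _ y0 (lexx y) (ltW t0)).
  - exact: integrable_ratio_dom.
apply: etrans; first apply: (@ge0_integral_affine _ 1 y) => //.
- by apply/measurable_EFinP; exact: measurable_gamma_fun.
- by move=> t _; rewrite lee_fin gamma_fun_ge0.
rewrite mul1e (_ : _ @^-1` _ = `]0, +oo[%classic); last first.
  by apply/seteqP; split => t /=; rewrite !in_itv/= !andbT mul1r ltrDr.
rewrite -ge0_integralZl_EFin//; last 2 first.
- by move=> t _; rewrite lee_fin ratio_fun_ge0.
- by apply/measurable_EFinP; exact: measurable_ratio_fun.
apply: eq_integral => t /[!inE]/=; rewrite in_itv/= andbT => t0.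
rewrite -EFinM /gamma_fun /ratio_fun mul1r; congr EFin.
rewrite (_ : t + y = y * (1 + t / y)); last first.
  by field; rewrite gt_eqF.
rewrite powRM ?(ltW y0)//; last by rewrite addr_ge0 ?divr_ge0 ?ltW.
rewrite (_ : - (y * (1 + t / y)) = - y + - t); last by field; rewrite gt_eqF.
by rewrite expRD; ring.
Qed.

Lemma igamma_ratio_ge0 s y : 0 <= igamma_ratio s y.
Proof. by apply: Rintegral_ge0 => t _; exact: ratio_fun_ge0. Qed.

Lemma igamma_ratio_bounded s y0 : 0 < y0 ->
  exists2 K, 0 < K & forall y, y0 <= y -> igamma_ratio s y <= K.
Proof.
move=> y00; exists (1 + \int[leb]_(t in `]0, +oo[) ratio_dom s y0 t).
  by rewrite ltr_wpDr// Rintegral_ge0// => t _; rewrite mulr_ge0 ?powR_ge0 ?expR_ge0.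
move=> y y0y.
apply: (@le_trans _ _ (\int[leb]_(t in `]0, +oo[) ratio_dom s y0 t)); last by rewrite lerDr.
rewrite /igamma_ratio.
have i1 := integrable_ratio_dom s y00.
apply: le_Rintegral => //.
- apply: (@integrable_dominated _ _ leb _ (ratio_fun s y) (ratio_dom s y0)) => //.
  + exact: measurable_ratio_fun.
  + move=> t /=; rewrite in_itv/= andbT => t0.
    exact: (ratio_fun_le _ y00 y0y (ltW t0)).
- move=> t /=; rewrite in_itv/= andbT => t0.
  by rewrite (le_trans (ler_norm _))// ratio_fun_le// ltW.
Qed.

Lemma igamma_ratio_cvg1 s (u : nat -> R) : u n @[n --> \oo] --> +oo ->
  igamma_ratio s (u n) @[n --> \oo] --> (1 : R).
Proof.
move=> uoo.
have := @ratio_cvg_near s u 1 (fun t => expR (- (1 * t))) ltr01.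
rewrite (_ : \int[leb]_(t in `]0, +oo[) expR (- (1 * t)) = 1); last first.
  rewrite /Rintegral integral_itv_obnd_cbnd; last first.
    apply/measurable_EFinP; apply: measurable_funTS; apply: measurableT_comp => //.
    by apply: measurableT_comp => //; exact: measurable_funM.
  by rewrite integral_expRN// invr1.
apply; first by move/cvgryPge : uoo; exact.
move=> t t0; rewrite mul1r /ratio_fun -[X in _ --> X]mul1r; apply: cvgMl.
rewrite [X in _ --> X](_ : 1 = 1 `^ (s - 1)); last by rewrite powR1.
apply: cvg_powR => //.
rewrite -[X in _ --> X]addr0; apply: cvgD; first exact: cvg_cst.
rewrite -(mulr0 t); apply: cvgMr.
by apply/gtr0_cvgV0 => //; first by move/cvgryPgt : uoo; exact.
Qed.

(** After the factorization [igamma_ratioE] the domain of integration no longer depends on y, so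
    dominated convergence applies with the majorant for y0 = y / 2. *)
Lemma continuous_igamma s (u : nat -> R) (y : R) : 0 < s -> 0 < y ->
  u n @[n --> \oo] --> y -> igamma s (u n) @[n --> \oo] --> igamma s y.
Proof.
move=> s0 y0 uy.
have uy2 : \forall n \near \oo, y / 2 <= u n.
  by apply: (cvgr_ge y) => //; rewrite ltr_pdivrMr// ltr_pMr// ltr1n.
have y20 : 0 < y / 2 by rewrite divr_gt0.
have un0 : \forall n \near \oo, 0 < u n.
  by apply: filterS uy2 => n; exact: lt_le_trans.
rewrite igamma_ratioE//.
apply: cvg_trans (_ : u n `^ (s - 1) * expR (- u n) * igamma_ratio s (u n) @[n --> \oo] --> _).
  by apply: near_eq_cvg; apply: filterS un0 => n un0; rewrite igamma_ratioE.
apply: cvgM.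
  apply: cvgM; first exact: cvg_powR.
  apply: (cvg_comp (fun n => - u n) expR); last exact: continuous_expR.
  exact: cvgN.
apply: (ratio_cvg_near y20 uy2) => t t0; apply: cvgMl.
apply: cvg_powR; first by rewrite ltr_wpDr// divr_ge0 ?ltW.
apply: cvgD; first exact: cvg_cst.
apply: cvgMr; apply: cvgV => //.
by rewrite gt_eqF.
Qed.

End incomplete_gamma.

Section igamma_integrals.
Context {R : realType}.
Notation leb := (@lebesgue_measure R).

Lemma measurable_igamma (s : R) : 0 < s -> measurable_fun (`]0, +oo[ : set R) (igamma s).
Proof.
move=> s0; apply: open_continuous_measurable_fun; first exact: interval_open.
move=> y /[!inE]/=; rewrite in_itv/= andbT => y0.
apply/continuous_withinNx/cvgr_dnbhsP => u [_ uy].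
exact: continuous_igamma.
Qed.

Lemma measurable_igamma_comp d (T : measurableType d) (X : set T) (f : T -> R) (s : R) :
  0 < s -> measurable_fun X f -> (forall x, X x -> 0 < f x) ->
  measurable_fun X (fun x => igamma s (f x)).
Proof.
move=> s0 mf f0; apply: (@measurable_comp _ _ _ _ _ _ (`]0, +oo[ : set R)%classic).
- exact: measurable_itv.
- by move=> _ [x Xx <-] /=; rewrite in_itv/= andbT f0.
- exact: measurable_igamma.
- exact: mf.
Qed.

Lemma igammaE_indic (s y : R) : 0 < s -> 0 <= y ->
  (\int[leb]_t (if y < t then gamma_fun s t else 0)%:E = (igamma s y)%:E)%E.
Proof.
move=> s0 y0; rewrite -igammaE// [RHS]integral_mkcond; apply: eq_integral => t _.
rewrite patchE mem_setE in_itv/= andbT.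
by case: ifP.
Qed.

(** Exchange the two integrations: for fixed t the condition a * u ^ (1 / k) < t cuts out an
    interval of length (t / a) ^ k, which raises the exponent of the gamma density by k. *)
Lemma integral_igamma_powR (s k a : R) : 0 < s -> 0 < k -> 0 < a ->
  (\int[leb]_(u in `]0%R, +oo[) (igamma s (a * u `^ k^-1))%:E =
   (a `^ (- k) * Gamma (s + k))%:E)%E.
Proof.
move=> s0 k0 a0.
have ki0 : 0 < k^-1 by rewrite invr_gt0.
pose f (p : measurableTypeR R * measurableTypeR R) : \bar R :=
  (if (0 < p.1) && (a * p.1 `^ k^-1 < p.2) then gamma_fun s p.2 else 0)%:E.
have f0 p : (0 <= f p)%E by rewrite lee_fin; case: ifP => _ //; exact: gamma_fun_ge0.
have mf : measurable_fun setT f.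
  apply/measurable_EFinP; apply: measurable_fun_ifT => //.
    apply: measurable_and.
      by apply: measurable_fun_ltr => //; exact: measurable_fst.
    apply: measurable_fun_ltr; last exact: measurable_snd.
    apply: measurable_funM => //.
    by apply: (measurableT_comp (measurable_powR _)); exact: measurable_fst.
  have mg : measurable_fun setT (gamma_fun s) by exact: measurable_gamma_fun.
  by apply: (measurableT_comp mg); exact: measurable_snd.
have : (\int[leb]_u \int[leb]_t f (u, t) = \int[leb]_t \int[leb]_u f (u, t))%E.
  exact: (@fubini_tonelli _ _ _ _ _ leb leb f mf f0).
rewrite (_ : (\int[leb]_u \int[leb]_t f (u, t))%E =
    (\int[leb]_(u in `]0%R, +oo[) (igamma s (a * u `^ k^-1))%:E)%E); last first.
  rewrite [RHS]integral_mkcond; apply: eq_integral => u _.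
  rewrite patchE mem_setE in_itv/= andbT; case: ifPn => u0.
    rewrite -igammaE_indic ?mulr_ge0 ?powR_ge0 ?(ltW a0)//.
    by apply: eq_integral => t _; rewrite /f/= u0.
  by apply: integral0_eq => t _; rewrite /f/= (negbTE u0).
move=> ->.
transitivity (\int[leb]_(t in `]0%R, +oo[) ((a `^ (- k))%:E * (gamma_fun (s + k) t)%:E))%E.
  rewrite [RHS]integral_mkcond; apply: eq_integral => t _.
  rewrite patchE mem_setE in_itv/= andbT; case: ifPn => t0; last first.
    apply: integral0_eq => u _; rewrite /f/=; case: ifP => // /andP[u0].
    move=> /(le_lt_trans _) => /(_ 0); rewrite mulr_ge0 ?powR_ge0 ?(ltW a0)//.
    by move=> /(_ isT); rewrite (negbTE t0).
  have ta0 : 0 < t / a by rewrite divr_gt0.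
  transitivity (\int[leb]_(u in `]0%R, ((t / a) `^ k)%R[) (gamma_fun s t)%:E)%E.
    rewrite [RHS]integral_mkcond; apply: eq_integral => u _.
    rewrite patchE mem_setE in_itv/= /f/=.
    rewrite (_ : ((0 < u) && (a * u `^ k^-1 < t)) = (0 < u < (t / a) `^ k)); first by case: ifP.
    case: (ltP 0 u) => //= u0; rewrite mulrC -ltr_pdivlMr//.
    apply/idP/idP => h.
      rewrite -[ltLHS](_ : (u `^ k^-1) `^ k = u); last first.
        by rewrite -powRrM mulVf ?gt_eqF// powRr1// ltW.
      by rewrite gt0_ltr_powR// ?nnegrE ?powR_ge0// ltW.
    rewrite -[ltRHS](powR_invK (ltW ta0) (gt_eqF k0)).
    by rewrite gt0_ltr_powR// ?nnegrE ?powR_ge0// ltW.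
  transitivity ((gamma_fun s t)%:E * leb `]0%R, ((t / a) `^ k)%R[%classic)%E.
    by apply: integral_cst; exact: measurable_itv.
  rewrite lebesgue_measure_itv/= lte_fin powR_gt0// sube0 -!EFinM.
  rewrite /gamma_fun; congr EFin.
  rewrite powRM ?(ltW t0) ?invr_ge0 ?(ltW a0)// powRN -powR_inv1 ?(ltW a0)//.
  rewrite -powRrM mulN1r powRN addrAC [X in _ = _ * (X * _)]powRD; last first.
    by rewrite (gt_eqF t0) implybT.
  by ring.
apply: etrans.
  apply: ge0_integralZl_EFin => //.
  - by move=> t _; rewrite lee_fin gamma_fun_ge0.
  - by apply/measurable_EFinP; exact: measurable_gamma_fun.
  - exact: powR_ge0.
by rewrite GammaE// addr_gt0.
Qed.

Lemma ltr_powR2 (r u v : R) : 0 < r -> 0 <= u -> 0 <= v ->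
  (u `^ r < v `^ r) = (u < v).
Proof.
move=> r0 u0 v0; case: (ltP u v) => [uv|vu].
  by rewrite gt0_ltr_powR ?nnegrE.
by apply/negbTE; rewrite -leNgt ge0_ler_powR ?nnegrE// ltW.
Qed.

(* The substitution t = r ^ betaF * f turns the density along a ray into the gamma density. *)
Lemma integral_ray (n : nat) (betaA betaF alphaH a f h x : R) : (0 < n)%N ->
  0 < betaF -> 0 < alphaH -> 0 < (n%:R + betaA) / betaF -> 0 <= a -> 0 < f -> 0 < h -> 0 < x ->
  (\int[leb]_(w in `]0%R, +oo[)
     (if x < (w `^ n%:R^-1) `^ alphaH * h
      then (w `^ n%:R^-1) `^ betaA * a * expR (- ((w `^ n%:R^-1) `^ betaF * f))
      else 0)%:E =
   (n%:R / betaF * (a / f `^ ((n%:R + betaA) / betaF) *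
    igamma ((n%:R + betaA) / betaF) (x `^ (betaF / alphaH) * (f / h `^ (betaF / alphaH)))))%:E)%E.
Proof.
move=> n0 bF0 aH0 l0 a0 f0 h0 x0; set l := (_ + _) / _; set rho := betaF / alphaH.
have n0' : 0 < n%:R :> R by rewrite ltr0n.
have rho0 : 0 < rho by rewrite divr_gt0.
(* The variable w is the n-th power of the radius r, so w = s ^ p amounts to s = r ^ betaF. The
   factor f is absorbed by a second, linear substitution. *)
pose p := n%:R / betaF.
have p0 : 0 < p by rewrite divr_gt0.
have mpow (q : R) : measurable_fun setT (fun w : R => (w `^ n%:R^-1) `^ q).
  by apply: (measurableT_comp (measurable_powR _)); exact: measurable_powR.
rewrite (@ge0_integral_powR _ p)//; last 2 first.
- apply: measurable_funTS; apply/measurable_EFinP; apply: measurable_fun_ifT => //.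
    by apply: measurable_fun_ltr => //; exact: measurable_funM.
  apply: measurable_funM; first exact: measurable_funM.
  by apply: (measurableT_comp (@measurable_expR R)); apply: measurableT_comp => //;
    exact: measurable_funM.
- move=> s _; rewrite lee_fin; case: ifP => // _.
  by rewrite !mulr_ge0 ?powR_ge0 ?expR_ge0.
(* The condition x < r ^ alphaH * h, expressed in t = r ^ betaF * f, becomes y < t. *)
pose y := x `^ rho * (f / h `^ rho).
have y0 : 0 < y by rewrite mulr_gt0 ?divr_gt0 ?powR_gt0.
transitivity (\int[leb]_(s in `]0%R, +oo[)
    (if y < s * f then p * a * (s `^ (l - 1) * expR (- (s * f))) else 0)%:E)%E.
  apply: eq_integral => s /[!inE]/=; rewrite in_itv/= andbT => s0.
  have pE q : ((s `^ p) `^ n%:R^-1) `^ q = s `^ (q / betaF).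
    by rewrite -!powRrM; congr (_ `^ _); rewrite /p; field; rewrite !gt_eqF.
  rewrite !pE divff ?gt_eqF// powRr1 ?(ltW s0)// -EFinM.
  rewrite (_ : (x < s `^ (alphaH / betaF) * h) = (y < s * f)); last first.
    rewrite /y mulrA mulrAC ltr_pM2r// ltr_pdivrMr ?powR_gt0//.
    have sE : s = (s `^ (alphaH / betaF)) `^ rho.
      rewrite -powRrM (_ : _ * rho = 1) ?powRr1 ?(ltW s0)//.
      by rewrite /rho; field; rewrite !gt_eqF.
    rewrite {2}sE -powRM ?powR_ge0 ?(ltW h0)//.
    rewrite ltr_powR2//; first exact: ltW.
    by rewrite mulr_ge0 ?powR_ge0// ltW.
  case: ifP => _; last by rewrite mul0r.
  congr EFin; rewrite /l (_ : _ / betaF - 1 = betaA / betaF + (p - 1)); last first.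
    by rewrite /p; field; rewrite gt_eqF.
  rewrite [X in _ = _ * (X * _)]powRD; last by rewrite (gt_eqF s0) implybT.
  by ring.
have pa0 : 0 <= p * a by rewrite mulr_ge0// ltW.
have fi0 : 0 < f^-1 by rewrite invr_gt0.
apply: etrans; first apply: (@ge0_integral_affine _ f^-1 0) => //.
- apply: measurable_funTS; apply/measurable_EFinP; apply: measurable_fun_ifT => //.
    by apply: measurable_fun_ltr => //; exact: measurable_funM.
  apply: measurable_funM => //; apply: measurable_funM; first exact: measurable_powR.
  by apply: (measurableT_comp (@measurable_expR R)); apply: measurableT_comp => //;
    exact: measurable_funM.
- move=> s _; rewrite lee_fin; case: ifP => // _.
  by rewrite mulr_ge0// mulr_ge0 ?powR_ge0 ?expR_ge0.
rewrite (_ : _ @^-1` _ = `]0, +oo[%classic); last first.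
  by apply/seteqP; split => t /=; rewrite !in_itv/= !andbT addr0 pmulr_rgt0.
transitivity (f^-1%:E * \int[leb]_(t in `]0%R, +oo[)
    ((p * a * f^-1 `^ (l - 1))%:E * (if (y < t)%R then gamma_fun l t else 0)%:E))%E.
  congr (_ * _)%E; apply: eq_integral => t /[!inE]/=; rewrite in_itv/= andbT => t0.
  rewrite addr0 mulrAC mulVf ?gt_eqF// mul1r -EFinM; case: ifP => _; last by rewrite mulr0.
  by rewrite powRM ?(ltW t0) ?(ltW fi0)// /gamma_fun; congr EFin; ring.
have mI : measurable_fun setT (fun t : R => (if (y < t)%R then gamma_fun l t else 0)%:E).
  apply/measurable_EFinP; apply: measurable_fun_ifT => //; last exact: measurable_gamma_fun.
  exact: measurable_fun_ltr.
rewrite (_ : (\int[leb]_(t in `]0%R, +oo[) _)%E =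
    ((p * a * f^-1 `^ (l - 1))%:E * (igamma l y)%:E)%E); last first.
  apply: etrans; first apply: ge0_integralZl_EFin => //.
  - by move=> t _; rewrite lee_fin; case: ifP => // _; exact: gamma_fun_ge0.
  - exact: measurable_funTS.
  - by rewrite mulr_ge0// powR_ge0.
  rewrite -igammaE_indic ?(ltW y0)//; congr (_ * _)%E.
  rewrite integral_mkcond; apply: eq_integral => t _; rewrite patchE mem_setE in_itv/= andbT.
  case: ifPn => // t0; rewrite ifF//; apply/negbTE; rewrite -leNgt.
  by rewrite (le_trans _ (ltW y0))// leNgt.
rewrite -!EFinM; congr EFin.
rewrite -/y.
have -> : f^-1 `^ (l - 1) = (f `^ l)^-1 * f.
  rewrite -powR_inv1 ?(ltW f0)// -powRrM mulN1r opprB addrC powRD; last by rewrite (gt_eqF f0) implybT.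
  by rewrite powRN powRr1// ltW.
by rewrite /p; field; rewrite ?gt_eqF ?powR_gt0.
Qed.

End igamma_integrals.

(** * The tail as an integral over the sphere *)

Section tail_formula.
Local Open Scope ereal_scope.
Context {R : realType} (D : nat) (D_gt0 : (0 < D)%N).
Notation leb := (@lebesgue_measure R).

Lemma pos_homogeneous_polar (b : R) (f : 'rV[R]_D -> R) (v : 'rV[R]_D) :
  pos_homogeneous b f -> (0 < enorm v)%R ->
  (f v = enorm v `^ b * f (radial v))%R.
Proof.
move=> fh v0; rewrite -{1}(enorm_radial v0) fh//.
exact: sphere_radial.
Qed.

(** Away from the origin homogeneity expresses [f] through its restriction to the sphere; at the
    origin its value is arbitrary, but a single point does not affect measurability. *)
Lemma measurable_pos_homogeneous (b : R) (f : 'rV[R]_D -> R) :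
  pos_homogeneous b f -> measurable_fun (sphere D) f -> measurable_fun setT f.
Proof.
move=> fh mf.
pose P : set 'rV[R]_D := [set v | (0 < enorm v)%R].
have mP : measurable P.
  rewrite (_ : P = @enorm R D @^-1` `]0%R, +oo[).
    rewrite -[X in measurable X]setTI.
    by apply: measurable_enorm => //; exact: measurable_itv.
  by apply/seteqP; split => v; rewrite /P/= in_itv/= andbT.
have m0 : measurable [set 0%R : 'rV[R]_D].
  by apply: measurable_closed_rV; apply: accessible_closed_set1;
    apply: hausdorff_accessible; exact: norm_hausdorff.
rewrite (_ : [set: 'rV[R]_D] = P `|` [set 0%R]); last first.
  apply/esym/seteqP; split => // v _; rewrite /P/= enorm_gt0.
  by have [->|] := eqVneq v 0%R; [right|left].
apply/measurable_funU => //; split; last exact: measurable_fun_set1.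
apply: (eq_measurable_fun (fun v => enorm v `^ b * f (radial v))%R).
  by move=> v /[!inE] Pv; rewrite -pos_homogeneous_polar.
apply: measurable_funM.
  apply: measurable_funTS; apply: (measurableT_comp (measurable_powR _)).
  exact: measurable_enorm.
apply: (@measurable_comp _ _ _ _ _ _ (sphere D)) => //.
- exact: measurable_sphere.
- by move=> _ [v Pv <-]; exact: sphere_radial.
- by apply: measurable_funTS; exact: measurable_radial.
Qed.

Variables (d : measure_display) (Omega : measurableType d) (P : probability Omega R).
Variable (eta : {RV P >-> 'rV[R]_D}).
Variables (A F H : 'rV[R]_D -> R) (betaA betaF alphaH : R).
Hypotheses (betaF_gt0 : (0 < betaF)%R) (alphaH_gt0 : (0 < alphaH)%R).
Hypotheses (A_ge0 : forall v, (0 <= A v)%R).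
Hypotheses (A_hom : pos_homogeneous betaA A) (F_hom : pos_homogeneous betaF F)
  (H_hom : pos_homogeneous alphaH H).
Hypotheses (A_meas : measurable_fun (sphere D) A)
  (F_meas : measurable_fun (sphere D) F) (H_meas : measurable_fun (sphere D) H).
Hypothesis eta_density : has_density eta (fun v => A v * expR (- F v))%R.

Let lambda := ((D%:R + betaA) / betaF)%R.
Let rho := (betaF / alphaH)%R.
Let G := posdirs H.
Hypotheses (lambda_gt0 : (0 < lambda)%R) (F_gt0 : forall t, G t -> (0 < F t)%R).

Lemma measurable_posdirs : measurable G.
Proof.
rewrite /G /posdirs (_ : [set t | (0 < H t)%R] = H @^-1` `]0%R, +oo[).
  by apply: H_meas; [exact: measurable_sphere|exact: measurable_itv].
by apply/seteqP; split => t /=; rewrite in_itv/= andbT.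
Qed.

Let G_sphere : G `<=` sphere D. Proof. by move=> t []. Qed.

Lemma measurable_Phi : measurable_fun G (Phi F H rho).
Proof.
have mG := measurable_posdirs.
have mS := @measurable_sphere R D.
apply: measurable_funM; first exact: measurable_funS F_meas.
have mH : measurable_fun G H by exact: measurable_funS H_meas.
rewrite (_ : (fun t => _) = fun t => ((H t) `^ rho) `^ (-1))%R; last first.
  by apply/funext => t; rewrite powR_inv1 ?powR_ge0.
do 2 (apply: (measurableT_comp (measurable_powR _))).
exact: mH.
Qed.

Lemma measurable_W : measurable_fun G (W A F lambda).
Proof.
have mG := measurable_posdirs.
have mS := @measurable_sphere R D.
apply: measurable_funM; first exact: measurable_funS A_meas.
have mF : measurable_fun G F by exact: measurable_funS F_meas.
rewrite (_ : (fun t => _) = fun t => ((F t) `^ lambda) `^ (-1))%R; last first.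
  by apply/funext => t; rewrite powR_inv1 ?powR_ge0.
do 2 (apply: (measurableT_comp (measurable_powR _))).
exact: mF.
Qed.

Lemma Phi_gt0 t : G t -> (0 < Phi F H rho t)%R.
Proof. by move=> Gt; rewrite divr_gt0 ?F_gt0// powR_gt0//; case: Gt. Qed.

Lemma W_ge0 t : (0 <= W A F lambda t)%R.
Proof. by rewrite divr_ge0 ?powR_ge0. Qed.

Lemma measurable_igamma_Phi (z : R) : (0 < z)%R ->
  measurable_fun G (fun t => igamma lambda (z * Phi F H rho t))%R.
Proof.
move=> z0; apply: measurable_igamma_comp => // [|t Gt]; last by rewrite mulr_gt0// Phi_gt0.
by apply: measurable_funM => //; exact: measurable_Phi.
Qed.

(** Polar coordinates reduce each direction to [integral_ray]. The factor D / betaF found there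
    splits into the D contained in [surface_measure] and the factor betaF^-1 in front. *)
Lemma tail_formula (x : R) : (0 < x)%R ->
  P [set w | (x < H (eta w))%R] =
  (betaF^-1)%:E * \int[surface_measure D]_(t in G)
    (W A F lambda t * igamma lambda (x `^ rho * Phi F H rho t))%:E.
Proof.
move=> x0.
have mA := measurable_pos_homogeneous A_hom A_meas.
have mF := measurable_pos_homogeneous F_hom F_meas.
have mH := measurable_pos_homogeneous H_hom H_meas.
pose S : set 'rV[R]_D := [set v | (x < H v)%R].
have mS : measurable S.
  rewrite (_ : S = H @^-1` `]x, +oo[).
    by rewrite -[X in measurable X]setTI; apply: mH => //; exact: measurable_itv.
  by apply/seteqP; split => v; rewrite /S/= in_itv/= andbT.
transitivity (distribution P eta S) => //.
rewrite eta_density// integral_mkcond.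
pose p v := (if (x < H v)%R then A v * expR (- F v) else 0)%:E.
have -> : (fun v => (A v * expR (- F v))%:E) \_ S = p.
  apply/funext => v; rewrite patchE /p; case: ifPn => [/[!inE] Sv|/negP Sv].
    by rewrite /S/= in Sv; rewrite Sv.
  by rewrite ifN//; apply/negP => xH; apply: Sv; rewrite inE.
have p0 v : 0 <= p v.
  by rewrite lee_fin; case: ifP => // _; rewrite mulr_ge0 ?expR_ge0.
have mp : measurable_fun setT p.
  apply/measurable_EFinP; apply: measurable_fun_ifT => //.
    exact: measurable_fun_ltr.
  apply: measurable_funM => //.
  by apply: (measurableT_comp (@measurable_expR R)); exact: measurableT_comp.
rewrite ge0_integral_polar//.
have mG := measurable_posdirs.
have mI : measurable_fun G (fun t =>
    (W A F lambda t * igamma lambda (x `^ rho * Phi F H rho t))%:E).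
  apply/measurable_EFinP; apply: measurable_funM; first exact: measurable_W.
  by apply: measurable_igamma_Phi; rewrite powR_gt0.
have I0 t : 0 <= (W A F lambda t * igamma lambda (x `^ rho * Phi F H rho t))%:E.
  by rewrite lee_fin mulr_ge0 ?W_ge0// igamma_ge0.
rewrite (ge0_integral_surface_measure mG mI)// muleA -EFinM.
transitivity (\int[@cone_measure R D]_(t in G) ((betaF^-1 * D%:R)%:E *
    (W A F lambda t * igamma lambda (x `^ rho * Phi F H rho t))%:E)); last first.
  apply: ge0_integralZl_EFin => //.
  by rewrite mulr_ge0// invr_ge0 ltW.
rewrite integral_mkcond [RHS]integral_mkcond; apply: eq_integral => t _.
rewrite !patchE; case: (boolP (t \in sphere D)) => [/[!inE] St|/negP St]; last first.
  by rewrite memNset// => /G_sphere; rewrite -inE.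
have pray w : (0 < w)%R -> p (w `^ D%:R^-1 *: t)%R =
    (if (x < (w `^ D%:R^-1) `^ alphaH * H t)%R
      then (w `^ D%:R^-1) `^ betaA * A t * expR (- ((w `^ D%:R^-1) `^ betaF * F t))
      else 0%R)%:E.
  move=> w0; have r0 := powR_gt0 D%:R^-1 w0.
  by rewrite /p H_hom// A_hom// F_hom.
case: ifPn => [/[!inE] Gt|/negP Gt]; last first.
  (* In a direction with H <= 0 no point of the ray reaches the positive level x. *)
  apply: integral0_eq => w /=; rewrite in_itv/= andbT => w0.
  rewrite pray// ifN// -leNgt (le_trans _ (ltW x0))//.
  rewrite mulr_ge0_le0 ?powR_ge0// leNgt; apply/negP => Ht.
  by apply: Gt; rewrite inE; split.
transitivity (\int[leb]_(w in `]0%R, +oo[) (if (x < (w `^ D%:R^-1) `^ alphaH * H t)%R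
      then (w `^ D%:R^-1) `^ betaA * A t * expR (- ((w `^ D%:R^-1) `^ betaF * F t))
      else 0%R)%:E).
  by apply: eq_integral => w /[!inE]/=; rewrite in_itv/= andbT; exact: pray.
rewrite integral_ray//; [|exact: F_gt0|by case: Gt].
by rewrite -EFinM; congr EFin; rewrite (mulrC betaF^-1)%R.
Qed.

End tail_formula.

(** * Submanifolds and collars *)

Section continuity.
Context {R : realType}.

Lemma cvg_big_sum (T : Type) (F : set_system T) {FF : Filter F} (I : Type)
    (r : seq I) (P : pred I) (f : I -> T -> R) (l : I -> R) :
  (forall i, f i x @[x --> F] --> l i) ->
  (\sum_(i <- r | P i) f i x) @[x --> F] --> \sum_(i <- r | P i) l i.
Proof.
move=> fl; elim: r => [|i r IH].
  rewrite big_nil; under eq_fun do rewrite big_nil; exact: cvg_cst.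
rewrite big_cons; under eq_fun do rewrite big_cons.
by case: (P i) => //; apply: cvgD.
Qed.

Lemma cvg_big_prod (T : Type) (F : set_system T) {FF : Filter F} (I : Type)
    (r : seq I) (P : pred I) (f : I -> T -> R) (l : I -> R) :
  (forall i, f i x @[x --> F] --> l i) ->
  (\prod_(i <- r | P i) f i x) @[x --> F] --> \prod_(i <- r | P i) l i.
Proof.
move=> fl; elim: r => [|i r IH].
  rewrite big_nil; under eq_fun do rewrite big_nil; exact: cvg_cst.
rewrite big_cons; under eq_fun do rewrite big_cons.
by case: (P i) => //; apply: cvgM.
Qed.

Lemma cvg_det (T : Type) (F : set_system T) {FF : Filter F} n (M : T -> 'M[R]_n)
    (L : 'M[R]_n) : (forall i j, M x i j @[x --> F] --> L i j) ->
  \det (M x) @[x --> F] --> \det L.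
Proof.
move=> ML; rewrite /determinant; apply: cvg_big_sum => s; apply: cvgMr.
by apply: cvg_big_prod => i.
Qed.

Lemma near_le_continuous (T : topologicalType) (f : T -> R) (y : T) (K : R) :
  {for y, continuous f} -> f y < K -> \forall y' \near y, f y' <= K.
Proof. by move=> cf fyK; apply: (cvgr_le (f y)). Qed.

Lemma closed_sphere n : closed (sphere n : set 'rV[R]_n).
Proof.
rewrite (_ : sphere n = (fun v : 'rV[R]_n => \sum_i v ord0 i ^+ 2) @^-1` [set 1]).
  apply: closed_comp => [v _|]; last first.
    by apply: accessible_closed_set1; apply: hausdorff_accessible; exact: Rhausdorff.
  apply: (@cvg_big_sum _ (nbhs v) (nbhs_filter v)) => i; under eq_fun do rewrite expr2.
  rewrite expr2; by apply: cvgM; exact: coord_continuous.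
apply/seteqP; split => v; rewrite /sphere /= /enorm dotmulvv.
  move=> /(congr1 (fun x => x ^+ 2)); rewrite expr1n sqr_sqrtr//.
  by apply: sumr_ge0 => i _; exact: sqr_ge0.
by move=> ->; rewrite sqrtr1.
Qed.

Lemma lebesgue_rV_ball n (v : 'rV[R]_n) (r : R) : 0 < r ->
  lebesgue_rV n (ball v r) = ((2 * r) ^+ n)%:E.
Proof.
move=> r0; elim: n => [|n IH] in v *.
  rewrite /= diracE mem_set//; split => // i [].
  by case.
rewrite /= /lebesgue_step /pushforward.
rewrite (_ : @cons_rV R n @^-1` ball v r =
    (ball (v ord0 ord0) r : set (measurableTypeR R)) `*`
    ball (\row_i v ord0 (lift ord0 i)) r); last first.
  apply/seteqP; split => [[x w] /= [_ xv]|[x w]/= [vx [_ vw]]].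
    split; first by have := xv ord0 ord0; rewrite mxE unlift_none.
    split => // i j; rewrite (ord1 i) mxE.
    by have := xv ord0 (lift ord0 j); rewrite mxE liftK.
  split => // i j; rewrite (ord1 i) mxE.
  case: unliftP => [k ->|->] //=.
  by have := vw ord0 k; rewrite mxE.
have mb : measurable (ball (\row_i v ord0 (lift ord0 i)) r) by exact: measurable_mx_ball.
transitivity (lebesgue_measure (ball (v ord0 ord0) r) *
    lebesgue_rV n (ball (\row_i v ord0 (lift ord0 i)) r))%E.
  by apply: product_measure1E => //; exact: measurable_ball.
rewrite IH lebesgue_measure_ball ?(ltW r0)// -EFinM exprS.
by rewrite mulr_natl.
Qed.

End continuity.

(** * Finiteness of the Riemannian measure *)

Section riemannian_measure.
Context {R : realType} (k n : nat).
Variables (B : set 'rV[R]_n) (mu : {measure set 'rV[R]_n -> \bar R}).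
Hypotheses (B_compact : compact B) (B_smooth : submanifold k B)
  (mu_riem : is_riemannian_measure k B mu).

Lemma measurable_compact_rV : measurable B.
Proof.
apply: measurable_closed_rV; apply: compact_closed => //; exact: norm_hausdorff.
Qed.

Lemma continuous_partial (U : set 'rV[R]_k) (psi : 'rV[R]_k -> 'rV[R]_n) i y :
  Ck 2 U psi -> U y -> {for y, continuous (partial i psi)}.
Proof. by move=> [_ /(_ i)[_ [+ _]]] => /[apply]. Qed.

Lemma continuous_sqrt_gram (U : set 'rV[R]_k) (psi : 'rV[R]_k -> 'rV[R]_n) y :
  Ck 2 U psi -> U y ->
  {for y, continuous (fun y => Num.sqrt (\det (gram psi y)))}.
Proof.
move=> Cpsi Uy.
have cp l i : partial i psi y' ord0 l @[y' --> y] --> partial i psi y ord0 l.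
  have c1 := continuous_partial (i := i) Cpsi Uy.
  exact: (cvg_comp _ (fun v : 'rV[R]_n => v ord0 l) c1 (@coord_continuous _ _ _ _ _ _)).
have gE i j : (fun y' => gram psi y' i j) =
    (fun y' => \sum_l partial i psi y' ord0 l * partial j psi y' ord0 l).
  by apply/funext => y'; rewrite mxE; apply: eq_bigr => l _; rewrite !mxE.
have cd : \det (gram psi y') @[y' --> y] --> \det (gram psi y).
  apply: (@cvg_det R _ (nbhs y) (nbhs_filter y) _ (gram psi) (gram psi y)) => i j.
  rewrite (gE i j) (congr1 (fun f => f y) (gE i j)).
  apply: (@cvg_big_sum R _ (nbhs y) (nbhs_filter y)) => l.
  by apply: cvgM; exact: cp.
exact: (@cvg_comp _ _ _ (fun y => \det (gram psi y)) Num.sqrt _ _ _ cd (@sqrt_continuous R _)).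
Qed.

Lemma measure_bigsetU_lty (s : seq (set 'rV[R]_n)) (f : set 'rV[R]_n -> set 'rV[R]_n) :
  {in s, forall O, measurable (f O) /\ (mu (f O) < +oo)%E} ->
  measurable (\big[setU/set0]_(O <- s) f O) /\
  (mu (\big[setU/set0]_(O <- s) f O) < +oo)%E.
Proof.
elim: s => [_|O s IH fs]; first by rewrite big_nil measure0.
have [mO O_lty] := fs O (mem_head _ _).
have [mU U_lty] : measurable (\big[setU/set0]_(O <- s) f O) /\
    (mu (\big[setU/set0]_(O <- s) f O) < +oo)%E.
  by apply: IH => O' O's; apply: fs; rewrite inE O's orbT.
rewrite big_cons; split; first exact: measurableU.
by apply: le_lt_trans (measureU2 _ _ _) _ => //; exact: lte_add_pinfty.
Qed.

(** Every point has a neighbourhood in B that is the image of a chart ball on which the Riemannian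
    density is bounded; finitely many cover the compact B. Finiteness is what permits Fubini and
    constant majorants over B. *)
Lemma riemannian_measure_finite : (mu setT < +oo)%E.
Proof.
have mB := measurable_compact_rV.
have muB0 : (mu (~` B) = 0)%E by exact: mu_riem.1.
suff muB : (mu B < +oo)%E.
  rewrite -(setUv B); apply: le_lt_trans (measureU2 _ _ _) _ => //.
    exact: measurableC.
  apply: lte_add_pinfty => //; apply: (@le_lt_trans _ _ 0%E) => //.
  by rewrite le_eqVlt; apply/orP; left; apply/eqP; exact: muB0.
pose good : set (set 'rV[R]_n) := fun O => open O /\ (mu (B `&` O) < +oo)%E.
have ex_good t : B t -> exists2 O, good O & O t.
  move=> /B_smooth[U [psi [[oU Cpsi rf inj hom] [y Uy psiy]]]].
  have cy := continuous_sqrt_gram Cpsi Uy.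
  (* Any bound above the value at y holds near y by continuity. *)
  pose K := Num.sqrt (\det (gram psi y)) + 1.
  have : \forall y' \near y, Num.sqrt (\det (gram psi y')) <= K.
    by apply: (near_le_continuous cy); rewrite ltrDl.
  have : nbhs y U by exact: open_nbhs_nbhs.
  move=> /filterI/[apply]/nbhs_ballP[r /= r0 rU].
  have bU : ball y r `<=` U by move=> z /rU[].
  have [Q oQ psiQ] := hom _ (ball_open y r) bU.
  exists Q; last first.
    have : (B `&` Q) t by rewrite -psiQ; exists y => //; exact: ballxx.
    by move=> [].
  split => //; rewrite -psiQ (mu_riem.2 U psi)//; last exact: measurable_mx_ball.
  apply: (@le_lt_trans _ _ (\int[lebesgue_rV k]_(y' in ball y r) K%:E)%E).
    apply: ge0_le_integral => //.
    - exact: measurable_mx_ball.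
    - apply/measurable_EFinP; apply: within_continuous_measurable_rV.
        exact: measurable_mx_ball.
      apply: continuous_in_subspaceT => z /[!inE]/bU Uz.
      exact: (continuous_sqrt_gram Cpsi Uz).
    - by move=> z /rU[_]; rewrite lee_fin.
  rewrite integral_cst; last exact: measurable_mx_ball.
  by rewrite lebesgue_rV_ball// -EFinM ltry.
have : cover_compact B by rewrite -compact_cover.
move=> /(_ _ good id) [Q [oQ _]//|t /ex_good[Q gQ Qt]|D Dgood BD].
  by exists Q.
have mD O : O \in finmap.enum_fset D -> measurable (B `&` O) /\ (mu (B `&` O) < +oo)%E.
  move=> OD; have /set_mem[oO Ooo] := Dgood O OD.
  by split => //; apply: measurableI => //; exact: measurable_open_rV.
have sub : B `<=` \big[setU/set0]_(O <- finmap.enum_fset D) (B `&` O).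
  by move=> t Bt; have [Q QD Qt] := BD _ Bt; rewrite -bigcup_seq; exists Q.
have [mU] := measure_bigsetU_lty mD; apply: le_lt_trans.
by apply: le_measure; rewrite ?inE.
Qed.

End riemannian_measure.

(** * Integration in collar coordinates *)

Section collar_coordinates.
Context {R : realType} (D : nat).
Notation leb := (@lebesgue_measure R).
Variables (H A F : 'rV[R]_D -> R) (B : set 'rV[R]_D) (eps : R)
  (phi : 'rV[R]_D * R -> 'rV[R]_D) (rho lambda : R).
Let G := posdirs H.
Hypotheses (phi_collar : is_collar_map G B H eps phi)
  (B_smooth : submanifold D.-2 B) (B_compact : compact B).

(** The regularity of [phi] is given only through extensions [g] in local parametrizations. Openness
    of the parametrization onto its image lifts points of B near t to parameters near y0, where [g]
    is continuous. *)
Lemma continuous_collar_map : {within collar B eps, continuous phi}.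
Proof.
apply/subspace_continuousP => -[t u] [/= Bt]; rewrite in_itv/= => u0.
have [U [psi [lp [y0 Uy0 psiy0]]]] := B_smooth Bt.
have [oU Cpsi rf inj hom] := lp.
have [_ _ _ _ /(_ U psi lp)[g [Cg gE _]]] := phi_collar.
have u1 : - eps < u < eps.
  case/andP: (u0) => u00 ueps; rewrite ueps andbT (lt_le_trans _ u00)// oppr_lt0.
  exact: le_lt_trans ueps.
have gc : {for row_mx y0 u%:M, continuous g}.
  apply: Cg.1; split; first by rewrite row_mxKl.
  by rewrite row_mxKr mxE eqxx mulr1n.
apply/cvg_ballP => e e0.
have /cvg_ballP/(_ e e0)/nbhs_ballP[r /= r0 rg] := gc.
pose V := U `&` ball y0 r.
have oV : open V by apply: openI => //; exact: ball_open.
have [|Q oQ psiQ] := hom V oV; first by move=> z [].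
have Qt : Q t.
  have : (B `&` Q) t by rewrite -psiQ; exists y0 => //; split => //; exact: ballxx.
  by case.
rewrite near_withinE.
have : nbhs (t, u) (Q `*` ball u r).
  by exists (Q, ball u r) => //; split; [exact: open_nbhs_nbhs|exact: nbhsx_ballx].
apply: filterS => -[t' u'] /= [Qt' bu'] [/= Bt']; rewrite in_itv/= => u'0.
have : (B `&` Q) t' by [].
rewrite -psiQ => -[y' [Uy' [_ by']] psiy'].
change (ball (phi (t, u)) e (phi (t', u'))).
rewrite -psiy0 -psiy' -(gE y0 u)// -(gE y' u')//; apply: rg; split => // i j; rewrite !mxE.
case: splitP => k _; first exact: by'.
by rewrite !mxE (ord1 k) (ord1 i) eqxx !mulr1n.
Qed.

Lemma measurable_collar_open (N : set ('rV[R]_D * R)) : open N ->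
  measurable (collar B eps `&` N).
Proof.
move=> oN; apply: measurableI; last exact: measurable_open_prod.
apply: measurableX; last exact: measurable_itv.
exact: measurable_compact_rV.
Qed.

(** The image is relatively open in the closed set [closure G]. *)
Lemma measurable_collar_image (N : set ('rV[R]_D * R)) : open N ->
  measurable (phi @` (collar B eps `&` N)).
Proof.
move=> oN; have [_ _ _ /(_ N oN)[Q oQ ->] _] := phi_collar.
apply: measurableI; last exact: measurable_open_rV.
by apply: measurable_closed_rV; exact: closed_closure.
Qed.

Lemma measurable_collar_map (N : set ('rV[R]_D * R)) : open N ->
  measurable_fun (collar B eps `&` N) phi.
Proof.
move=> oN; apply: measurable_fun_rV => i; apply: within_continuous_measurable_prod.
  exact: measurable_collar_open.
have : {within collar B eps `&` N, continuous phi}.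
  by apply: continuous_subspaceW continuous_collar_map => p [].
move=> /subspace_continuousP cphi; apply/subspace_continuousP => p Np.
apply: (@cvg_comp _ _ _ phi (fun v : 'rV[R]_D => v ord0 i) _ _ _ (cphi p Np)).
exact: coord_continuous.
Qed.

Lemma open_setX_lt (Q : set 'rV[R]_D) (e : R) : open Q ->
  open [set p : 'rV[R]_D * R | Q p.1 /\ p.2 < e].
Proof.
move=> oQ; rewrite (_ : [set _ | _] = fst @^-1` Q `&` snd @^-1` `]-oo, e[).
  apply: openI; first by apply: open_comp => // p _; exact: cvg_fst.
  by apply: open_comp => [p _|]; [exact: cvg_snd|exact: interval_open].
by apply/seteqP; split => p /=; rewrite in_itv.
Qed.

(** The slice u = 0 of the collar is mapped to B, where H = 0, hence outside G. *)
Let pos2 : set ('rV[R]_D * R) := [set p | 0 < p.2].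

Lemma open_pos2 : open pos2.
Proof.
rewrite (_ : pos2 = snd @^-1` `]0, +oo[).
  by apply: open_comp => [p _|]; [exact: cvg_snd|exact: interval_open].
by apply/seteqP; split => p; rewrite /pos2/= in_itv/= andbT.
Qed.

Lemma posdirs_collar p : collar B eps p -> 0 < p.2 -> G (phi p).
Proof.
move=> cp p2; have [_ phiH _ _ _] := phi_collar; have [Gp Hp] := phiH p cp.
split; last by rewrite /= Hp.
have : closure G `<=` sphere D.
  rewrite [X in _ `<=` X](closure_id _).1; last exact: closed_sphere.
  by apply: closureS => t [].
exact.
Qed.

Lemma posdirs_collar_image (N : set ('rV[R]_D * R)) :
  G `&` phi @` (collar B eps `&` N) = phi @` (collar B eps `&` (N `&` pos2)).
Proof.
have [_ phiH _ _ _] := phi_collar.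
apply/seteqP; split => [t [Gt [p [cp Np] phip]]|_ [p [cp [Np p2]] <-]].
  exists p => //; split => //; split => //; move: Gt.
  by rewrite -phip => -[_]; rewrite /= (phiH p cp).2.
by split; [exact: posdirs_collar|exists p].
Qed.

Variables (sigmaB : {measure set 'rV[R]_D -> \bar R}) (J omega : 'rV[R]_D * R -> R).
Hypotheses (J_jacobian : is_collar_jacobian B sigmaB eps phi J)
  (omegaE : forall (t : 'rV_D) (u : R), B t -> 0 < u < eps ->
       omega (t, u) = W A F lambda (phi (t, u)) * J (t, u)).

(** Restricting to u > 0 is what lets [omegaE] absorb the Jacobian into the effective density. *)
Lemma ge0_integral_collar (N : set ('rV[R]_D * R)) (f : 'rV[R]_D -> R) : open N ->
  measurable_fun G (fun t => W A F lambda t * f t) ->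
  (forall t, G t -> 0 <= W A F lambda t * f t) -> measurable G ->
  (\int[surface_measure D]_(t in G `&` phi @` (collar B eps `&` N))
     (W A F lambda t * f t)%:E =
   \int[sigmaB \x leb]_(p in collar B eps `&` (N `&` pos2)) (omega p * f (phi p))%:E)%E.
Proof.
move=> oN mf f0 mG; have [mJ J0 JE] := J_jacobian.
have oN' : open (N `&` pos2) by apply: openI => //; exact: open_pos2.
have sub : phi @` (collar B eps `&` (N `&` pos2)) `<=` G.
  by rewrite -posdirs_collar_image => t [].
have mC := measurable_collar_open oN'.
have mI := measurable_collar_image oN'.
rewrite posdirs_collar_image.
rewrite (@ge0_change_of_variables _ _ _ _ R (sigmaB \x leb)%E
  (@surface_measure R D) (collar B eps `&` (N `&` pos2)) phi J)//.
- apply: eq_integral => -[t u] /[!inE] -[[/= Bt]]; rewrite in_itv/= => /andP[_ ueps] [_ u0].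
  rewrite /pos2/= in u0; rewrite -EFinM omegaE//; last by rewrite u0.
  by congr EFin; rewrite mulrAC.
- exact: measurable_collar_map.
- apply: (measurable_funS _ _ mJ); last by move=> p [].
  by apply: measurableX; [exact: measurable_compact_rV|exact: measurable_itv].
- by move=> p [cp _]; exact: J0.
- move=> E mE EN; apply: JE => //; by apply: subset_trans EN _ => p [].
- apply/measurable_EFinP; apply: (measurable_funS _ _ mf); [exact: mG|exact: sub].
- by move=> t /sub Gt; rewrite lee_fin f0.
Qed.

End collar_coordinates.

(** * Localization and the fractional case *)

Section localization.
Context {R : realType}.
Notation leb := (@lebesgue_measure R).

(** For infinite x both sides are 0, because [fine] sends infinities to 0 and k > 0 keeps them
    infinite. *)
Lemma fine_EFinM (k : R) (x : \bar R) : 0 < k -> fine (k%:E * x)%E = k * fine x.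
Proof.
move=> k0; case: x => [r| |] /=; first by [].
  by rewrite mulry gtr0_sg// mul1e mulr0.
by rewrite mulrNy gtr0_sg// mul1e mulr0.
Qed.

(** Passes to sequences, as dominated convergence requires; taking the maximum with 1 makes
    positivity hold for every index and not merely eventually. *)
Lemma cvg_pinfty_ge1 (f : R -> R) (l : R) :
  (forall u : nat -> R, (forall n, 1 <= u n) -> u n @[n --> \oo] --> +oo ->
    f (u n) @[n --> \oo] --> l) -> f x @[x --> +oo] --> l.
Proof.
move=> fu; apply/cvg_pinftyP => u uoo; pose v n := Num.max 1 (u n).
have vu : \forall n \near \oo, v n = u n.
  by move/cvgryPge : uoo => /(_ 1); apply: filterS => n u1; exact/max_idPr.
apply: cvg_trans (fu v _ _).
- by apply: near_eq_cvg; apply: filterS vu => n ->.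
- by move=> n; rewrite le_max lexx.
- apply: cvg_trans uoo; apply: near_eq_cvg; apply: filterS vu => n ->.
  by [].
Qed.

Lemma cvg_powRN_pinfty (s : R) (u : nat -> R) : 0 < s -> (forall n, 1 <= u n) ->
  u n @[n --> \oo] --> +oo -> u n `^ (- s) @[n --> \oo] --> (0 : R).
Proof.
move=> s0 u1 uoo; have u0 n : 0 < u n by exact: lt_le_trans (u1 n).
apply/cvgr0Pnorm_lt => b b0; move/cvgryPgt : uoo => /(_ (b `^ (- s^-1))).
apply: filterS => n bu; rewrite gtr0_norm ?powR_gt0//.
rewrite powRN invf_plt ?posrE ?powR_gt0//.
rewrite -[ltLHS](@powRr1 _ b^-1) ?invr_ge0 ?ltW// -(mulVf (lt0r_neq0 s0)) powRrM.
by rewrite gt0_ltr_powR ?nnegrE ?powR_ge0 ?(ltW (u0 n))// -powR_inv1 ?(ltW b0)// -powRrM mulN1r.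
Qed.

Lemma igamma_decay (l p q delta : R) (u : nat -> R) : 0 < l -> 0 <= q -> q < delta ->
  (forall n, 1 <= u n) -> u n @[n --> \oo] --> +oo ->
  u n `^ p * expR (q * u n) * igamma l (u n * delta) @[n --> \oo] --> (0 : R).
Proof.
move=> l0 q0 qd u1 uoo; have d0 : 0 < delta by exact: le_lt_trans qd.
(* The excess rate delta - q is split in two halves: one bounds the power of u n, the other tends to
   0. *)
pose b := (delta - q) / 2; have b0 : 0 < b by rewrite divr_gt0// subr_gt0.
have [K K0 Kle] := powR_le_expR (p + (l - 1)) b0.
have [L L0 Lle] := igamma_ratio_bounded l d0.
have u0 n : 0 < u n by exact: lt_le_trans (u1 n).
apply: (@squeeze_cvgr _ _ _ _ (fun=> 0) (fun n => (delta `^ (l - 1) * K * L) * expR (- (b * u n)))).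
- apply: nearW => n; apply/andP; split.
    by rewrite !mulr_ge0 ?powR_ge0 ?expR_ge0 ?igamma_ge0.
  rewrite igamma_ratioE ?mulr_gt0// powRM ?(ltW (u0 n)) ?(ltW d0)//.
  have pw : u n `^ (p + (l - 1)) * expR (- (b * u n)) <= K.
    by rewrite expRN ler_pdivrMr ?expR_gt0// Kle.
  rewrite (_ : _ * _ = delta `^ (l - 1) * (u n `^ (p + (l - 1)) * expR (- (b * u n))) *
     igamma_ratio l (u n * delta) * expR (- (b * u n))); last first.
    rewrite (@powRD _ (u n) p (l - 1)); last by rewrite (gt_eqF (u0 n)) implybT.
    have eE : expR (q * u n) * expR (- (u n * delta)) =
        expR (- (b * u n)) * expR (- (b * u n)).
      by rewrite -!expRD; congr expR; rewrite /b; field.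
    transitivity (delta `^ (l - 1) * (u n `^ p * u n `^ (l - 1)) *
      igamma_ratio l (u n * delta) * (expR (q * u n) * expR (- (u n * delta)))); first by ring.
    by rewrite eE; ring.
  rewrite ler_wpM2r ?expR_ge0// ler_pM ?igamma_ratio_ge0 ?mulr_ge0 ?powR_ge0 ?expR_ge0//.
    by rewrite ler_wpM2l ?powR_ge0.
  by rewrite Lle// ler_peMl// ltW.
- exact: cvg_cst.
- rewrite -[X in _ --> X](mulr0 (delta `^ (l - 1) * K * L)); apply: cvgMr.
  apply: (cvg_comp (fun n => b * u n) (fun x => expR (- x))); last exact: cvgr_expR.
  apply/cvgryPge => A; move/cvgryPge : uoo => /(_ (A / b)).
  by apply: filterS => n; rewrite ler_pdivrMr// mulrC.
Qed.

Lemma patch_EFin T (X : set T) (f : T -> R) : (EFin \o f) \_ X = EFin \o (f \_ X).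
Proof. by apply/funext => p; rewrite /= !patchE; case: ifP. Qed.

(* On G \ V the integrand is at most w times igamma l (u n * delta), of order exp (- delta * u n),
   hence negligible against exp (- q * u n). *)
Lemma cvg_tail_localize d (T : measurableType d) (m : {measure set T -> \bar R})
    (G V : set T) (w P : T -> R) (l p q delta : R) (u : nat -> R) (L : R) :
  measurable G -> measurable V -> m.-integrable G (EFin \o w) ->
  (forall t, G t -> 0 <= w t) -> (forall t, G t -> 0 < P t) -> measurable_fun G P ->
  0 < l -> 0 <= q -> q < delta -> (forall t, (G `\` V) t -> delta <= P t) ->
  (forall n, 1 <= u n) -> u n @[n --> \oo] --> +oo ->
  u n `^ p * expR (q * u n) *
    fine (\int[m]_(t in G `&` V) (w t * igamma l (u n * P t))%:E)%E @[n --> \oo] --> L ->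
  u n `^ p * expR (q * u n) *
    fine (\int[m]_(t in G) (w t * igamma l (u n * P t))%:E)%E @[n --> \oo] --> L.
Proof.
move=> mG mV iw w0 P0 mP l0 q0 qd Pd u1 uoo cV.
have u0 n : 0 < u n by exact: lt_le_trans (u1 n).
have d0 : 0 < delta by exact: le_lt_trans qd.
have mw : measurable_fun G w by apply/measurable_EFinP; exact: measurable_int iw.
have mI n : measurable_fun G (fun t => (w t * igamma l (u n * P t))%:E).
  apply/measurable_EFinP; apply: measurable_funM => //.
  apply: measurable_igamma_comp => // [|t Gt]; first exact: measurable_funM.
  by rewrite mulr_gt0// P0.
have I0 n t : G t -> (0 <= (w t * igamma l (u n * P t))%:E)%E.
  by move=> Gt; rewrite lee_fin mulr_ge0 ?igamma_ge0 ?w0.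
pose rest n := (\int[m]_(t in G `\` V) (w t * igamma l (u n * P t))%:E)%E.
pose M := fine (\int[m]_(t in G) (w t)%:E)%E.
have M0 : 0 <= M by rewrite fine_ge0// integral_ge0.
have ME : (\int[m]_(t in G) (w t)%:E = M%:E)%E.
  by rewrite fineK//; exact: integrable_fin_num iw.
have igd n t : (G `\` V) t -> igamma l (u n * P t) <= igamma l (u n * delta).
  by move=> GVt; rewrite ler_igamma ?mulr_ge0 ?(ltW d0) ?(ltW (u0 n))// ler_pM2l ?Pd.
have iI n : m.-integrable G (EFin \o (fun t => w t * igamma l (u n * P t))).
  apply: (@integrable_dominated _ _ _ _ _ _ (fun t => w t * Gamma l)) => //.
  - by apply/measurable_EFinP; exact: mI.
  - move=> t Gt; rewrite ger0_norm ?mulr_ge0 ?igamma_ge0 ?w0// ler_wpM2l ?w0//.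
    apply: (@le_trans _ _ (igamma l 0)); last by rewrite /igamma lexx.
    by rewrite ler_igamma// mulr_ge0 ?ltW ?P0.
  - by rewrite (_ : _ \o _ = fun t => ((Gamma l)%:E * (w t)%:E)%E);
      [exact: integrableZl|apply/funext => t /=; rewrite mulrC EFinM].
have rest_le n : (rest n <= (igamma l (u n * delta) * M)%:E)%E.
  rewrite EFinM -ME -ge0_integralZl_EFin//; last 2 first.
  - exact/measurable_EFinP.
  - exact: igamma_ge0.
  apply: (@le_trans _ _ (\int[m]_(t in G `\` V) ((igamma l (u n * delta))%:E * (w t)%:E))%E).
    apply: ge0_le_integral => //.
    - exact: measurableD.
    - by move=> t [Gt _]; exact: I0.
    - by apply: (measurable_funS _ _ (mI n)) => // t [].
    - apply: emeasurable_funM => //; apply/measurable_EFinP.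
      by apply: (measurable_funS _ _ mw) => // t [].
    - move=> t GVt; rewrite -EFinM lee_fin mulrC ler_wpM2r ?igd//.
      by case: GVt => Gt _; exact: w0.
  apply: ge0_subset_integral => //.
  - exact: measurableD.
  - by apply: emeasurable_funM => //; exact/measurable_EFinP.
  - by move=> t Gt; rewrite -EFinM lee_fin mulr_ge0 ?igamma_ge0 ?w0.
have rest0 n : (0 <= rest n)%E by apply: integral_ge0 => t [Gt _]; exact: I0.
have rest_fin n : rest n = (fine (rest n))%:E.
  by rewrite fineK// ge0_fin_numE// (le_lt_trans (rest_le n))// ltry.
rewrite (_ : (fun n => _) = (fun n => u n `^ p * expR (q * u n) *
    fine (\int[m]_(t in G `&` V) (w t * igamma l (u n * P t))%:E)%E +
    u n `^ p * expR (q * u n) * fine (rest n))); last first.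
  apply/funext => n; rewrite -mulrDr; congr (_ * _); rewrite -fineD//.
  - congr fine; rewrite /rest -[X in integral _ X _](setIT G) -(setUv V) setIUr.
    rewrite ge0_integral_setU//.
    + exact: measurableI.
    + by apply: measurableI => //; exact: measurableC.
    + by rewrite -setIUr setUv setIT.
    + by rewrite -setIUr setUv setIT; exact: I0.
    + by apply/disj_setPS => t [[_ Vt] [_ nVt]].
  - rewrite ge0_fin_numE; last by apply: integral_ge0 => t [Gt _]; exact: I0.
    apply: (@le_lt_trans _ _ (\int[m]_(t in G) (w t * igamma l (u n * P t))%:E)%E).
      by apply: ge0_subset_integral => //; [exact: measurableI|exact: I0].
    rewrite -ge0_fin_numE; last exact: integral_ge0 (I0 n).
    by apply: integrable_fin_num => //; exact: iI.
  - by rewrite rest_fin.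
rewrite -[X in _ --> X]addr0; apply: cvgD => //.
apply: (@squeeze_cvgr _ _ _ _ (fun=> 0)
  (fun n => u n `^ p * expR (q * u n) * igamma l (u n * delta) * M)).
- apply: nearW => n; apply/andP; split.
    by rewrite !mulr_ge0 ?powR_ge0 ?expR_ge0 ?fine_ge0.
  rewrite -[leRHS]mulrA ler_wpM2l ?mulr_ge0 ?powR_ge0 ?expR_ge0//.
  by rewrite -lee_fin -rest_fin.
- exact: cvg_cst.
- by rewrite -[X in _ --> X](mul0r M); apply: cvgMl; exact: igamma_decay.
Qed.

Section scaling.
Context d (T : measurableType d) (m1 : {measure set T -> \bar R}).
Hypothesis m1_sf : sigma_finite setT m1.
Variables (A : set T) (e : R) (f : T * R -> R).
Hypotheses (mA : measurable A).
Let X : set (T * R) := A `*` `]0, e[.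
Hypotheses (mf : measurable_fun X f) (f0 : forall p, X p -> 0 <= f p).

Let mX : measurable X.
Proof. by apply: measurableX => //; exact: measurable_itv. Qed.

Lemma measurable_patch_scale (a : R) (Y : set (T * R)) :
  measurable_fun Y (fun p => (f \_ X) (p.1, a * p.2)).
Proof.
apply: measurable_funTS.
have mfX : measurable_fun setT (f \_ X) by apply/(measurable_restrictT f).
apply: (measurableT_comp mfX); apply: measurable_fun_pair => //.
by apply: measurable_funM.
Qed.

(** After extension by zero the rescaled integral runs over a half line that does not depend on a,
    as dominated convergence needs. *)
Lemma ge0_integral_setX_scale (a : R) : 0 < a ->
  (\int[m1 \x leb]_(p in X) (f p)%:E =
   a%:E * \int[m1 \x leb]_(p in A `*` `]0%R, +oo[) ((f \_ X) (p.1, a * p.2)%R)%:E)%E.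
Proof.
move=> a0.
have mfX : measurable_fun setT (f \_ X) by apply/(measurable_restrictT f).
have fX0 p : 0 <= (f \_ X) p.
  by rewrite patchE; case: ifPn => // /[!inE]; exact: f0.
transitivity (\int[m1 \x leb]_(p in A `*` `]0%R, +oo[) ((f \_ X) p)%:E)%E.
  rewrite integral_mkcond [RHS]integral_mkcond patch_EFin.
  apply: eq_integral => -[t s] _ /=; rewrite !patchE.
  case: ifP => [/set_mem[/= At]|_]; last by case: ifP.
  rewrite in_itv/= => /andP[s0 _].
  by rewrite ifT//; apply/mem_set; split => //=; rewrite in_itv/= s0.
apply: etrans; first apply: (@ge0_fubini_setX _ _ _ _ R m1 leb A `]0%R, +oo[%classic) => //.
- by apply/measurable_EFinP; exact: measurable_funTS.
- by move=> t s _ _; rewrite lee_fin.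
transitivity (a%:E * \int[m1]_(x in A) \int[leb]_(y in `]0%R, +oo[)
    ((f \_ X) (x, a * y)%R)%:E)%E; last first.
  congr (_ * _)%E; apply/esym; apply: etrans; first apply: (@ge0_fubini_setX _ _ _ _ R m1 leb A `]0%R, +oo[%classic) => //.
  + by apply/measurable_EFinP; exact: measurable_patch_scale.
  + by move=> t s _ _; rewrite lee_fin.
  by [].
rewrite -ge0_integralZl_EFin//=; last 3 first.
- by move=> t _; apply: integral_ge0 => s _; rewrite lee_fin.
- apply: (@measurable_fun_integral_setX _ _ _ _ R leb A `]0%R, +oo[%classic
    (fun p => ((f \_ X) (p.1, a * p.2)%R)%:E)) => //.
  + by apply/measurable_EFinP; exact: measurable_patch_scale.
  + by move=> t s _ _; rewrite lee_fin.
- exact: ltW.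
apply: eq_integral => t _; apply: etrans.
  apply: (@ge0_integral_affine R a 0 `]0%R, +oo[%classic) => //.
  + apply/measurable_EFinP; apply: measurable_funTS.
    by apply: (measurableT_comp mfX); exact: measurable_pair1.
  + by move=> s _; rewrite lee_fin.
congr (_ * _)%E; rewrite (_ : _ @^-1` _ = `]0%R, +oo[%classic).
  by apply: eq_integral => s _; rewrite addr0.
by apply/seteqP; split => s /=; rewrite !in_itv/= !andbT addr0 pmulr_rgt0.
Qed.

End scaling.
End localization.

(** * Asymptotics in the fractional case *)

Section fractional.
Context {R : realType} d (T : measurableType d) (m1 : {measure set T -> \bar R}).
Notation leb := (@lebesgue_measure R).
(** [w] and [P] stand for omega and Phi in collar coordinates, [w0] and [c] for their leading
    coefficients at u = 0, and k for 1 / (1 - zeta). [w_le] and [P_ge] give the majorant, [w_cvg]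
    and [P_cvg] the pointwise limit. *)
Variables (A : set T) (e : R) (w P : T * R -> R) (w0 c : T -> R) (K a k l : R).
Let X : set (T * R) := A `*` `]0, e[.
Hypotheses (m1_fin : (m1 setT < +oo)%E) (mA : measurable A) (e0 : 0 < e)
  (k0 : 0 < k) (l0 : 0 < l) (a0 : 0 < a) (K0 : 0 <= K)
  (mw : measurable_fun X w) (mP : measurable_fun X P)
  (mw0 : measurable_fun A w0) (mc : measurable_fun A c)
  (w_ge0 : forall p, X p -> 0 <= w p) (w_le : forall p, X p -> w p <= K)
  (P_ge : forall p, X p -> a * p.2 `^ k^-1 <= P p)
  (w0_ge0 : forall t, A t -> 0 <= w0 t) (c_gt0 : forall t, A t -> 0 < c t)
  (w_cvg : forall t (v : nat -> R), A t -> (forall n, 0 < v n) ->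
     v n @[n --> \oo] --> (0 : R) -> w (t, v n) @[n --> \oo] --> w0 t)
  (P_cvg : forall t (v : nat -> R), A t -> (forall n, 0 < v n) ->
     v n @[n --> \oo] --> (0 : R) ->
     P (t, v n) / v n `^ k^-1 @[n --> \oo] --> c t).

Lemma measure_fin_sigma_finite : sigma_finite setT m1.
Proof.
apply: fin_num_fun_sigma_finite => [|E mE]; first by rewrite measure0.
by rewrite ge0_fin_numE// (le_lt_trans _ m1_fin)// le_measure ?inE.
Qed.

Let f (z : R) (p : T * R) := w p * igamma l (z * P p).

Let P_gt0 p : X p -> 0 < P p.
Proof.
move=> Xp; rewrite (lt_le_trans _ (P_ge Xp))// mulr_gt0// powR_gt0//.
by case: Xp => _ /=; rewrite in_itv/= => /andP[].
Qed.

Let mf z : 0 < z -> measurable_fun X (f z).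
Proof.
move=> z0; apply: measurable_funM => //.
apply: measurable_igamma_comp => // [|p Xp]; first exact: measurable_funM.
by rewrite mulr_gt0// P_gt0.
Qed.

Let f0 z p : X p -> 0 <= f z p.
Proof. by move=> Xp; rewrite mulr_ge0 ?w_ge0 ?igamma_ge0. Qed.

Let Y : set (T * R) := A `*` `]0, +oo[.

Let mY : measurable Y.
Proof. by apply: measurableX => //; exact: measurable_itv. Qed.

Let dom (p : T * R) := K * igamma l (a * p.2 `^ k^-1).

Let measurable_igamma_snd (b : T -> R) : measurable_fun A b -> (forall t, A t -> 0 < b t) ->
  measurable_fun Y (fun p => igamma l (b p.1 * p.2 `^ k^-1)).
Proof.
move=> mb b0; apply: measurable_igamma_comp => // [|p [Ap]]; last first.
  by rewrite /= in_itv/= => /andP[p0 _]; rewrite mulr_gt0 ?powR_gt0 ?b0.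
apply: measurable_funM.
  apply: (@measurable_comp _ _ _ _ _ _ A) => //; first by move=> _ [p [Ap _] <-].
  exact: measurable_funTS.
apply: (measurableT_comp (measurable_powR _)).
exact: measurable_funTS.
Qed.

Let integral_igamma_snd (g b : T -> R) : measurable_fun A b -> (forall t, A t -> 0 < b t) ->
  measurable_fun A g -> (forall t, A t -> 0 <= g t) ->
  (\int[m1 \x leb]_(p in Y) (g p.1 * igamma l (b p.1 * p.2 `^ k^-1))%:E =
   (Gamma (l + k))%:E * \int[m1]_(t in A) (g t * b t `^ (- k))%:E)%E.
Proof.
move=> mb b0 mg g0.
apply: etrans; first apply: (@ge0_fubini_setX _ _ _ _ R m1 leb A `]0%R, +oo[%classic) => //.
- apply/measurable_EFinP; apply: measurable_funM; last exact: measurable_igamma_snd.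
  apply: (@measurable_comp _ _ _ _ _ _ A) => //; first by move=> _ [p [Ap _] <-].
  exact: measurable_funTS.
- by move=> t s At _; rewrite lee_fin mulr_ge0 ?igamma_ge0 ?g0.
- exact: measure_fin_sigma_finite.
rewrite -ge0_integralZl_EFin//; last 3 first.
- by move=> t At; rewrite lee_fin mulr_ge0 ?powR_ge0 ?g0.
- apply/measurable_EFinP; apply: measurable_funM => //.
  exact: (measurableT_comp (measurable_powR _)).
- by rewrite ltW// Gamma_gt0// addr_gt0.
apply: eq_integral => t /[!inE] At /=.
transitivity ((g t)%:E * \int[leb]_(s in `]0%R, +oo[) (igamma l (b t * s `^ k^-1))%:E)%E.
  rewrite -ge0_integralZl_EFin//.
  - by move=> s _; rewrite lee_fin igamma_ge0.
  - apply/measurable_EFinP.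
    apply: measurable_igamma_comp => // [|s].
      by apply: measurable_funM => //; exact: measurable_funTS (measurable_powR _).
    by rewrite /= in_itv/= => /andP[s0 _]; rewrite mulr_gt0 ?powR_gt0 ?b0.
  - exact: g0.
by rewrite integral_igamma_powR ?b0// -!EFinM; congr EFin; ring.
Qed.

(* After the substitution s -> u n ^ (- k) s the integrand converges and is dominated by
   K * igamma l (a * s ^ (1 / k)). *)
Lemma frac_asymptotics (u : nat -> R) : (forall n, 1 <= u n) ->
  u n @[n --> \oo] --> +oo ->
  u n `^ k * fine (\int[m1 \x leb]_(p in X) (w p * igamma l (u n * P p))%:E)%E
    @[n --> \oo] --> Gamma (l + k) * \int[m1]_(t in A) (w0 t * c t `^ (- k)).
Proof.
move=> u1 uoo.
have u0 n : 0 < u n by exact: lt_le_trans (u1 n).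
(* At this scale u n * P (t, s n * v) tends to c t * v ^ (1 / k), as (s n) ^ (1 / k) is the inverse
   of u n. *)
pose s n := u n `^ (- k).
have s0 n : 0 < s n by rewrite powR_gt0.
have scvg : s n @[n --> \oo] --> (0 : R) by exact: cvg_powRN_pinfty.
pose g n (p : T * R) := (f (u n) \_ X) (p.1, s n * p.2).
have gE n : u n `^ k * fine (\int[m1 \x leb]_(p in X) (w p * igamma l (u n * P p))%:E)%E =
    fine (\int[m1 \x leb]_(p in Y) (g n p)%:E)%E.
  rewrite -[X in fine X]/(\int[m1 \x leb]_(p in X) (f (u n) p)%:E)%E.
  rewrite (ge0_integral_setX_scale measure_fin_sigma_finite mA _ _ (s0 n))//; last 2 first.
  - exact: mf.
  - by move=> p; exact: f0.
  have us : u n `^ k * s n = 1 by rewrite /s powRN mulfV// gt_eqF// powR_gt0.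
  rewrite (fine_EFinM _ (s0 n)) mulrA us mul1r; congr fine.
rewrite (_ : (fun n => _) = fun n => fine (\int[m1 \x leb]_(p in Y) (g n p)%:E)%E); last first.
  by apply/funext => n; exact: gE.
have dE : (\int[m1 \x leb]_(p in Y) (dom p)%:E =
    (Gamma (l + k))%:E * \int[m1]_(t in A) (K * a `^ (- k))%:E)%E.
  exact: (@integral_igamma_snd (cst K) (cst a)).
have m1A : (m1 A < +oo)%E by rewrite (le_lt_trans _ m1_fin)// le_measure ?inE.
have dom0 p : 0 <= dom p by rewrite mulr_ge0 ?igamma_ge0.
have mdom : measurable_fun Y dom.
  by apply: measurable_funM => //; exact: (@measurable_igamma_snd (cst a)).
have idom : (m1 \x leb)%E.-integrable Y (EFin \o dom).
  apply/integrableP; split; first exact/measurable_EFinP.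
  under eq_integral do rewrite /= ger0_norm//.
  rewrite dE integral_cst//.
  have m1Af : m1 A = (fine (m1 A))%:E by rewrite fineK// ge0_fin_numE.
  by rewrite m1Af -!EFinM ltry.
have bound n p : Y p -> `|g n p| <= dom p.
  case: p => t v [/= At]; rewrite in_itv/= andbT => v0; rewrite /g patchE.
  case: ifPn => [/[!inE] Xp|_]; last by rewrite normr0.
  rewrite ger0_norm ?f0// /f /dom ler_pM ?w_ge0 ?igamma_ge0 ?w_le//.
  rewrite ler_igamma// ?mulr_ge0 ?powR_ge0 ?(ltW a0)//.
  apply: (@le_trans _ _ (u n * (a * (s n * v) `^ k^-1))); last first.
    by rewrite ler_pM2l//; exact: (P_ge Xp).
  rewrite powRM ?(ltW (s0 n)) ?(ltW v0)// /s -powRrM mulNr mulfV ?gt_eqF//.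
  by rewrite powR_inv1 ?(ltW (u0 n))// mulrCA mulVKf// gt_eqF.
have cvg p : Y p -> g n p @[n --> \oo] --> w0 p.1 * igamma l (c p.1 * p.2 `^ k^-1).
  case: p => t v [/= At]; rewrite in_itv/= andbT => v0.
  have sv0 n : 0 < s n * v by rewrite mulr_gt0.
  have sv : s n * v @[n --> \oo] --> (0 : R).
    by rewrite -[X in _ --> X](mul0r v); exact: cvgMl.
  have sve : \forall n \near \oo, s n * v < e by apply: cvgr_lt sv _ _.
  apply: cvg_trans (_ : w (t, s n * v) * igamma l (u n * P (t, s n * v)) @[n --> \oo] --> _).
    apply: near_eq_cvg; apply: filterS sve => n sve; rewrite /g patchE ifT//.
    by apply/mem_set; split => //=; rewrite in_itv/= sv0 sve.
  apply: cvgM; first exact: w_cvg.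
  apply: continuous_igamma => //; first by rewrite mulr_gt0 ?c_gt0 ?powR_gt0.
  rewrite (_ : (fun n => _) = fun n => P (t, s n * v) / (s n * v) `^ k^-1 * v `^ k^-1).
    by apply: cvgMl; exact: P_cvg.
  apply/funext => n; rewrite powRM ?(ltW (s0 n)) ?(ltW v0)// /s -powRrM mulNr mulfV ?gt_eqF//.
  rewrite powR_inv1 ?(ltW (u0 n))//.
  have vk : v `^ k^-1 != 0 by rewrite gt_eqF ?powR_gt0.
  by field; rewrite vk gt_eqF.
have mg n : measurable_fun Y (g n).
  by apply: measurable_patch_scale => //; exact: mf.
have [_ lim] := @dominated_cvg_seq R _ (T * measurableTypeR R)%type (m1 \x leb)%E
  Y g _ dom mY mg cvg idom bound.
have limE : (\int[m1 \x leb]_(p in Y) (w0 p.1 * igamma l (c p.1 * p.2 `^ k^-1))%:E =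
    (Gamma (l + k) * \int[m1]_(t in A) (w0 t * c t `^ (- k)))%:E)%E.
  apply: etrans; first exact: (@integral_igamma_snd w0 c).
  rewrite [RHS]EFinM; congr (_ * _)%E; apply/esym; apply: fineK.
  rewrite ge0_fin_numE; last first.
    by apply: integral_ge0 => t At; rewrite lee_fin mulr_ge0 ?powR_ge0 ?w0_ge0.
  (* The bounds on [w] and [P] pass to the limits [w0] and [c] along any heights decreasing to 0
     inside ]0, e[. They make the limit integral finite, so that [fine] loses nothing. *)
  have ub t : A t -> w0 t * c t `^ (- k) <= K * a `^ (- k).
    move=> At; pose v n := e / 2 / n.+1%:R.
    have v0 n : 0 < v n by rewrite !divr_gt0.
    have ve n : v n < e.
      apply: (@le_lt_trans _ _ (e / 2)); last by rewrite ltr_pdivrMr// ltr_pMr// ltr1n.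
      by rewrite ler_pdivrMr// ler_peMr ?divr_ge0 ?(ltW e0)// ler1n.
    have vc : v n @[n --> \oo] --> (0 : R).
      rewrite -[X in _ --> X](mulr0 (e / 2)); apply: cvgMr; exact: cvg_harmonic.
    have Xv n : X (t, v n) by split => //=; rewrite in_itv/= v0 ve.
    apply: ler_pM; rewrite ?powR_ge0 ?w0_ge0//.
      apply: (cvgr_to_le (w_cvg At v0 vc)); apply: nearW => n; exact: w_le.
    have ac : a <= c t.
      apply: (cvgr_to_ge (P_cvg At v0 vc)); apply: nearW => n.
      by rewrite ler_pdivlMr ?powR_gt0//; exact: (P_ge (Xv n)).
    by rewrite !powRN lef_pV2 ?posrE ?powR_gt0 ?c_gt0// ge0_ler_powR ?nnegrE ?(ltW k0) ?(ltW a0) ?(ltW (c_gt0 At)).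
  apply: (@le_lt_trans _ _ (\int[m1]_(t in A) (K * a `^ (- k))%:E)%E).
    apply: ge0_le_integral => //.
    - by move=> t At; rewrite lee_fin mulr_ge0 ?powR_ge0 ?w0_ge0.
    - apply/measurable_EFinP; apply: measurable_funM => //.
      exact: (measurableT_comp (measurable_powR _)).
  rewrite integral_cst// lte_mul_pinfty// ?lee_fin ?mulr_ge0 ?powR_ge0//.
by move: lim; rewrite limE => /fine_cvgP[].
Qed.

End fractional.

(** * Gaussian integrals *)

Section gaussian.
Context {R : realType}.
Notation leb := (@lebesgue_measure R).

Lemma integral_gauss_scaled (a b : R) : 0 < a ->
  (\int[leb]_x (expR (- (a * (x + b) ^+ 2 / 2)))%:E = (Num.sqrt (2 * pi / a))%:E)%E.
Proof.
(* The substitution s * (x + b) reduces to the integral of exp (- x ^ 2). *)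
move=> a0; pose s := Num.sqrt (a / 2).
have s0 : 0 < s by rewrite sqrtr_gt0 divr_gt0.
have s2 : s ^+ 2 = a / 2 by rewrite sqr_sqrtr// divr_ge0// ltW.
have := integralT_gauss (R := R) => gE.
have : (\int[leb]_x (gauss_fun x)%:E = s%:E * \int[leb]_x (expR (- (a * (x + b) ^+ 2 / 2)))%:E)%E.
  apply: etrans; first apply: (@ge0_integral_affine R s (s * b) setT) => //.
  - by apply/measurable_EFinP; exact: measurable_gauss_fun.
  - by move=> x _; rewrite lee_fin gauss_fun_ge0.
  rewrite preimage_setT; congr (_ * _)%E; apply: eq_integral => x _.
  by rewrite /gauss_fun -mulrDr exprMn s2; congr (expR (- _))%:E; rewrite mulrAC.
rewrite gE; set I := (\int[leb]_x _)%E => sI.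
rewrite -[I]mul1e -(@mulVf _ s) ?gt_eqF// EFinM -muleA -sI -EFinM; congr EFin.
apply: (mulfI (lt0r_neq0 s0)); rewrite mulVKf ?gt_eqF//.
have p0 : 0 <= (pi : R) by exact: pi_ge0.
rewrite /s -sqrtrM ?divr_ge0 ?(ltW a0)//; congr Num.sqrt; field.
by rewrite !gt_eqF.
Qed.

Definition quadratic n (Q : 'M[R]_n) (v : 'rV[R]_n) : R := dotmul (v *m Q) v.

Lemma quadraticE n (Q : 'M[R]_n) v :
  quadratic Q v = \sum_i \sum_j v ord0 i * Q i j * v ord0 j.
Proof.
rewrite /quadratic /dotmul mxE exchange_big/=; apply: eq_bigr => j _.
by rewrite mxE mulr_suml mxE; apply: eq_bigr => i _.
Qed.

Lemma measurable_quadratic n (Q : 'M[R]_n) : measurable_fun setT (quadratic Q).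
Proof.
rewrite (_ : quadratic Q = fun v => \sum_i \sum_j v ord0 i * Q i j * v ord0 j); last first.
  by apply/funext => v; exact: quadraticE.
apply: measurable_sum => i; apply: measurable_sum => j; apply: measurable_funM.
  by apply: measurable_funM => //; exact: measurable_coord.
exact: measurable_coord.
Qed.

Definition posdef n (Q : 'M[R]_n) := forall v : 'rV[R]_n, v != 0 -> 0 < quadratic Q v.

Section schur_complement.
Variables (n : nat) (Q : 'M[R]_n.+1).
Hypotheses (Qsym : Q^T = Q) (Qpos : posdef Q).
Let a := Q ord0 ord0.
Let b (y : 'rV[R]_n) := \sum_j Q ord0 (lift ord0 j) * y ord0 j.

Definition schur : 'M[R]_n :=
  \matrix_(i, j) (Q (lift ord0 i) (lift ord0 j) -
    Q ord0 (lift ord0 i) * Q ord0 (lift ord0 j) / Q ord0 ord0).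

Lemma posdef_entry_gt0 : 0 < a.
Proof.
have : delta_mx ord0 ord0 != 0 :> 'rV[R]_n.+1.
  by apply/eqP => /rowP/(_ ord0)/eqP; rewrite !mxE !eqxx oner_eq0.
move/Qpos; rewrite quadraticE (bigD1 ord0)//= (bigD1 ord0)//= !mxE !eqxx.
rewrite big1 ?addr0 => [|j /negPf j0]; last by rewrite mxE j0 mulr0.
rewrite big1 ?addr0 ?mul1r ?mulr1// => i /negPf i0.
by rewrite big1// => j _; rewrite mxE i0 !mul0r.
Qed.

Let a0 := posdef_entry_gt0.

(** Completion of the square in the first coordinate; the shift b y / a depends on the other
    coordinates only, so it disappears when x is integrated over the line. *)
Lemma quadratic_cons (x : R) y :
  quadratic Q (cons_rV (x, y)) = a * (x + b y / a) ^+ 2 + quadratic schur y.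
Proof.
have Qs i : Q (lift ord0 i) ord0 = Q ord0 (lift ord0 i) by rewrite -{1}Qsym mxE.
rewrite !quadraticE big_ord_recl/= big_ord_recl/= !mxE unlift_none -/a.
rewrite (_ : \sum_(i < n) _ = x * b y); last first.
  by rewrite /b mulr_sumr; apply: eq_bigr => j _; rewrite !mxE liftK mulrA.
rewrite (_ : \sum_(i < n) _ = x * b y + \sum_i \sum_j y ord0 i * Q (lift ord0 i) (lift ord0 j) * y ord0 j); last first.
  rewrite /b mulr_sumr -big_split/=; apply: eq_bigr => i _.
  rewrite big_ord_recl/= !mxE ?unlift_none liftK Qs; congr (_ + _); first by rewrite /=; ring.
  by apply: eq_bigr => j _; rewrite !mxE liftK.
rewrite [X in _ = _ + X](_ : _ = \sum_i \sum_j y ord0 i * Q (lift ord0 i) (lift ord0 j) * y ord0 j -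
    b y ^+ 2 / a); last first.
  rewrite expr2 {1}/b !mulr_suml -sumrB; apply: eq_bigr => i _.
  rewrite /b mulr_sumr mulr_suml -sumrB; apply: eq_bigr => j _; rewrite !mxE -/a.
  by ring.
set S := \sum_i _; rewrite /=; move: (b y) S => r S.
by field; rewrite gt_eqF.
Qed.

Lemma posdef_schur : posdef schur.
Proof.
move=> y y0; have : cons_rV (- (b y / a), y) != 0.
  apply: contra y0 => /eqP/rowP yE; apply/eqP/rowP => i.
  by have := yE (lift ord0 i); rewrite !mxE liftK.
by move/Qpos; rewrite quadratic_cons addNr expr0n mulr0 add0r.
Qed.

Lemma tr_schur : schur^T = schur.
Proof.
apply/matrixP => i j; rewrite !mxE -{1}Qsym mxE; congr (_ - _ / _).
exact: mulrC.
Qed.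

Lemma det_schur : \det Q = a * \det schur.
Proof.
pose Q' : 'M[R]_(1 + n) := Q.
(* A unipotent column operation clearing the rest of the first row; it leaves the Schur complement
   in the lower right block. *)
pose L : 'M[R]_(1 + n) := block_mx 1%:M (- a^-1 *: ursubmx Q') 0 1%:M.
have dL : \det L = 1 by rewrite /L det_ublock !det1 mulr1.
have l0 (i : 'I_n) : rshift 1 i = lift ord0 i by apply/val_inj.
have l00 : lshift n (ord0 : 'I_1) = ord0 by apply/val_inj.
have aE : ulsubmx Q' = a%:M.
  by apply/matrixP => i j; rewrite !mxE !ord1 l00 eqxx mulr1n.
have QL : Q' *m L = block_mx a%:M 0 (dlsubmx Q') schur.
  rewrite -{1}[Q']submxK /L mulmx_block !mulmx0 !mulmx1 !addr0 aE.
  congr block_mx.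
    rewrite -scalemxAr mul_scalar_mx scalerA mulNr mulVf ?gt_eqF// scaleN1r addNr//.
  apply/matrixP => i j; rewrite -scalemxAr !mxE big_ord1 !mxE !l0 l00.
  have Qi : Q' (lift ord0 i) ord0 = Q ord0 (lift ord0 i) by rewrite /Q' -{1}Qsym mxE.
  by rewrite Qi addrC /Q' -/a mulNr; congr (_ - _); rewrite mulrC.
have : \det (Q' *m L) = \det Q' by rewrite det_mulmx dL mulr1.
by rewrite QL det_lblock det_scalar1 => <-.
Qed.

End schur_complement.

Lemma det_posdef_gt0 n (Q : 'M[R]_n) : Q^T = Q -> posdef Q -> 0 < \det Q.
Proof.
elim: n Q => [Q _ _|n IH Q Qsym Qpos]; first by rewrite det_mx00.
rewrite (det_schur Qsym Qpos) mulr_gt0//; first exact: posdef_entry_gt0.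
by apply: IH; [exact: tr_schur|exact: posdef_schur].
Qed.

(** By induction on n: the first coordinate contributes sqrt (2 * pi / a) and leaves the Gaussian of
    the Schur complement, whose determinant is det Q / a. For n = 0 Lebesgue measure is a Dirac
    mass. *)
Lemma integral_gaussian_rV n (Q : 'M[R]_n) : Q^T = Q -> posdef Q ->
  (\int[lebesgue_rV n]_v (expR (- (quadratic Q v / 2)))%:E =
   ((2 * pi) `^ (n%:R / 2) / Num.sqrt (\det Q))%:E)%E.
Proof.
elim: n Q => [Q _ _|n IH Q Qsym Qpos].
  have mf : measurable_fun setT (fun v => (expR (- (quadratic Q v / 2)))%:E).
    apply/measurable_EFinP; apply: (measurableT_comp (@measurable_expR R)).
    apply: measurableT_comp => //; apply: measurable_funM => //.
    exact: measurable_quadratic.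
  apply: etrans; first exact: (@integral_dirac _ _ (0 : 'rV[R]_0) R setT measurableT _ mf).
  rewrite diracT mul1e det_mx00 sqrtr1 divr1 mul0r powRr0.
  by rewrite quadraticE big_ord0 mul0r oppr0 expR0.
have mq m (S : 'M[R]_m) : measurable_fun setT (fun v => (expR (- (quadratic S v / 2)))%:E).
  apply/measurable_EFinP; apply: (measurableT_comp (@measurable_expR R)).
  apply: measurableT_comp => //; apply: measurable_funM => //.
  exact: measurable_quadratic.
rewrite ge0_integral_lebesgue_rVS//=.
have a0 := posdef_entry_gt0 Qpos; set a := Q ord0 ord0 in a0.
pose f (p : measurableTypeR R * 'rV[R]_n) := (expR (- (quadratic Q (cons_rV p) / 2)))%:E.
have mf : measurable_fun setT f by exact: (measurableT_comp (mq _ Q) (@measurable_cons_rV R n)).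
have f0 p : (0 <= f p)%E by rewrite lee_fin expR_ge0.
(* The recursive definition integrates the first coordinate last; Tonelli makes it the inner
   integral, where the square can be translated away. *)
apply: etrans; first exact: (@fubini_tonelli _ _ _ _ _ leb (lebesgue_rV n) f mf f0).
transitivity (\int[lebesgue_rV n]_v
    ((Num.sqrt (2 * pi / a))%:E * (expR (- (quadratic (schur Q) v / 2)))%:E))%E.
  apply: eq_integral => v _.
  set b := \sum_j Q ord0 (lift ord0 j) * v ord0 j.
  rewrite -(integral_gauss_scaled (b / a) a0) -ge0_integralZr//=; last first.
    apply/measurable_EFinP; apply: (measurableT_comp (@measurable_expR R)).
    apply: measurableT_comp => //; apply: measurable_funM => //.
    by apply: measurable_funM => //; apply: measurable_funX; exact: measurable_funD.
  apply: eq_integral => x _; rewrite -EFinM -expRD /f (quadratic_cons Qsym Qpos).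
  by congr (expR _)%:E; rewrite -/a -/b; field; rewrite gt_eqF.
rewrite ge0_integralZl_EFin//.
rewrite IH; [|exact: tr_schur|exact: posdef_schur].
rewrite -EFinM; congr EFin.
have S0 := det_posdef_gt0 (tr_schur Qsym) (posdef_schur Qsym Qpos).
have p0 : 0 < 2 * pi :> R by rewrite mulr_gt0 ?pi_gt0.
rewrite (det_schur Qsym Qpos) -/a (@sqrtrM _ a) ?(ltW a0)//.
rewrite (@sqrtrM _ (2 * pi)) ?(ltW p0)// sqrtrV ?(ltW a0)//.
rewrite (_ : n.+1%:R / 2 = n%:R / 2 + 2^-1 :> R); last by rewrite -natr1 mulrDl mul1r.
rewrite powRD; last by rewrite (gt_eqF p0) implybT.
rewrite powR12_sqrt ?(ltW p0)//; field.
  by rewrite !gt_eqF ?sqrtr_gt0.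
exact: mq.
Qed.

End gaussian.

(** * Second-order calculus *)

Section second_order.
Context {R : realType} (k : nat).
Implicit Types (f g : 'rV[R]_k -> R) (x y e : 'rV[R]_k) (i j : 'I_k).

(* Moving from 0 to y one coordinate at a time keeps the path inside the box, so bounds on the
   partial derivatives suffice. *)
Definition box (r : R) : set 'rV[R]_k := [set y | forall i, `|y ord0 i| <= r].

Lemma box_norm y : box `|y| y.
Proof.
move=> i; rewrite [leRHS]/Num.norm/= mx_normrE.
exact: (le_bigmax _ (fun ij : 'I_1 * 'I_k => `|y ij.1 ij.2|) (ord0, i)).
Qed.

Lemma nbhs0_box (N : set 'rV[R]_k) : nbhs (0 : 'rV[R]_k) N ->
  exists2 r : R, 0 < r & box r `<=` N.
Proof.
move=> /nbhs_ballP[r /= r0 rN]; exists (r / 2); first by rewrite divr_gt0.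
move=> y yr; apply: rN; split => // i j; rewrite (ord1 i) /ball/= mxE sub0r normrN.
by rewrite (le_lt_trans (yr j))// ltr_pdivrMr// ltr_pMr// ltr1n.
Qed.

Lemma is_derive_line f x e (t : R) : derivable f (x + t *: e) e ->
  is_derive t (1 : R) (fun s => f (x + s *: e)) ('D_e f (x + t *: e)).
Proof.
move=> df.
have lE : (fun h : R => h^-1 *: (((fun s => f (x + s *: e)) \o shift t) (h *: (1 : R)) - f (x + t *: e))) =
    (fun h : R => h^-1 *: ((f \o shift (x + t *: e)) (h *: e) - f (x + t *: e))).
  apply/funext => h; rewrite /shift/= -[h *: 1]/(h * 1) mulr1 scalerDl.
  by congr (_ *: (f _ - _)); rewrite addrCA addrC.
by apply: DeriveDef; rewrite /derivable /derive lE.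
Qed.

Lemma mvt_line f x e (s : R) : 0 <= s ->
  (forall t : R, 0 <= t <= s -> derivable f (x + t *: e) e) ->
  exists2 t : R, 0 <= t <= s & f (x + s *: e) - f x = s * 'D_e f (x + t *: e).
Proof.
move=> s0 df.
pose g (t : R) : R := f (x + t *: e); pose dg (t : R) : R := 'D_e f (x + t *: e).
have dl (t : R) : t \in `[0, s] -> is_derive t (1 : R) g (dg t).
  by rewrite in_itv/= => ts; apply: is_derive_line; exact: df.
have dl' (t : R) : t \in `]0, s[ -> is_derive t (1 : R) g (dg t).
  by move=> ts; apply: dl; apply: subset_itv_oo_cc ts.
have cg : {within `[0, s], continuous g}.
  apply: derivable_within_continuous => t ts.
  by have [] := dl t ts.
have [t ts tE] : exists2 t : R, t \in `[0, s] & g s - g 0 = dg t * (s - 0).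
  exact: (MVT_segment s0 dl' cg).
move: ts; rewrite in_itv/= => ts.
exists t => //; move: tE.
by rewrite /g /dg scale0r addr0 subr0 mulrC.
Qed.

(** Writing the points of the segment as s * t with s in [0, 1] treats both signs of t at once; for
    t < 0 the mean value theorem is applied from the other end. *)
Lemma increment_bound f x e (t M : R) : 0 <= M ->
  (forall s : R, 0 <= s <= 1 ->
     derivable f (x + (s * t) *: e) e /\ `|'D_e f (x + (s * t) *: e)| <= M) ->
  `|f (x + t *: e) - f x| <= M * `|t|.
Proof.
move=> M0 df; have [t0|t0] := leP 0 t.
  have key (s : R) : 0 <= s <= t -> exists2 s', 0 <= s' <= 1 & s = s' * t.
    move=> /andP[s0 st]; have [tE|tn] := eqVneq t 0.
      by exists 0; rewrite ?lexx ?ler01// mul0r; apply/le_anti; rewrite s0 -tE st.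
    have tp : 0 < t by rewrite lt_neqAle eq_sym tn.
    by exists (s / t); rewrite ?divfK// divr_ge0//= ler_pdivrMr// mul1r.
  have [s /key[s' s'1 ->]|s /key[s' s'1 ->] ->] := @mvt_line f x e t t0.
    by have [] := df _ s'1.
  by rewrite normrM mulrC ler_wpM2r//; have [] := df _ s'1.
have nt0 : 0 < - t by rewrite oppr_gt0.
have arg (s : R) : (x + t *: e) + s *: e = x + (((t + s) / t) * t) *: e.
  by rewrite divfK ?lt_eqF// -addrA -scalerDl.
have rng (s : R) : 0 <= s <= - t -> 0 <= (t + s) / t <= 1.
  move=> /andP[s0 st]; rewrite ler_ndivrMr// ler_ndivlMr// mul0r mul1r.
  by rewrite lerDl s0 andbT addrC -lerBrDr sub0r.
have [s st|s st fE] := @mvt_line f (x + t *: e) e (- t) (ltW nt0).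
  by rewrite arg; have [] := df _ (rng _ st).
rewrite -normrN opprB -[X in f X - _](_ : (x + t *: e) + (- t) *: e = x); last first.
  by rewrite scaleNr addrK.
rewrite fE normrM normrN mulrC ler_wpM2r// arg.
by have [] := df _ (rng _ st).
Qed.

Lemma box_increment_bound f (r M : R) y : 0 <= r -> 0 <= M ->
  (forall y, box r y -> forall i, derivable f y (delta_mx ord0 i) /\ `|partial i f y| <= M) ->
  box r y -> `|f y - f 0| <= k%:R * (M * r).
Proof.
move=> r0 M0 df yr.
pose p m : 'rV[R]_k := \row_i (if (i < m)%N then y ord0 i else 0).
have pk : p k = y by apply/rowP => i; rewrite mxE ltn_ord.
have p0 : p 0%N = 0 by apply/rowP => i; rewrite !mxE ltn0.
have step m : (m <= k)%N -> `|f (p m) - f 0| <= m%:R * (M * r).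
  elim: m => [_|m IH mk]; first by rewrite p0 subrr normr0 mul0r.
  pose i := Ordinal mk.
  have pS : p m.+1 = p m + y ord0 i *: delta_mx ord0 i.
    apply/rowP => j; rewrite !mxE eqxx/= ltnS leq_eqVlt.
    have [->|ji] := eqVneq j i; first by rewrite eqxx ltnn mulr1 add0r.
    rewrite (_ : (_ == m) = false) ?mulr0 ?addr0//.
    by apply/negbTE; apply: contra ji => /eqP jm; apply/eqP/val_inj.
  rewrite -natr1 mulrDl mul1r -(subrKA (f (p m))) addrC.
  rewrite (le_trans (ler_normD _ _))// lerD ?IH ?(ltnW mk)// pS.
  apply: (@le_trans _ _ (M * `|y ord0 i|)); last by rewrite ler_wpM2l.
  apply: increment_bound => // s /andP[s0 s1]; apply: df => j; rewrite !mxE eqxx/=.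
  have [->|ji] := eqVneq j i.
    by rewrite ltnn add0r mulr1 normrM (le_trans _ (yr i))// ger0_norm// ler_piMl.
  by rewrite mulr0 addr0; case: ifP => _; rewrite ?normr0.
by rewrite -pk step.
Qed.

Lemma dotmulDl x y e : dotmul (x + y) e = dotmul x e + dotmul y e.
Proof. by rewrite /dotmul mulmxDl mxE. Qed.

Lemma dotmulDr x y e : dotmul e (x + y) = dotmul e x + dotmul e y.
Proof. by rewrite /dotmul linearD/= mulmxDr mxE. Qed.

Lemma dotmulZl (a : R) x y : dotmul (a *: x) y = a * dotmul x y.
Proof. by rewrite /dotmul -scalemxAl mxE. Qed.

Lemma dotmulZr (a : R) x y : dotmul x (a *: y) = a * dotmul x y.
Proof. by rewrite /dotmul linearZ/= -scalemxAr mxE. Qed.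

Lemma dotmul_sym x y (Q : 'M[R]_k) : Q^T = Q -> dotmul (x *m Q) y = dotmul (y *m Q) x.
Proof.
move=> Qs; rewrite /dotmul; transitivity ((x *m Q *m y^T)^T ord0 ord0).
  by rewrite [RHS]mxE.
by rewrite !trmx_mul trmxK Qs mulmxA.
Qed.

(** An exact quotient a + h * b is what linear functions and quadratic forms have. *)
Lemma is_derive_quotient f y e (a b : R) :
  (forall h : R, h != 0 -> f (h *: e + y) - f y = h * (a + h * b)) ->
  is_derive y e f a.
Proof.
move=> fh.
have lim : (fun h : R => h^-1 *: ((f \o shift y) (h *: e) - f y)) @ 0^' --> a.
  apply: cvg_trans (_ : a + h * b @[h --> 0^'] --> a).
    apply: near_eq_cvg; near=> h; have h0 : h != 0 by near: h; exact: nbhs_dnbhs_neq.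
    by rewrite /= fh// /GRing.scale/= mulKf.
  rewrite -[X in _ --> X]addr0; apply: cvgD; first exact: cvg_cst.
  rewrite -[X in _ --> X](mul0r b); apply: cvgMl; exact: cvg_within.
by apply: DeriveDef; [apply/cvg_ex; exists a|exact: cvg_lim lim].
Unshelve. all: end_near. Qed.

Lemma is_derive_linear (c : 'I_k -> R) y i :
  is_derive y (delta_mx ord0 i) (fun y => \sum_j c j * y ord0 j) (c i).
Proof.
apply: (@is_derive_quotient _ _ _ _ 0) => h h0; rewrite mulr0 addr0 -sumrB.
rewrite (bigD1 i)//= big1 ?addr0 => [|j ji]; first by rewrite !mxE !eqxx/=; ring.
by rewrite !mxE (negbTE ji) andbF mulr0 add0r subrr.
Qed.

Lemma is_derive_quadratic (Q : 'M[R]_k) y i : Q^T = Q ->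
  is_derive y (delta_mx ord0 i) (fun y => quadratic Q y / 2) (\sum_j Q i j * y ord0 j).
Proof.
move=> Qs; apply: (@is_derive_quotient _ _ _ _ (Q i i / 2)) => h h0.
have dQ (v : 'rV[R]_k) : dotmul (delta_mx ord0 i *m Q) v = \sum_j Q i j * v ord0 j.
  by rewrite /dotmul mxE; apply: eq_bigr => j _; rewrite -rowE !mxE.
rewrite /quadratic mulmxDl dotmulDl !dotmulDr -!scalemxAl !dotmulZl !dotmulZr.
rewrite (dotmul_sym y _ Qs) !dQ.
rewrite [X in h * (h * X)](bigD1 i)//= [X in h * (h * (_ + X))]big1 => [|j ji]; last first.
  by rewrite !mxE (negbTE ji) andbF mulr0.
by rewrite !mxE !eqxx/=; field.
Qed.

Section Ck2.
Variables (U : set 'rV[R]_k) (f : 'rV[R]_k -> R).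
Hypotheses (oU : open U) (U0 : U 0) (Cf : Ck 2 U f).

Let d1 y i : U y -> derivable f y (delta_mx ord0 i).
Proof. by move=> Uy; have [_ /(_ i)[+ _]] := Cf; apply. Qed.

Let d2 y i j : U y -> derivable (partial i f) y (delta_mx ord0 j).
Proof. by move=> Uy; have [_ /(_ i)[_ [_ /(_ j)[+ _]]]] := Cf; apply. Qed.

Let c2 y i j : U y -> {for y, continuous (partial j (partial i f))}.
Proof. by move=> Uy; have [_ /(_ i)[_ [_ /(_ j)[_ [+ _]]]]] := Cf; apply. Qed.

Let normr_le_half (a b c e : R) : `|a - b| <= e / 2 -> `|b - c| <= e / 2 -> `|a - c| <= e.
Proof.
by move=> ab bc; rewrite (le_trans (ler_distD b _ _))// [leRHS](splitr e) lerD.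
Qed.

Lemma near_partial2 (eps : R) : 0 < eps -> exists2 r : R, 0 < r &
  forall y, box r y -> U y /\
    forall i j, `|partial j (partial i f) y - partial j (partial i f) 0| <= eps.
Proof.
move=> e0; apply: (@nbhs0_box [set y | U y /\
    forall i j, `|partial j (partial i f) y - partial j (partial i f) 0| <= eps]).
apply: filterI; first exact: open_nbhs_nbhs.
have h (ij : 'I_k * 'I_k) : \forall y \near (0 : 'rV[R]_k),
    `|partial ij.2 (partial ij.1 f) y - partial ij.2 (partial ij.1 f) 0| <= eps.
  by have /cvgrPdistC_le := c2 (i := ij.1) (j := ij.2) U0; apply.
have := @filter_forall _ _ _ _ (nbhs_filter (0 : 'rV[R]_k)) h.
by apply: filterS => y hy i j; exact: hy (i, j).
Qed.

(** The mean value theorem is applied twice: in direction i to the first difference in direction j,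
    then in direction j to the partial derivative in direction i. *)
Lemma second_difference i j (s : R) : 0 <= s -> box (2 * s) `<=` U ->
  exists2 y, box (2 * s) y &
    f (s *: delta_mx ord0 j + s *: delta_mx ord0 i) - f (s *: delta_mx ord0 i) -
      f (s *: delta_mx ord0 j) + f 0 = s ^+ 2 * partial j (partial i f) y.
Proof.
move=> s0 sU; pose ei : 'rV[R]_k := delta_mx ord0 i; pose ej : 'rV[R]_k := delta_mx ord0 j.
have bx (a b : R) : 0 <= a <= s -> 0 <= b <= s -> box (2 * s) (a *: ei + b *: ej).
  move=> /andP[a0 as_] /andP[b0 bs] l; rewrite !mxE eqxx/= (le_trans (ler_normD _ _))//.
  rewrite mulrDl mul1r lerD// normrM ger0_norm//.
    by case: eqP => _; rewrite ?normr1 ?mulr1 ?normr0 ?mulr0.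
  by case: eqP => _; rewrite ?normr1 ?mulr1 ?normr0 ?mulr0.
have ss : 0 <= s <= s by rewrite s0 lexx.
have z0 : (0 : R) <= 0 <= s by rewrite lexx.
pose g x := f (s *: ej + x) - f x.
have dg (t : R) : 0 <= t <= s -> is_derive (0 + t *: ei) ei g
    (partial i f (t *: ei + s *: ej) - partial i f (t *: ei)).
  move=> ts; rewrite add0r.
  have D1 : derivable f (t *: ei + s *: ej) ei by apply: d1; apply: sU; exact: bx.
  have D2 : derivable f (t *: ei) ei.
    by apply: d1; apply: sU; have := bx t 0 ts z0; rewrite scale0r addr0.
  have lE : (fun h : R => h^-1 *: (((fun x => f (s *: ej + x)) \o shift (t *: ei)) (h *: ei) -
      f (s *: ej + t *: ei))) =
      (fun h : R => h^-1 *: ((f \o shift (t *: ei + s *: ej)) (h *: ei) -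
      f (t *: ei + s *: ej))).
    apply/funext => h; rewrite /shift/=; congr (_ *: (f _ - f _)); last exact: addrC.
    by rewrite addrC addrA.
  apply: is_deriveB; first by apply: DeriveDef; rewrite /partial /derivable /derive lE.
  exact: DeriveDef.
have [t ts|t ts tE] := @mvt_line g 0 ei s s0; first by have [] := dg t ts.
have [_ gE] := dg t ts; rewrite gE in tE.
have [v vs|v vs vE] := @mvt_line (partial i f) (t *: ei) ej s s0.
  by apply: d2; apply: sU; exact: bx.
exists (t *: ei + v *: ej); first exact: bx.
rewrite vE in tE; rewrite expr2 -mulrA /partial -/ej -/ei -[in RHS]/(partial i f) -tE /g.
by rewrite add0r addr0; ring.
Qed.

(** The second difference is symmetric in i and j, so the two mixed derivatives agree at some pair
    of points near 0, and both are continuous there. *)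
Lemma partial_comm i j : partial j (partial i f) 0 = partial i (partial j f) 0.
Proof.
apply/eqP; rewrite -subr_eq0 -normr_le0; apply/ler_addgt0Pl => e e0; rewrite addr0.
have [|r r0 rU] := @near_partial2 (e / 2); first by rewrite divr_gt0.
have r20 : 0 < r / 2 by rewrite divr_gt0.
have r2 : 2 * (r / 2) = r by rewrite mulrC divfK.
have [|y yb yE] := @second_difference i j _ (ltW r20).
  by rewrite r2 => y /rU[].
have [|z zb zE] := @second_difference j i _ (ltW r20).
  by rewrite r2 => z /rU[].
rewrite r2 in yb zb.
have E : partial j (partial i f) y = partial i (partial j f) z.
  apply: (@mulfI _ ((r / 2) ^+ 2)); first by rewrite expf_neq0// gt_eqF.
  apply: etrans (esym yE) _; apply: etrans _ zE; congr (_ + _).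
  by rewrite [X in f X - _ - _]addrC; exact: addrAC.
have [_ /(_ i j) yc] := rU y yb; have [_ /(_ j i) zc] := rU z zb.
rewrite E distrC in yc; exact: (normr_le_half yc zc).
Qed.

Definition hess : 'M[R]_k := \matrix_(i, j) partial j (partial i f) 0.

Lemma tr_hess : hess^T = hess.
Proof. by apply/matrixP => i j; rewrite !mxE partial_comm. Qed.

(** [box_increment_bound] is used twice: on each partial derivative minus its linear part, then on
    the remainder itself, whose partial derivatives are these differences. *)
Lemma taylor2 (eps : R) : 0 < eps -> (forall i, partial i f 0 = 0) ->
  exists2 r : R, 0 < r & forall s y, s <= r -> box s y ->
    U y /\ `|f y - f 0 - quadratic hess y / 2| <= eps * s ^+ 2.
Proof.
move=> e0 f0.
(* Each of the two increment bounds costs a factor k; the added 1 keeps [K] positive for k = 0. *)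
pose K : R := k%:R ^+ 2 + 1; have K0 : 0 < K by rewrite ltr_wpDl// sqr_ge0.
have [|r r0 rU] := @near_partial2 (eps / K); first by rewrite divr_gt0.
exists r => // s y sr ys.
have Us z : box s z -> U z by move=> zs; have [|//] := rU z; move=> i; exact: le_trans (zs i) sr.
split; first exact: Us.
(* A box of negative size is nonempty only in dimension 0. *)
have [s0|s0] := ltP s 0.
  have [k0|k0] := posnP k; last first.
    by have := ys (Ordinal k0); rewrite leNgt (lt_le_trans s0).
  have -> : y = 0 by apply/rowP => i; have := ltn_ord i; rewrite {2}k0.
  have -> : quadratic hess 0 = 0 by rewrite /quadratic mul0mx /dotmul mul0mx mxE.
  by rewrite subrr mul0r subrr normr0 mulr_ge0 ?sqr_ge0 ?ltW.
pose ee := eps / K; have ee0 : 0 <= ee by rewrite divr_ge0 ?ltW.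
have lin z i : box s z -> `|partial i f z - \sum_j hess i j * z ord0 j| <= k%:R * (ee * s).
  move=> zs.
  have := @box_increment_bound (fun z => partial i f z - \sum_j hess i j * z ord0 j) s ee z s0 ee0.
  rewrite f0 (_ : \sum_j hess i j * (0 : 'rV[R]_k) ord0 j = 0); last first.
    by rewrite big1// => j _; rewrite [X in _ * X]mxE mulr0.
  rewrite subr0 subr0; apply => // w ws j.
  have dl := is_derive_linear (hess i) w j; have dp := d2 (i := i) (j := j) (Us _ ws).
  split; first by apply: derivableB => //; have [] := dl.
  have [dl1 dl2] := dl.
  rewrite /partial deriveB// dl2 mxE.
  by have [|_] := rU w; [move=> l; exact: le_trans (ws l) sr|exact].
have M0 : 0 <= k%:R * (ee * s) by exact: mulr_ge0 (ler0n _ _) (mulr_ge0 ee0 s0).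
have := @box_increment_bound (fun z => f z - f 0 - quadratic hess z / 2) s _ y s0 M0.
have -> : quadratic hess 0 = 0 by rewrite /quadratic mul0mx /dotmul mul0mx mxE.
rewrite subrr mul0r subrr subr0 => bnd; apply: le_trans (bnd _ ys) _.
  move=> w ws j; have [dq1 dq2] := is_derive_quadratic w j tr_hess.
  have df : derivable (fun z => f z - f 0) w (delta_mx ord0 j).
    by apply: derivableB; [exact: d1 (Us _ ws)|exact: derivable_cst].
  split; first exact: derivableB.
  rewrite /partial deriveB// dq2 deriveB ?derive_cst ?subr0; first exact: lin.
    exact: d1 (Us _ ws).
  exact: derivable_cst.
rewrite (_ : _ * _ = ee * k%:R ^+ 2 * s ^+ 2); last by ring.
rewrite ler_wpM2r ?sqr_ge0// /ee mulrAC ler_pdivrMr// ler_pM2l//.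
by rewrite /K lerDl.
Qed.

End Ck2.
End second_order.

(** * Laplace asymptotics *)

Section laplace.
Context {R : realType}.
Notation leb := (@lebesgue_measure R).

Lemma quadraticZ n (Q : 'M[R]_n) (a : R) v : quadratic Q (a *: v) = a ^+ 2 * quadratic Q v.
Proof. by rewrite /quadratic -scalemxAl dotmulZl dotmulZr mulrA. Qed.

Lemma quadraticZm n (Q : 'M[R]_n) (a : R) v : quadratic (a *: Q) v = a * quadratic Q v.
Proof. by rewrite /quadratic -scalemxAr dotmulZl. Qed.

Lemma continuous_quadratic n (Q : 'M[R]_n) : continuous (quadratic Q).
Proof.
move=> v; rewrite (_ : quadratic Q = fun v => \sum_i \sum_j v ord0 i * Q i j * v ord0 j); last first.
  by apply/funext => v'; exact: quadraticE.
apply: (@cvg_big_sum _ _ (nbhs v) (nbhs_filter v)) => i.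
apply: (@cvg_big_sum _ _ (nbhs v) (nbhs_filter v)) => j.
apply: cvgM; last exact: coord_continuous.
by apply: cvgMl; exact: coord_continuous.
Qed.

(** The constant is the minimum of the form on the compact unit sphere of the sup norm. *)
Lemma posdef_lower_bound n (Q : 'M[R]_n) : posdef Q ->
  exists2 a : R, 0 < a & forall v, a * `|v| ^+ 2 <= quadratic Q v.
Proof.
move=> Qpos; pose S := [set v : 'rV[R]_n | `|v| = 1].
have q0 : quadratic Q 0 = 0 by rewrite /quadratic mul0mx /dotmul mul0mx mxE.
have nS v : v != 0 -> S (`|v|^-1 *: v).
  by move=> v0; rewrite /S/= normrZ normfV normr_id mulVf// normr_eq0.
(* An empty unit sphere means that every vector is 0; any constant works then. *)
have [S0|/set0P S0] := eqVneq S set0.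
  exists 1 => // v; have [->|/nS] := eqVneq v 0; last by rewrite S0.
  by rewrite normr0 expr0n/= mulr0 q0.
have cS : compact S.
  apply: bounded_closed_compact.
    by exists 1; split => // x x1 v /= ->; exact: ltW.
  rewrite (_ : S = (fun v : 'rV[R]_n => `|v|) @^-1` [set 1])//.
  apply: closed_comp => [v _|]; first exact: norm_continuous.
  by apply: accessible_closed_set1; apply: hausdorff_accessible; exact: Rhausdorff.
have cq : {within S, continuous quadratic Q}.
  by apply: continuous_subspaceT; exact: continuous_quadratic.
have [v Sv vmin] := EVT_min_rV S0 cS cq.
exists (quadratic Q v).
  by apply: Qpos; apply/eqP => v0; move: Sv; rewrite inE /S/= v0 normr0 => /eqP; rewrite eq_sym oner_eq0.
move=> y; have [->|y0] := eqVneq y 0; first by rewrite normr0 expr0n/= mulr0 q0.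
have ny : 0 < `|y| by rewrite normr_gt0.
rewrite -ler_pdivlMr ?exprn_gt0//.
have := vmin (`|y|^-1 *: y); rewrite inE => /(_ (nS _ y0)).
by rewrite quadraticZ exprVn mulrC.
Qed.

Lemma sigma_finite_lebesgue_rV n :
  sigma_finite setT (lebesgue_rV n : {measure set 'rV[R]_n -> \bar R}).
Proof. by have := @sigma_finiteT _ _ _ (@lebesgue_rV R n); exact. Qed.

Lemma integral_gaussian_expR n (Q : 'M[R]_n) (b : R) : Q^T = Q -> posdef Q -> 0 < b ->
  (\int[lebesgue_rV n \x leb]_(p in [set: 'rV[R]_n] `*` `]0%R, +oo[)
     (expR (- (quadratic Q p.1 / 2 + b * p.2)))%:E =
   ((2 * pi) `^ (n%:R / 2) / Num.sqrt (\det Q) / b)%:E)%E.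
Proof.
move=> Qs Qpos b0.
have mq : measurable_fun setT (fun v => expR (- (quadratic Q v / 2))).
  apply: (measurableT_comp (@measurable_expR R)).
  apply: measurableT_comp => //; apply: measurable_funM => //.
  exact: measurable_quadratic.
have mb : measurable_fun setT (fun s : R => expR (- (b * s))).
  apply: (measurableT_comp (@measurable_expR R)).
  by apply: measurableT_comp => //; exact: measurable_funM.
apply: etrans; first apply: (@ge0_fubini_setX _ _ _ _ R (lebesgue_rV n) leb setT `]0%R, +oo[%classic) => //.
- apply/measurable_EFinP; apply: measurable_funTS.
  rewrite (_ : (fun p : 'rV[R]_n * R => _) = fun p =>
      expR (- (quadratic Q p.1 / 2)) * expR (- (b * p.2))); last first.
    by apply/funext => p; rewrite opprD expRD.
  by apply: measurable_funM; [apply: (measurableT_comp mq)|apply: (measurableT_comp mb)].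
- exact: sigma_finite_lebesgue_rV.
transitivity (\int[lebesgue_rV n]_v ((expR (- (quadratic Q v / 2)))%:E * (b^-1)%:E))%E.
  apply: eq_integral => v _; rewrite -(integral_expRN b0).
  rewrite -integral_itv_obnd_cbnd; last first.
    by apply/measurable_EFinP; exact: measurable_funTS.
  rewrite -ge0_integralZl_EFin ?expR_ge0//=; last first.
    by apply/measurable_EFinP; exact: measurable_funTS.
  by apply: eq_integral => s _; rewrite opprD expRD EFinM.
rewrite ge0_integralZr//=; last 2 first.
- exact/measurable_EFinP.
- by rewrite lee_fin invr_ge0 ltW.
by rewrite integral_gaussian_rV// -EFinM.
Qed.

Lemma ge0_integral_setX_scale_rV n (c : R) (g : 'rV[R]_n * R -> R) : 0 < c ->
  measurable_fun setT g -> (forall p, 0 <= g p) ->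
  (\int[lebesgue_rV n \x leb]_(p in [set: 'rV[R]_n] `*` `]0%R, +oo[) (g p)%:E =
   (c ^+ n)%:E * \int[lebesgue_rV n \x leb]_(p in [set: 'rV[R]_n] `*` `]0%R, +oo[)
     (g (c *: p.1, p.2))%:E)%E.
Proof.
move=> c0 mg g0.
have mgc : measurable_fun setT (fun p : 'rV[R]_n * R => g (c *: p.1, p.2)).
  apply: (measurableT_comp mg); apply: measurable_fun_pair => //.
  exact: (measurableT_comp (@measurable_scale_rV R n c)).
transitivity (\int[lebesgue_rV n]_y \int[leb]_(s in `]0%R, +oo[) (g (y, s))%:E)%E.
  apply: (@ge0_fubini_setX _ _ _ _ R (lebesgue_rV n) leb setT `]0%R, +oo[%classic) => //.
  - by apply/measurable_EFinP; exact: measurable_funTS.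
  - by move=> y s _ _; rewrite lee_fin.
  - exact: sigma_finite_lebesgue_rV.
transitivity ((c ^+ n)%:E * \int[lebesgue_rV n]_y \int[leb]_(s in `]0%R, +oo[) (g (c *: y, s))%:E)%E.
  apply: (@ge0_integral_lebesgue_rV_scale R n c (fun y => \int[leb]_(s in `]0%R, +oo[) (g (y, s))%:E)%E) => //.
    apply: (@measurable_fun_integral_setX _ _ _ _ R leb setT `]0%R, +oo[%classic
      (fun p => (g p)%:E)) => //.
    - by apply/measurable_EFinP; exact: measurable_funTS.
    - by move=> y s _ _; rewrite lee_fin.
  by move=> y; apply: integral_ge0 => s _; rewrite lee_fin.
congr (_ * _)%E; apply/esym.
apply: (@ge0_fubini_setX _ _ _ _ R (lebesgue_rV n) leb setT `]0%R, +oo[%classic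
  (fun p => (g (c *: p.1, p.2))%:E)) => //.
- by apply/measurable_EFinP; exact: measurable_funTS.
- by move=> y s _ _; rewrite lee_fin.
- exact: sigma_finite_lebesgue_rV.
Qed.

End laplace.

(** * Laplace asymptotics at a boundary minimum *)

Section laplace_asymptotics.
Context {R : realType} (k : nat).
Notation leb := (@lebesgue_measure R).
(** [w] is the effective density times the Riemannian density of the chart, [P] is Phi in chart and
    collar coordinates. [P_ge] has rates below those of the limit [P_cvg], as a majorant allows;
    together with mu, [M] bounds P ^ (l - 1) for either sign of l - 1. *)
Variables (r e mu b c1 w0 K M l : R) (Q : 'M[R]_k) (w P : 'rV[R]_k * R -> R).
Let S : set 'rV[R]_k := ball (0 : 'rV[R]_k) r.
Let X : set ('rV[R]_k * R) := S `*` `]0, e[.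
Hypotheses (r0 : 0 < r) (e0 : 0 < e) (mu0 : 0 < mu) (b0 : 0 < b) (c10 : 0 < c1)
  (l0 : 0 < l) (K0 : 0 <= K) (Qsym : Q^T = Q) (Qpos : posdef Q) (w0_ge0 : 0 <= w0)
  (mw : measurable_fun X w) (mP : measurable_fun X P)
  (w_ge0 : forall p, X p -> 0 <= w p) (w_le : forall p, X p -> w p <= K)
  (P_ge : forall p, X p -> mu + (quadratic Q p.1 / 4 + b * p.2) <= P p)
  (P_le : forall p, X p -> P p <= M)
  (w_cvg : forall (z : nat -> R) (y : 'rV[R]_k) (s : R), (forall n, 1 <= z n) ->
     z n @[n --> \oo] --> +oo -> 0 < s ->
     w (z n `^ (- 2^-1) *: y, s / z n) @[n --> \oo] --> w0)
  (P_cvg : forall (z : nat -> R) (y : 'rV[R]_k) (s : R), (forall n, 1 <= z n) ->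
     z n @[n --> \oo] --> +oo -> 0 < s ->
     z n * (P (z n `^ (- 2^-1) *: y, s / z n) - mu) @[n --> \oo] -->
       quadratic Q y / 2 + c1 * s).

Let Y : set ('rV[R]_k * R) := [set: 'rV[R]_k] `*` `]0, +oo[.

Let mY : measurable Y.
Proof. by apply: measurableX => //; exact: measurable_itv. Qed.

Let mX : measurable X.
Proof. by apply: measurableX; [exact: measurable_mx_ball|exact: measurable_itv]. Qed.

Let q_ge0 v : 0 <= quadratic Q v.
Proof.
have [->|/Qpos/ltW//] := eqVneq v 0.
by rewrite /quadratic mul0mx /dotmul mul0mx mxE.
Qed.

Let P_mu p : X p -> mu <= P p.
Proof.
move=> Xp; rewrite (le_trans _ (P_ge Xp))// lerDl addr_ge0 ?divr_ge0//.
rewrite mulr_ge0 ?(ltW b0)//.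
by case: Xp => _ /=; rewrite in_itv/= => /andP[/ltW].
Qed.

Let f (z : R) (p : 'rV[R]_k * R) := w p * igamma l (z * P p).

Let mf z : 0 < z -> measurable_fun X (f z).
Proof.
move=> z0; apply: measurable_funM => //.
apply: measurable_igamma_comp => // [|p Xp]; first exact: measurable_funM.
by rewrite mulr_gt0// (lt_le_trans _ (P_mu Xp)).
Qed.

Let f0 z p : X p -> 0 <= f z p.
Proof. by move=> Xp; rewrite mulr_ge0 ?w_ge0 ?igamma_ge0. Qed.

Let fX0 z p : 0 <= (f z \_ X) p.
Proof. by rewrite patchE; case: ifPn => // /set_mem; exact: f0. Qed.

Let c (z : R) := z `^ (- 2^-1).

Let c_sqr z : 0 < z -> z * c z ^+ 2 = 1.
Proof.
move=> z0; rewrite /c powRN exprVn powR12_sqrt ?(ltW z0)// sqr_sqrtr ?(ltW z0)//.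
by rewrite mulfV// gt_eqF.
Qed.

Let scaled (z : R) (p : 'rV[R]_k * R) : 'rV[R]_k * R := (c z *: p.1, p.2 / z).

(** The factor z ^ (k / 2 + 1) of the full normalization is missing here because it cancels the
    Jacobian of the scaling. *)
Let g (z : R) (p : 'rV[R]_k * R) := z `^ (1 - l) * expR (mu * z) * (f z \_ X) (scaled z p).

Let integralZl_Y (C : R) (hc : 'rV[R]_k * R -> R) : 0 <= C -> measurable_fun Y hc ->
  (forall p, 0 <= hc p) ->
  (\int[lebesgue_rV k \x leb]_(p in Y) (C * hc p)%:E =
   C%:E * \int[lebesgue_rV k \x leb]_(p in Y) (hc p)%:E)%E.
Proof.
move=> C0 mh h0; under eq_integral do rewrite EFinM.
apply: ge0_integralZl_EFin => //; last exact/measurable_EFinP.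
by move=> p _; rewrite lee_fin.
Qed.

Let integral_scaled z : 0 < z ->
  z `^ (k%:R / 2 + 1 + (1 - l)) * expR (mu * z) *
    fine (\int[lebesgue_rV k \x leb]_(p in X) (w p * igamma l (z * P p))%:E)%E =
  fine (\int[lebesgue_rV k \x leb]_(p in Y) (g z p)%:E)%E.
Proof.
move=> z0; have c0 : 0 < c z by rewrite powR_gt0.
have zi0 : 0 < z^-1 by rewrite invr_gt0.
have mfX : measurable_fun setT (f z \_ X) by apply/(measurable_restrictT (f z)) => //; exact: mf.
pose h p := (f z \_ X) (p.1, z^-1 * p.2).
have mh : measurable_fun setT h.
  apply: (measurableT_comp mfX); apply: measurable_fun_pair => //.
  by apply: measurable_funM.
have E1 : (\int[lebesgue_rV k \x leb]_(p in X) (w p * igamma l (z * P p))%:E =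
    (z^-1)%R%:E * \int[lebesgue_rV k \x leb]_(p in S `*` `]0%R, +oo[) (h p)%:E)%E.
  exact: (ge0_integral_setX_scale (sigma_finite_lebesgue_rV k)
    (measurable_mx_ball _ _) (mf z0) (@f0 z) zi0).
have E2 : (\int[lebesgue_rV k \x leb]_(p in S `*` `]0%R, +oo[) (h p)%:E =
    \int[lebesgue_rV k \x leb]_(p in Y) (h p)%:E)%E.
  rewrite integral_mkcond [RHS]integral_mkcond; apply: eq_integral => -[y s] _.
  rewrite !patchE; case: ifPn => [/set_mem[by_ s0]|].
    by rewrite ifT//; apply/mem_set.
  move=> /negP nX; case: ifPn => // /set_mem[_ s0]; rewrite /h patchE ifF//.
  apply/negbTE/negP => /set_mem[by_ _]; apply: nX; apply/mem_set; split => //.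
have E3 : (\int[lebesgue_rV k \x leb]_(p in Y) (h p)%:E = (c z ^+ k)%:E *
    \int[lebesgue_rV k \x leb]_(p in Y) (h (c z *: p.1, p.2))%:E)%E.
  by apply: ge0_integral_setX_scale_rV => // p; exact: fX0.
pose C := z `^ (1 - l) * expR (mu * z).
have C0 : 0 < C by rewrite mulr_gt0 ?powR_gt0 ?expR_gt0.
have E4 : (\int[lebesgue_rV k \x leb]_(p in Y) (g z p)%:E = C%:E *
    \int[lebesgue_rV k \x leb]_(p in Y) (h (c z *: p.1, p.2))%:E)%E.
  transitivity (\int[lebesgue_rV k \x leb]_(p in Y) (C * h (c z *: p.1, p.2))%:E)%E.
    by apply: eq_integral => p _; rewrite /g /h /scaled/= [_ / z]mulrC.
  apply: (integralZl_Y (ltW C0)) => [|p]; last exact: fX0.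
  apply: measurable_funTS.
  apply: (measurableT_comp mh); apply: measurable_fun_pair => /=.
    exact: (measurableT_comp (@measurable_scale_rV R k (c z))).
  exact: measurable_snd.
rewrite E1 E2 E3 E4 (fine_EFinM _ zi0) (fine_EFinM _ C0) (fine_EFinM _ (exprn_gt0 k c0)).
rewrite !mulrA; congr (_ * _); rewrite /C -powR_mulrn ?(ltW c0)// /c -powRrM.
rewrite (_ : - 2^-1 * k%:R = - (k%:R / 2)); last by rewrite mulNr mulrC.
rewrite powRN 2?powRD ?(gt_eqF z0) ?implybT// powRr1 ?(ltW z0)//.
by field; rewrite !gt_eqF// powR_gt0.
Qed.

Let dom C (p : 'rV[R]_k * R) := C * expR (- (quadratic (2^-1 *: Q) p.1 / 2 + b * p.2)).

(** The factorization of [igamma] cancels the normalizing factors exactly, leaving a product in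
    which every factor is bounded and converges separately. *)
Let gP z p : 1 <= z -> X (scaled z p) -> g z p =
  w (scaled z p) * P (scaled z p) `^ (l - 1) * expR (- (z * (P (scaled z p) - mu))) *
    igamma_ratio l (z * P (scaled z p)).
Proof.
move=> z1 Xp; have z0 : 0 < z by exact: lt_le_trans z1.
have P0 : 0 < P (scaled z p) by exact: lt_le_trans (P_mu Xp).
rewrite /g patchE mem_set// /f igamma_ratioE ?mulr_gt0// powRM ?(ltW z0) ?(ltW P0)//.
have zz : z `^ (1 - l) * z `^ (l - 1) = 1.
  rewrite -powRD ?(gt_eqF z0) ?implybT// (_ : _ + _ = 0) ?powRr0//; by ring.
have ee : expR (mu * z) * expR (- (z * P (scaled z p))) = expR (- (z * (P (scaled z p) - mu))).
  by rewrite -expRD; congr expR; ring.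
rewrite -ee; transitivity ((z `^ (1 - l) * z `^ (l - 1)) * (w (scaled z p) * P (scaled z p) `^ (l - 1) *
  (expR (mu * z) * expR (- (z * P (scaled z p)))) * igamma_ratio l (z * P (scaled z p)))).
  by ring.
by rewrite zz mul1r.
Qed.

(* After the substitution (y, s) -> (z ^ (- 1 / 2) y, s / z) the integrand converges to a multiple
   of exp (- quadratic Q y / 2 - c1 * s) and is dominated by one of exp (- quadratic Q y / 4 - b * s). *)
Lemma laplace_asymptotics (z : nat -> R) : (forall n, 1 <= z n) ->
  z n @[n --> \oo] --> +oo ->
  z n `^ (k%:R / 2 + 1 + (1 - l)) * expR (mu * z n) *
    fine (\int[lebesgue_rV k \x leb]_(p in X) (w p * igamma l (z n * P p))%:E)%E
    @[n --> \oo] -->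
  w0 * mu `^ (l - 1) * ((2 * pi) `^ (k%:R / 2) / Num.sqrt (\det Q) / c1).
Proof.
move=> z1 zoo; have z0 n : 0 < z n by exact: lt_le_trans (z1 n).
rewrite (_ : (fun n => _) = fun n => fine (\int[lebesgue_rV k \x leb]_(p in Y) (g (z n) p)%:E)%E); last first.
  by apply/funext => n; exact: integral_scaled.
have [L L0 Lle] := igamma_ratio_bounded l mu0.
(* Since mu <= P <= M, the sum bounds P ^ (l - 1) by its second term when l >= 1 and by its first
   when l < 1. *)
pose C := K * (mu `^ (l - 1) + M `^ (l - 1)) * L.
have C0 : 0 <= C by rewrite !mulr_ge0 ?addr_ge0 ?powR_ge0 ?(ltW L0).
have bound n p : Y p -> `|g (z n) p| <= dom C p.
  move=> Yp; have [Xp|nXp] := pselect (X (scaled (z n) p)); last first.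
    rewrite /g patchE memNset// mulr0 normr0 /dom mulr_ge0 ?expR_ge0//.
  have Pmu := P_mu Xp; have P0 : 0 < P (scaled (z n) p) by exact: lt_le_trans Pmu.
  rewrite gP// ger0_norm ?mulr_ge0 ?w_ge0 ?powR_ge0 ?expR_ge0 ?igamma_ratio_ge0//.
  rewrite /dom /C [leRHS]mulrAC; apply: ler_pM; rewrite ?igamma_ratio_ge0 ?mulr_ge0 ?w_ge0 ?powR_ge0 ?expR_ge0//.
    apply: ler_pM; rewrite ?mulr_ge0 ?w_ge0 ?powR_ge0 ?expR_ge0//.
      apply: ler_pM; rewrite ?w_ge0 ?powR_ge0 ?w_le//.
      have [l1|l1] := leP 0 (l - 1).
        apply: (@le_trans _ _ (M `^ (l - 1))); last by rewrite lerDr powR_ge0.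
        have PM := P_le Xp.
        by rewrite ge0_ler_powR ?nnegrE ?(ltW P0) ?(le_trans (ltW P0) PM).
      apply: (@le_trans _ _ (mu `^ (l - 1))); last by rewrite lerDl powR_ge0.
      have [l' l'0 ->] : exists2 l', 0 <= l' & l - 1 = - l'.
        by exists (- (l - 1)); rewrite ?opprK// oppr_ge0 ltW.
      by rewrite !powRN lef_pV2 ?posrE ?powR_gt0// ge0_ler_powR ?nnegrE ?(ltW P0) ?(ltW mu0).
    rewrite ler_expR lerN2 quadraticZm.
    have := P_ge Xp; rewrite /scaled/= quadraticZ => PX.
    have : z n * (c (z n) ^+ 2 * quadratic Q p.1 / 4 + b * (p.2 / z n)) <= z n * (P (scaled (z n) p) - mu).
      by rewrite ler_pM2l// lerBrDl.
    apply: le_trans.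
    have -> : z n * (c (z n) ^+ 2 * quadratic Q p.1 / 4 + b * (p.2 / z n)) =
        (z n * c (z n) ^+ 2) * quadratic Q p.1 / 4 + b * p.2.
      by field; rewrite gt_eqF.
    by rewrite c_sqr// mul1r (_ : 2^-1 * _ / 2 = quadratic Q p.1 / 4)//; field.
  by apply: Lle; rewrite (le_trans Pmu)// ler_peMl// ltW.
have mg n : measurable_fun Y (g (z n)).
  apply: measurable_funTS; apply: measurable_funM => //.
  have mfX : measurable_fun setT (f (z n) \_ X).
    by apply/(measurable_restrictT (f (z n))) => //; exact: mf.
  apply: (measurableT_comp mfX); apply: measurable_fun_pair => /=.
    exact: (measurableT_comp (@measurable_scale_rV R k (c (z n)))).
  by apply: measurable_funM.
have hQs : (2^-1 *: Q)^T = 2^-1 *: Q by rewrite linearZ/= Qsym.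
have hQpos : posdef (2^-1 *: Q).
  by move=> v v0; rewrite quadraticZm mulr_gt0// Qpos.
have mexp (S' : 'M[R]_k) (a : R) : measurable_fun Y (fun p => expR (- (quadratic S' p.1 / 2 + a * p.2))).
  apply: measurable_funTS; apply: (measurableT_comp (@measurable_expR R)).
  apply: measurableT_comp => //; apply: measurable_funD; last exact: measurable_funM.
  apply: measurable_funM => //.
  exact: (measurableT_comp (@measurable_quadratic R k S')).
have gaussC (S' : 'M[R]_k) (a C' : R) : S'^T = S' -> posdef S' -> 0 < a -> 0 <= C' ->
    (\int[lebesgue_rV k \x leb]_(p in Y) (C' * expR (- (quadratic S' p.1 / 2 + a * p.2)))%:E =
    (C' * ((2 * pi) `^ (k%:R / 2) / Num.sqrt (\det S') / a))%:E)%E.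
  move=> Ss Spos a0 C'0; rewrite EFinM -(integral_gaussian_expR Ss Spos a0).
  exact: (integralZl_Y C'0 (mexp S' a) (fun p => expR_ge0 _)).
have idom : (lebesgue_rV k \x leb)%E.-integrable Y (EFin \o dom C).
  apply/integrableP; split.
    by apply/measurable_EFinP; apply: measurable_funM => //; exact: mexp.
  under eq_integral do rewrite /= ger0_norm ?(mulr_ge0 C0 (expR_ge0 _))//.
  by have := gaussC _ _ _ hQs hQpos b0 C0 => ->; rewrite ltry.
have cvg p : Y p -> g (z n) p @[n --> \oo] -->
    w0 * mu `^ (l - 1) * expR (- (quadratic Q p.1 / 2 + c1 * p.2)).
  case: p => y s [_ /=]; rewrite in_itv/= andbT => s0.
  have ccvg : c (z n) @[n --> \oo] --> (0 : R) by apply: cvg_powRN_pinfty; rewrite ?invr_gt0.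
  have zV : (z n)^-1 @[n --> \oo] --> (0 : R).
    have := cvg_powRN_pinfty ltr01 z1 zoo; apply: cvg_trans.
    by apply: near_eq_cvg; apply: nearW => n; rewrite powR_inv1// ltW.
  have nX : \forall n \near \oo, X (scaled (z n) (y, s)).
    have n1 : \forall n \near \oo, ball (0 : 'rV[R]_k) r (c (z n) *: y).
      have : c (z n) *: y @[n --> \oo] --> (0 : 'rV[R]_k).
        by rewrite -[X in _ --> X](scale0r y); apply: cvgZl.
      by move=> /cvg_ballP/(_ r r0).
    have n2 : \forall n \near \oo, s / z n < e.
      have sz : s / z n @[n --> \oo] --> (0 : R).
        by rewrite -[X in _ --> X](mulr0 s); apply: cvgMr.
      exact: cvgr_lt sz _ _.
    near=> n; split; first by near: n.
    by rewrite /= in_itv/= divr_gt0//=; near: n.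
  have Pz := @P_cvg z y s z1 zoo s0; have wz := @w_cvg z y s z1 zoo s0.
  pose p n := scaled (z n) (y, s).
  (* Already contained in [P_cvg]: z n * (P - mu) converges and 1 / z n tends to 0. *)
  have Pc : P (p n) @[n --> \oo] --> mu.
    rewrite (_ : (fun n => _) = fun n => (z n)^-1 * (z n * (P (p n) - mu)) + mu); last first.
      by apply/funext => n; rewrite mulKf ?subrK// gt_eqF.
    rewrite -[X in _ --> X]add0r; apply: cvgD; last exact: cvg_cst.
    rewrite -(mul0r (quadratic Q y / 2 + c1 * s)); exact: cvgM.
  apply: cvg_trans (_ : w (p n) * P (p n) `^ (l - 1) * expR (- (z n * (P (p n) - mu))) *
      igamma_ratio l (z n * P (p n)) @[n --> \oo] --> _).
    by apply: near_eq_cvg; apply: filterS nX => n Xn; rewrite gP.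
  rewrite -[X in _ --> X]mulr1; apply: cvgM; last first.
    apply: igamma_ratio_cvg1; apply/cvgryPge => a.
    move/cvgryPge : zoo => /(_ (a / mu)) za; apply: filterS2 nX za => n Xn.
    rewrite ler_pdivrMr// => /le_trans; apply.
    by rewrite ler_pM2l//; exact: P_mu.
  apply: cvgM.
    by apply: cvgM => //; exact: cvg_powR.
  apply: (cvg_comp (fun n => - (z n * (P (p n) - mu))) expR); last exact: continuous_expR.
  exact: cvgN.
have [_ lim] := @dominated_cvg_seq R _ ('rV[R]_k * measurableTypeR R)%type
  (lebesgue_rV k \x leb)%E Y (fun n => g (z n)) _ (dom C) mY mg cvg idom bound.
move: lim; rewrite gaussC ?mulr_ge0 ?powR_ge0//.
by move=> /fine_cvgP[].
Unshelve. all: end_near. Qed.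

End laplace_asymptotics.

(** * Charts *)

Lemma measurable_fun_pair_in d d1 d2 (T : measurableType d) (T1 : measurableType d1)
    (T2 : measurableType d2) (D : set T) (f : T -> T1) (g : T -> T2) : measurable D ->
  measurable_fun D f -> measurable_fun D g -> measurable_fun D (fun x => (f x, g x)).
Proof.
move=> mD /(measurable_restrictT f mD) mf /(measurable_restrictT g mD) mg.
apply: (eq_measurable_fun (fun x => ((f \_ D) x, (g \_ D) x))).
  by move=> x Dx; rewrite !patchE Dx.
by apply: measurable_funTS; exact: measurable_fun_pair.
Qed.

Section charts.
Context {R : realType} (k n : nat).
Notation leb := (@lebesgue_measure R).

Let quotient_translate (V : normedModType R) (f : 'rV[R]_k -> V) (y0 y v : 'rV[R]_k) :
  (fun h : R => h^-1 *: (((fun y => f (y + y0)) \o shift y) (h *: v) - f (y + y0))) =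
  (fun h : R => h^-1 *: ((f \o shift (y + y0)) (h *: v) - f (y + y0))).
Proof. by apply/funext => h; rewrite /shift/= addrA. Qed.

Lemma partial_translate (V : normedModType R) (f : 'rV[R]_k -> V) (y0 : 'rV[R]_k) i :
  partial i (fun y => f (y + y0)) = fun y => partial i f (y + y0).
Proof. by apply/funext => y; rewrite /partial /derive quotient_translate. Qed.

Lemma continuous_translate (y0 : 'rV[R]_k) : continuous (fun y : 'rV[R]_k => y + y0).
Proof.
move=> y; apply: (@cvgD _ _ _ (nbhs y) (nbhs_filter y) id (fun=> y0) y y0).
  exact: cvg_id.
exact: cvg_cst.
Qed.

Lemma Ck_translate (m : nat) (V : normedModType R) (U : set 'rV[R]_k)
    (f : 'rV[R]_k -> V) (y0 : 'rV[R]_k) :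
  Ck m U f -> Ck m [set y | U (y + y0)] (fun y => f (y + y0)).
Proof.
elim: m f => [|m IH] f [cf df]; split => //.
- move=> y Uy; apply: (@cvg_comp _ _ _ (fun y => y + y0) f _ _ _ (@continuous_translate y0 y)).
  exact: cf.
- move=> y Uy; apply: (@cvg_comp _ _ _ (fun y => y + y0) f _ _ _ (@continuous_translate y0 y)).
  exact: cf.
- move=> i; have [dfi Cfi] := df i; split.
    by move=> y Uy; rewrite /derivable quotient_translate; exact: dfi.
  by rewrite partial_translate; exact: IH.
Qed.

Lemma local_param_translate (M : set 'rV[R]_n) (U : set 'rV[R]_k)
    (psi : 'rV[R]_k -> 'rV[R]_n) (y0 : 'rV[R]_k) :
  local_param M U psi ->
  local_param M [set y | U (y + y0)] (fun y => psi (y + y0)).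
Proof.
move=> [oU Cpsi rf inj hom]; split.
- by apply: open_comp => // y _; exact: continuous_translate.
- exact: Ck_translate.
- move=> y Uy; rewrite (_ : jac _ y = jac psi (y + y0)); first exact: rf.
  by apply/matrixP => i j; rewrite !mxE partial_translate.
- move=> y z; rewrite !inE/= => Uy Uz yz; apply: (addIr y0).
  by apply: inj; rewrite ?inE.
- move=> V oV VU; have [||O oO psiO] := hom [set y | V (y - y0)].
  + by apply: open_comp => // y _; exact: continuous_translate.
  + by move=> y /VU/=; rewrite subrK.
  exists O => //; rewrite -psiO; apply/seteqP; split => [_ [y Vy <-]|_ [y /= Vy <-]].
    by exists (y + y0) => //=; rewrite addrK.
  by exists (y - y0) => //; rewrite subrK.
Qed.

(** [submanifold] provides a parametrization through t at some parameter y0; translating it by y0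
    yields one centred at 0, so the choice in [chart_at] is not the default. *)
Lemma chart_at_spec (M : set 'rV[R]_n) t : submanifold k M -> M t ->
  is_chart_at M t (chart_at M t : 'rV[R]_k -> 'rV[R]_n).
Proof.
move=> sM Mt; apply: xgetPex; have [U [psi [lp [y0 Uy0 psiy0]]]] := sM t Mt.
exists (fun y => psi (y + y0)), [set y | U (y + y0)].
by split; [exact: local_param_translate|rewrite /= add0r|rewrite add0r].
Qed.

Lemma local_param_image (M : set 'rV[R]_n) (U : set 'rV[R]_k)
    (psi : 'rV[R]_k -> 'rV[R]_n) y : local_param M U psi -> U y -> M (psi y).
Proof.
move=> [oU _ _ _ hom] Uy; have [//|O oO psiO] := hom U oU.
have : (M `&` O) (psi y) by rewrite -psiO; exists y.
by case.
Qed.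

Section integral.
Variables (B : set 'rV[R]_n) (sigma : {measure set 'rV[R]_n -> \bar R})
  (U S : set 'rV[R]_k) (psi : 'rV[R]_k -> 'rV[R]_n) (T : set 'rV[R]_n) (e : R).
Hypotheses (sigma_fin : (sigma setT < +oo)%E) (riem : is_riemannian_measure k B sigma)
  (lp : local_param B U psi) (mS : measurable S) (SU : S `<=` U)
  (mT : measurable T) (TE : psi @` S = T).

Lemma measurable_chart : measurable_fun S psi.
Proof.
have [oU [cpsi _] _ _ _] := lp; apply: measurable_fun_rV => i.
apply: within_continuous_measurable_rV => //.
apply: continuous_in_subspaceT => y /[!inE] Sy.
apply: (@cvg_comp _ _ _ psi (fun v : 'rV[R]_n => v ord0 i) _ _ _ (cpsi y (SU Sy))).
exact: coord_continuous.
Qed.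

Lemma measurable_sqrt_gram : measurable_fun S (fun y => Num.sqrt (\det (gram psi y))).
Proof.
have [oU Cpsi _ _ _] := lp; apply: within_continuous_measurable_rV; first exact: mS.
apply: continuous_in_subspaceT => y /[!inE] Sy.
by apply: (continuous_sqrt_gram Cpsi); exact: SU.
Qed.

Lemma measurable_chart_setX :
  measurable_fun (S `*` (`]0, e[ : set R)) (fun p => (psi p.1, p.2)).
Proof.
have mX : measurable (S `*` (`]0, e[ : set R)).
  by apply: measurableX => //; exact: measurable_itv.
apply: measurable_fun_pair_in => //; last exact: measurable_funTS.
apply: (@measurable_comp _ _ _ _ _ _ S) => //; first by move=> _ [p [Sp _] <-].
- exact: measurable_chart.
- exact: measurable_funTS.
Qed.

(** The Riemannian property concerns B alone, so the integral over u is done first, the base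
    variable is changed, and Fubini restores the product. *)
Lemma ge0_integral_chart (g : 'rV[R]_n * R -> R) :
  measurable_fun (T `*` (`]0, e[ : set R)) g ->
  (forall p, (T `*` `]0, e[) p -> 0 <= g p) ->
  (\int[sigma \x leb]_(p in T `*` `]0%R, e[) (g p)%:E =
   \int[lebesgue_rV k \x leb]_(p in S `*` `]0%R, e[)
     (g (psi p.1, p.2) * Num.sqrt (\det (gram psi p.1)))%:E)%E.
Proof.
move=> mg g0; have [_ riemE] := riem.
pose J y := Num.sqrt (\det (gram psi y)).
have J0 y : 0 <= J y by exact: sqrtr_ge0.
have mJ : measurable_fun S J by exact: measurable_sqrt_gram.
have sigmaE (E : set 'rV[R]_k) : measurable E -> E `<=` S ->
    sigma (psi @` E) = (\int[lebesgue_rV k]_(y in E) (J y)%:E)%E.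
  by move=> mE ES; apply: riemE lp _ mE _; exact: subset_trans ES SU.
rewrite -[RHS]/(\int[lebesgue_rV k \x leb]_(p in S `*` `]0%R, e[)
     (g (psi p.1, p.2) * J p.1)%:E)%E.
(* From here on [J] enters only through its sign, its measurability and [sigmaE]. *)
clearbody J.
have psiT y : S y -> T (psi y) by move=> Sy; rewrite -TE; exists y.
have mgp : measurable_fun (S `*` (`]0, e[ : set R)) (fun p => g (psi p.1, p.2)).
  apply: (@measurable_comp _ _ _ _ _ _ (T `*` (`]0, e[ : set R))) => //.
  - by apply: measurableX => //; exact: measurable_itv.
  - by move=> _ [p [Sp p0] <-]; split => //=; exact: psiT.
  - exact: measurable_chart_setX.
have mgJ : measurable_fun (S `*` (`]0, e[ : set R)) (fun p => g (psi p.1, p.2) * J p.1).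
  apply: measurable_funM => //.
  apply: (@measurable_comp _ _ _ _ _ _ S) => //; first by move=> _ [p [Sp _] <-].
  exact: measurable_funTS.
pose h t := (\int[leb]_(u in `]0%R, e[) (g (t, u))%:E)%E.
have h0 t : T t -> (0 <= h t)%E.
  by move=> Tt; apply: integral_ge0 => u u0; rewrite lee_fin g0.
transitivity (\int[sigma]_(t in T) h t)%E.
  apply: (@ge0_fubini_setX _ _ _ _ R sigma leb T `]0%R, e[%classic (fun p => (g p)%:E)) => //.
  - exact/measurable_EFinP.
  - by move=> t u Tt u0; rewrite lee_fin g0.
  - exact: measure_fin_sigma_finite.
rewrite -[X in integral _ X _]TE.
have mh : measurable_fun T h.
  apply: (@measurable_fun_integral_setX _ _ _ _ R leb T `]0%R, e[%classic (fun p => (g p)%:E)) => //.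
  - exact/measurable_EFinP.
  - by move=> t u Tt u0; rewrite lee_fin g0.
transitivity (\int[lebesgue_rV k]_(y in S) (h (psi y) * (J y)%:E))%E.
  apply: (@ge0_change_of_variables _ _ _ _ R (lebesgue_rV k) sigma S psi J) => //.
  - by rewrite TE.
  - exact: measurable_chart.
  - by rewrite TE.
  - by move=> t; rewrite TE; exact: h0.
transitivity (\int[lebesgue_rV k]_(y in S) \int[leb]_(u in `]0%R, e[)
    (g (psi y, u) * J y)%:E)%E.
  apply: eq_integral => y /[!inE] Sy; rewrite /h.
  rewrite -ge0_integralZr//=.
  - apply/measurable_EFinP.
    apply: (@measurable_comp _ _ _ _ _ _ (T `*` (`]0, e[ : set R)) g _ (pair (psi y))) => //.
    + by apply: measurableX => //; exact: measurable_itv.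
    + by move=> _ [u u0 <-]; split => //=; exact: psiT.
    + exact: measurable_funTS (pair1_measurable _).
  - by move=> u u0; rewrite lee_fin g0//; split => //=; exact: psiT.
  - by rewrite lee_fin.
apply/esym.
apply: (@ge0_fubini_setX _ _ _ _ R (lebesgue_rV k) leb S `]0%R, e[%classic
  (fun p => (g (psi p.1, p.2) * J p.1)%:E)) => //.
- exact/measurable_EFinP.
- by move=> y u Sy u0; rewrite lee_fin mulr_ge0// g0//; split => //=; exact: psiT.
- exact: sigma_finite_lebesgue_rV.
Qed.

End integral.
End charts.

(** * The frontier *)

Section gram.
Context {R : realType}.

Lemma tr_mul_tr k n (M : 'M[R]_(k, n)) : (M *m M^T)^T = M *m M^T.
Proof. by rewrite trmx_mul trmxK. Qed.

Lemma posdef_mul_tr k n (M : 'M[R]_(k, n)) : row_free M -> posdef (M *m M^T).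
Proof.
move=> Mfree v v0; have vM0 : v *m M != 0 by rewrite mulmx_free_eq0.
have -> : quadratic (M *m M^T) v = dotmul (v *m M) (v *m M).
  by rewrite /quadratic /dotmul trmx_mul !mulmxA.
by move: vM0; rewrite -enorm_gt0 /enorm sqrtr_gt0.
Qed.

Lemma det_gram_gt0 k n (f : 'rV[R]_k -> 'rV[R]_n) y :
  row_free (jac f y) -> 0 < \det (gram f y).
Proof.
by move=> fr; apply: det_posdef_gt0; [exact: tr_mul_tr|exact: posdef_mul_tr].
Qed.

(** A small chart ball has positive volume and a density at least half of its positive value at the
    centre. Positivity of the constant in (i) rests on this. *)
Lemma riemannian_measure_open_gt0 k n (B : set 'rV[R]_n)
    (sigma : {measure set 'rV[R]_n -> \bar R}) (Q : set 'rV[R]_n) (t : 'rV[R]_n) :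
  compact B -> submanifold k B -> is_riemannian_measure k B sigma ->
  open Q -> B t -> Q t -> (0 < sigma (B `&` Q))%E.
Proof.
move=> Bc Bs [_ riem] oQ Bt Qt.
have [U [psi [lp [y Uy psiy]]]] := Bs _ Bt.
have [oU Cpsi rf inj hom] := lp.
pose g z := Num.sqrt (\det (gram psi z)).
have g0 : 0 < g y by rewrite sqrtr_gt0 det_gram_gt0//; exact: rf.
have cg : {for y, continuous g} := continuous_sqrt_gram Cpsi Uy.
have nU : nbhs y U by exact: open_nbhs_nbhs.
have nQ : nbhs y (psi @^-1` Q).
  have cpsi : {for y, continuous psi} by exact: Cpsi.1.
  by apply: cpsi; rewrite psiy; exact: open_nbhs_nbhs.
have ng : \forall z \near y, g y / 2 <= g z.
  by have /cvgr_ge := cg; apply; rewrite ltr_pdivrMr// ltr_pMr// ltr1n.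
have : nbhs y (U `&` psi @^-1` Q `&` [set z | g y / 2 <= g z]).
  by apply: filterI => //; exact: filterI.
move=> /nbhs_ballP[r /= r0 rb].
have bU : ball y r `<=` U by move=> z /rb[[]].
have mb : measurable (ball y r) by exact: measurable_mx_ball.
apply: (@lt_le_trans _ _ (sigma (psi @` ball y r))); last first.
  have [|V oV psiV] := hom (ball y r) _ bU; first exact: ball_open.
  apply: le_measure.
  - by rewrite inE psiV; apply: measurableI; [exact: measurable_compact_rV|exact: measurable_open_rV].
  - by rewrite inE; apply: measurableI; [exact: measurable_compact_rV|exact: measurable_open_rV].
  - move=> _ [z bz <-]; split; last by have [[_]] := rb z bz.
    have : (B `&` V) (psi z) by rewrite -psiV; exists z.
    by case.
rewrite (riem U psi lp _ mb bU).
apply: (@lt_le_trans _ _ (\int[lebesgue_rV k]_(z in ball y r) (g y / 2)%:E)%E).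
  by rewrite integral_cst// lebesgue_rV_ball// -EFinM lte_fin mulr_gt0 ?divr_gt0 ?exprn_gt0 ?mulr_gt0.
apply: (@ge0_le_integral _ _ _ _ _ mb (fun=> (g y / 2)%:E) (fun z => (g z)%:E)).
- by move=> z _; rewrite lee_fin divr_ge0 ?(ltW g0).
- exact: measurable_cst.
- apply/measurable_EFinP; apply: within_continuous_measurable_rV; first exact: mb.
  apply: continuous_in_subspaceT => z /[!inE] bz.
  by apply: (continuous_sqrt_gram Cpsi); exact: bU.
- by move=> z /rb[_]; rewrite lee_fin.
Qed.

End gram.

Lemma cvg_to_within (T : Type) (S : topologicalType) (K : set_system T) (FK : Filter K)
    (X : set S) (f : T -> S) (p : S) :
  f x @[x --> K] --> p -> (\forall x \near K, X (f x)) ->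
  f x @[x --> K] --> within X (nbhs p).
Proof.
move=> fp Xf P wP; have := fp _ wP; rewrite /= /nbhs/=.
by apply: filterS2 Xf => n Xn; exact.
Qed.

Section frontier.
Context {R : realType} (D : nat).
Notation leb := (@lebesgue_measure R).
Variables (A F H : 'rV[R]_D -> R) (rho lambda : R).
Let G := posdirs H.
Hypotheses (A_ge0 : forall v, 0 <= A v) (mG : measurable G)
  (mW : measurable_fun G (W A F lambda)) (mPhi : measurable_fun G (Phi F H rho))
  (Phi0 : forall t, G t -> 0 < Phi F H rho t) (lambda_gt0 : 0 < lambda)
  (W_int : (surface_measure D).-integrable G (EFin \o W A F lambda)).
Variables (B : set 'rV[R]_D) (sigmaB : {measure set 'rV[R]_D -> \bar R}) (eps : R)
  (phi : 'rV[R]_D * R -> 'rV[R]_D) (J omega : 'rV[R]_D * R -> R).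
Hypotheses (B_compact : compact B) (B_smooth : submanifold D.-2 B)
  (sigmaB_riem : is_riemannian_measure D.-2 B sigmaB) (eps_gt0 : 0 < eps)
  (phi_collar : is_collar_map G B H eps phi)
  (J_jacobian : is_collar_jacobian B sigmaB eps phi J)
  (omega_cont : {within B `*` `[0, eps], continuous omega})
  (omega_bounded : exists K : R, forall p : 'rV_D * R,
     (B `*` `[0, eps]) p -> `|omega p| <= K)
  (omegaE : forall (t : 'rV_D) (u : R), B t -> 0 < u < eps ->
     omega (t, u) = W A F lambda (phi (t, u)) * J (t, u)).

(** This is betaF times the tail, in the variable z = x ^ rho. *)
Definition laplace_integral (z : R) : R :=
  fine (\int[surface_measure D]_(t in G)
    (W A F lambda t * igamma lambda (z * Phi F H rho t))%:E)%E.

Let W_ge0 t : 0 <= W A F lambda t.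
Proof. by rewrite divr_ge0 ?powR_ge0. Qed.

Let mB : measurable B. Proof. exact: measurable_compact_rV. Qed.

Lemma omega_ge0 (t : 'rV[R]_D) (u : R) : B t -> 0 < u < eps -> 0 <= omega (t, u).
Proof.
move=> Bt ueps; rewrite omegaE// mulr_ge0//; have [_ J0 _] := J_jacobian; apply: J0.
by split => //=; rewrite in_itv/=; case/andP: ueps => /ltW -> ->.
Qed.

(** The base point may move along with the height: it is fixed in (i), but rescaled in (ii). *)
Lemma omega_cvg (t : 'rV[R]_D) (s : nat -> 'rV[R]_D) (v : nat -> R) : B t ->
  (\forall n \near \oo, B (s n)) -> s n @[n --> \oo] --> t ->
  (forall n, 0 < v n) -> v n @[n --> \oo] --> (0 : R) ->
  omega (s n, v n) @[n --> \oo] --> omega (t, 0).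
Proof.
move=> Bt Bs st v0 vc.
have : (B `*` `[0, eps]) (t, 0 : R) by split => //=; rewrite in_itv/= lexx ltW.
move/subspace_continuousP : omega_cont => /[apply] c0.
apply: (@cvg_comp _ _ _ (fun n => (s n, v n)) omega _ _ _ _ c0).
apply: (@cvg_to_within nat ('rV[R]_D * R)%type \oo _ _ (fun n => (s n, v n)) (t, 0)).
  exact: (cvg_pair st vc).
have : \forall n \near \oo, v n < eps by exact: cvgr_lt vc _ _.
by apply: filterS2 Bs => n Bsn vn; split => //=; rewrite in_itv/= (ltW (v0 n)) (ltW vn).
Qed.

Let small n := eps / 2 / n.+1%:R.

Let small_gt0 n : 0 < small n. Proof. by rewrite !divr_gt0. Qed.

Let small_lt n : small n < eps.
Proof.
apply: (@le_lt_trans _ _ (eps / 2)); last by rewrite ltr_pdivrMr// ltr_pMr// ltr1n.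
by rewrite ler_pdivrMr// ler_peMr ?divr_ge0 ?(ltW eps_gt0)// ler1n.
Qed.

Let small_cvg : small n @[n --> \oo] --> (0 : R).
Proof.
by rewrite -[X in _ --> X](mulr0 (eps / 2)); apply: cvgMr; exact: cvg_harmonic.
Qed.

(** The sign is known from W * J for u > 0 only and passes to the limit. *)
Lemma omega0_ge0 (t : 'rV[R]_D) : B t -> 0 <= omega (t, 0).
Proof.
move=> Bt; have c : omega (t, small n) @[n --> \oo] --> omega (t, 0).
  by apply: (@omega_cvg t (fun=> t)) => //; [exact: nearW|exact: cvg_cst].
apply: (cvgr_to_ge c); apply: nearW => n; apply: omega_ge0 => //.
by rewrite small_gt0 small_lt.
Qed.

Lemma measurable_omega : measurable_fun (B `*` (`[0, eps] : set R)) omega.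
Proof.
apply: within_continuous_measurable_prod => //.
by apply: measurableX => //; exact: measurable_itv.
Qed.

Lemma within_continuous_omega0 : {within B, continuous (fun t => omega (t, 0))}.
Proof.
apply/subspace_continuousP => t Bt.
have : (B `*` `[0, eps]) (t, 0 : R) by split => //=; rewrite in_itv/= lexx ltW.
move/subspace_continuousP : omega_cont => /[apply] c0.
apply: (@cvg_comp _ _ _ (fun t => (t, 0 : R)) omega _ _ _ _ c0).
apply: (@cvg_to_within 'rV[R]_D ('rV[R]_D * R)%type (within B (nbhs t)) _ _ (fun t => (t, 0 : R)) (t, 0)).
  exact: (@cvg_pair _ _ _ _ (nbhs t) (nbhs (0 : R)) _ _ _ id (fun=> 0 : R)
    (@cvg_within _ _ _ B) (@cvg_cst _ (0 : R) _ _ _)).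
rewrite near_withinE; apply: nearW => s Bs.
by split => //=; rewrite in_itv/= lexx ltW.
Qed.

Lemma measurable_collar_Phi (e : R) : e <= eps ->
  measurable_fun (B `*` (`]0, e[ : set R)) (Phi F H rho \o phi).
Proof.
move=> eeps; have mX : measurable (B `*` (`]0, e[ : set R)).
  by apply: measurableX => //; exact: measurable_itv.
have sub : B `*` (`]0, e[ : set R) `<=` collar B eps.
  move=> [t u] [/= Bt]; rewrite in_itv/= => /andP[u0 ue]; split => //=.
  by rewrite in_itv/= (ltW u0) (lt_le_trans ue).
apply: (@measurable_comp _ _ _ _ _ _ G) => //.
  move=> _ [p Xp <-]; apply: (posdirs_collar phi_collar (sub _ Xp)).
  by case: Xp => _ /=; rewrite in_itv/= => /andP[].
have := @measurable_collar_map _ _ _ _ _ _ phi_collar B_smooth B_compact _ openT.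
by rewrite setIT; apply: measurable_funS => //; rewrite -[collar _ _]setIT;
  exact: measurable_collar_open openT.
Qed.

Lemma collar_rect (Q : set 'rV[R]_D) (e z : R) : open Q -> e <= eps -> 0 < z ->
  (\int[surface_measure D]_(t in G `&` phi @` (collar B eps `&` [set p | Q p.1 /\ (p.2 < e)%R]))
    (W A F lambda t * igamma lambda (z * Phi F H rho t))%:E =
  \int[sigmaB \x leb]_(p in (B `&` Q) `*` `]0%R, e[)
    (omega p * igamma lambda (z * (Phi F H rho \o phi) p))%:E)%E.
Proof.
move=> oQ eeps z0.
have oN : open [set p : 'rV[R]_D * R | Q p.1 /\ p.2 < e] by exact: open_setX_lt.
rewrite (@ge0_integral_collar _ _ H A F B eps phi lambda phi_collar B_smooth
  B_compact sigmaB J omega J_jacobian omegaE _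
  (fun t => igamma lambda (z * Phi F H rho t)) oN)//.
- apply: congr2 => //; rewrite /collar; apply/seteqP; split => -[t u] /=.
    by move=> [[Bt _] [[Qt ue] u0]]; split => //; rewrite in_itv/= u0.
  move=> [[Bt Qt]]; rewrite !in_itv/= => /andP[u0 ue]; split => //.
  by rewrite (ltW u0) (lt_le_trans ue).
- apply: measurable_funM => //.
  apply: measurable_igamma_comp => // [|t Gt]; first exact: measurable_funM.
  by rewrite mulr_gt0// Phi0.
- by move=> t _; rewrite mulr_ge0 ?igamma_ge0.
Qed.

(** [inf] has the default value 0 on sets without an infimum, so positivity already implies that the
    image is bounded below. *)
Lemma le_inf_image (T : Type) (X : set T) (f : T -> R) t :
  0 < inf (f @` X) -> X t -> inf (f @` X) <= f t.
Proof.
move=> i0 Xt; apply: ge_inf; last by exists t.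
by apply: contrapT => nlb; move: i0; rewrite inf_out ?ltxx// => -[_ lb]; apply: nlb.
Qed.

Lemma fractional_frontier (m : nat) (zeta : R) (c : 'rV[R]_D -> R)
    (Rfrac : 'rV[R]_D * R -> R) (u : nat -> R) :
  rho = m%:R + zeta -> 0 < zeta < 1 ->
  (forall (t : 'rV_D) (u : R), B t -> 0 <= u < eps ->
     F (phi (t, u)) = u ^+ m.+1 * (c t + u * Rfrac (t, u))) ->
  0 < inf (c @` B) ->
  {within B, continuous c} ->
  (exists K : R, forall p : 'rV_D * R, collar B eps p -> `|Rfrac p| <= K) ->
  (forall e : R, 0 < e <= eps -> exists2 delta : R, 0 < delta &
     forall theta, (G `\` phi @` collar B e) theta ->
       delta <= Phi F H rho theta) ->
  (forall n, 1 <= u n) -> u n @[n --> \oo] --> +oo ->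
  u n `^ (1 / (1 - zeta)) * laplace_integral (u n) @[n --> \oo] -->
    Gamma (lambda + 1 / (1 - zeta)) *
      \int[sigmaB]_(t in B) (omega (t, 0) * c t `^ (- (1 / (1 - zeta)))).
Proof.
move=> rhoE /andP[zeta0 zeta1] FE cinf cc [K0 RK0] Phid u1 uoo.
pose k := 1 / (1 - zeta); have k0 : 0 < k by rewrite divr_gt0// subr_gt0.
have kV : k^-1 = 1 - zeta by rewrite /k invf_div divr1.
pose K := Num.max 0 K0; have K_ge0 : 0 <= K by rewrite le_max lexx.
have RK p : collar B eps p -> `|Rfrac p| <= K.
  by move=> /RK0 p0; rewrite le_max p0 orbT.
pose a := inf (c @` B) / 2; have a0 : 0 < a by rewrite divr_gt0.
have ca t : B t -> 2 * a <= c t.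
  by move=> Bt; rewrite /a mulrC divfK// le_inf_image.
(* With u < e the remainder u * Rfrac is at most e * K <= a, while c >= 2 * a; hence Phi >= a * u ^
   (1 / k) on the shrunk collar. *)
pose e := Num.min eps (a / (K + 1)).
have K10 : 0 < K + 1 by rewrite ltr_wpDl.
have e0 : 0 < e by rewrite lt_min eps_gt0 divr_gt0.
have eeps : e <= eps by rewrite ge_min lexx.
have eK : e * K <= a.
  apply: (@le_trans _ _ (a / (K + 1) * K)).
    by rewrite ler_wpM2r// ge_min lexx orbT.
  by rewrite mulrAC ler_pdivrMr// ler_pM2l// lerDl.
have [|delta d0 dPhi] := Phid e; first by rewrite e0 eeps.
have [phi0 phiH _ _ _] := phi_collar.
(* On the collar H = v, so the exponent is m + 1 - (m + zeta) = 1 - zeta = 1 / k. *)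
have PhiE t v : B t -> 0 < v < e ->
    Phi F H rho (phi (t, v)) = v `^ k^-1 * (c t + v * Rfrac (t, v)).
  move=> Bt /andP[v0 ve]; have v_eps : v < eps by exact: lt_le_trans ve _.
  have Cv : collar B eps (t, v) by split => //=; rewrite in_itv/= (ltW v0).
  rewrite /Phi FE ?(ltW v0)// (phiH _ Cv).2/= rhoE kV -powR_mulrn ?(ltW v0)//.
  rewrite mulrAC; congr (_ * _).
  rewrite -powRN -powRD; last by rewrite (gt_eqF v0) implybT.
  by congr (_ `^ _); rewrite -natr1; ring.
have vR t v : B t -> 0 < v < e -> `|v * Rfrac (t, v)| <= v * K.
  move=> Bt /andP[v0 ve]; rewrite normrM gtr0_norm// ler_pM2l// RK//.
  by split => //=; rewrite in_itv/= (ltW v0) (lt_le_trans ve).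
have omega_le := omega_bounded; case: omega_le => L0 omega_le.
(* A trivial exponential factor gives the normalization of [cvg_tail_localize], here with rate q =
   0. *)
have -> : (fun n => u n `^ k * laplace_integral (u n)) =
    fun n => u n `^ k * expR (0 * u n) * laplace_integral (u n).
  by apply/funext => n; rewrite mul0r expR0 mulr1.
pose N : set ('rV[R]_D * R) := [set p | [set: 'rV[R]_D] p.1 /\ p.2 < e].
have oN : open N by apply: open_setX_lt; exact: openT.
apply: (@cvg_tail_localize _ _ _ (surface_measure D) G (phi @` (collar B eps `&` N))
  (W A F lambda) (Phi F H rho) lambda k 0 delta u) => //.
- exact: (measurable_collar_image phi_collar).
- move=> t [Gt nV]; apply: dPhi; split => // -[[s v] [/= Bs]].
  rewrite in_itv/= => /andP[v0 ve] st; apply: nV; exists (s, v) => //.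
  by split; split => //=; rewrite in_itv/= v0 (lt_le_trans ve).
rewrite (_ : (fun n => _) = fun n => u n `^ k * fine (\int[sigmaB \x leb]_(p in B `*` `]0%R, e[)
    (omega p * igamma lambda (u n * (Phi F H rho \o phi) p))%:E)%E); last first.
  apply/funext => n; rewrite mul0r expR0 mulr1 collar_rect//; last 2 first.
  - exact: openT.
  - exact: lt_le_trans (u1 n).
  by rewrite setIT.
have sub : B `*` (`]0, e[ : set R) `<=` B `*` (`[0, eps] : set R).
  move=> [t v] [/= Bt]; rewrite !in_itv/= => /andP[v0 ve]; split => //=.
  by rewrite (ltW v0) (ltW (lt_le_trans ve eeps)).
have L_ge0 : 0 <= Num.max 0 L0 by rewrite le_max lexx.
apply: (@frac_asymptotics _ _ _ sigmaB B e omega (Phi F H rho \o phi)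
  (fun t => omega (t, 0)) c (Num.max 0 L0) a k lambda) => //.
- exact: riemannian_measure_finite B_compact B_smooth sigmaB_riem.
- apply: (measurable_funS _ sub measurable_omega).
  by apply: measurableX => //; exact: measurable_itv.
- exact: measurable_collar_Phi.
- by apply: within_continuous_measurable_rV => //; exact: within_continuous_omega0.
- exact: within_continuous_measurable_rV.
- move=> [t v] [/= Bt]; rewrite in_itv/= => /andP[v0 ve].
  by apply: omega_ge0 => //; rewrite v0 (lt_le_trans ve).
- move=> p Xp; rewrite le_max; apply/orP; right.
  by rewrite (le_trans (ler_norm _))//; apply: omega_le; exact: sub.
- move=> [t v] [/= Bt]; rewrite in_itv/= => vI.
  rewrite PhiE// [leRHS]mulrC ler_wpM2r ?powR_ge0//.
  have := vR _ _ Bt vI; rewrite ler_norml => /andP[+ _].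
  have := ca _ Bt; case/andP: vI => v0 ve.
  have : v * K <= e * K by rewrite ler_wpM2r// ltW.
  by lra.
- by move=> t; exact: omega0_ge0.
- by move=> t Bt; rewrite (lt_le_trans _ (ca _ Bt))// mulr_gt0.
- move=> t v Bt v0 vc.
  by apply: (@omega_cvg t (fun=> t)) => //; [exact: nearW|exact: cvg_cst].
- move=> t v Bt v0 vc.
  have ve : \forall n \near \oo, v n < e by exact: cvgr_lt vc _ _.
  apply: cvg_trans (_ : c t + v n * Rfrac (t, v n) @[n --> \oo] --> _).
    apply: near_eq_cvg; apply: filterS ve => n vne; rewrite /= PhiE ?v0//.
    by rewrite mulrAC mulfV ?mul1r// gt_eqF// powR_gt0.
  rewrite -[X in _ --> X]addr0; apply: cvgD; first exact: cvg_cst.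
  apply: norm_cvg0; apply: (@squeeze_cvgr _ _ _ _ (fun=> 0) (fun n => v n * K)).
  + by apply: filterS ve => n vne; rewrite normr_ge0 vR// v0.
  + exact: cvg_cst.
  + by rewrite -[X in _ --> X](mul0r K); exact: cvgMl.
Qed.

Lemma fractional_constant_gt0 (c : 'rV[R]_D -> R) (k : R) (t : 'rV[R]_D) :
  0 < inf (c @` B) -> {within B, continuous c} -> k <= 0 -> B t -> omega (t, 0) != 0 ->
  0 < \int[sigmaB]_(t in B) (omega (t, 0) * c t `^ k).
Proof.
move=> i0 cc k0 Bt ot.
have c0 s : B s -> 0 < c s by move=> Bs; rewrite (lt_le_trans i0)// le_inf_image.
(* Integrability matters: an infinite integral would have the real value 0. *)
have ig : sigmaB.-integrable B (EFin \o (fun t => omega (t, 0) * c t `^ k)).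
  have [L0 omega_le] := omega_bounded.
  apply: (@integrable_dominated _ _ _ _ _ _ (fun=> Num.max 0 L0 * inf (c @` B) `^ k)) => //.
  - apply: measurable_funM.
      by apply: within_continuous_measurable_rV => //; exact: within_continuous_omega0.
    apply: (measurableT_comp (measurable_powR _)).
    exact: within_continuous_measurable_rV.
  - move=> s Bs; rewrite ger0_norm ?mulr_ge0 ?powR_ge0 ?omega0_ge0//.
    apply: ler_pM; rewrite ?powR_ge0 ?omega0_ge0//.
      rewrite le_max; apply/orP; right.
      rewrite (le_trans (ler_norm _))//; apply: omega_le; split => //=.
      by rewrite in_itv/= lexx ltW.
    have [k' k'0 ->] : exists2 k', 0 <= k' & k = - k' by exists (- k); rewrite ?oppr_ge0 ?opprK.
    rewrite !powRN lef_pV2 ?posrE ?powR_gt0 ?c0//.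
    by rewrite ge0_ler_powR ?nnegrE ?(ltW i0) ?(ltW (c0 _ Bs)) ?le_inf_image.
  - apply/integrableP; split; first by apply/measurable_EFinP; exact: measurable_cst.
    rewrite integral_cst//=.
    have sB : (sigmaB B < +oo)%E.
      apply: le_lt_trans (riemannian_measure_finite B_compact B_smooth sigmaB_riem).
      by apply: le_measure; rewrite ?inE.
    by rewrite lte_mul_pinfty.
pose g s := omega (s, 0) * c s `^ k.
have g0 s : B s -> 0 <= g s by move=> Bs; rewrite mulr_ge0 ?powR_ge0 ?omega0_ge0.
have gt0 : 0 < g t by rewrite mulr_gt0 ?powR_gt0 ?c0// lt_neqAle eq_sym ot omega0_ge0.
have gc : g s @[s --> within B (nbhs t)] --> g t.
  apply: cvgM.
    by have /subspace_continuousP := within_continuous_omega0; apply.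
  apply: cvg_powR; first exact: c0.
  by move/subspace_continuousP : cc; apply.
have : \forall s \near within B (nbhs t), g t / 2 <= g s.
  by have /cvgr_ge := gc; apply; rewrite ltr_pdivrMr// ltr_pMr// ltr1n.
rewrite near_withinE nbhsE => -[Q [oQ Qt] Qg].
have mQ : measurable (B `&` Q) by apply: measurableI => //; exact: measurable_open_rV.
have s0 := riemannian_measure_open_gt0 B_compact B_smooth sigmaB_riem oQ Bt Qt.
have [/measurable_EFinP mg _] := integrableP _ _ _ ig.
rewrite -lte_fin /Rintegral fineK; last exact: integrable_fin_num ig.
apply: (@lt_le_trans _ _ (\int[sigmaB]_(s in B `&` Q) (g t / 2)%:E)%E).
  by rewrite integral_cst// mule_gt0// lte_fin divr_gt0.
apply: (@le_trans _ _ (\int[sigmaB]_(s in B `&` Q) (g s)%:E)%E).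
  apply: (@ge0_le_integral _ _ _ sigmaB _ mQ (fun=> (g t / 2)%:E) (fun z => (g z)%:E)).
  - by move=> s _; rewrite lee_fin divr_ge0 ?(ltW gt0).
  - exact: measurable_cst.
  - by apply/measurable_EFinP; apply: (measurable_funS _ _ mg) => // s [].
  - by move=> s [Bs Qs]; rewrite lee_fin Qg.
apply: ge0_subset_integral => //.
- exact/measurable_EFinP.
Qed.

Lemma integer_frontier (m : nat) (c0 c1 : 'rV[R]_D -> R) (t0 : 'rV[R]_D) :
  rho = m%:R ->
  (exists K : R, forall (t : 'rV_D) (u : R), B t -> 0 <= u < eps ->
     exists2 r : R, `|r| <= K * u ^+ 2 &
       F (phi (t, u)) = u ^+ m * (c0 t + u * c1 t + r)) ->
  Ck_on_submanifold D.-2 2 B c0 ->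
  {within B, continuous c1} ->
  B t0 ->
  0 < c0 t0 ->
  gradient D.-2 B c0 t0 = 0 ->
  hessian_posdef D.-2 B c0 t0 ->
  0 < c1 t0 ->
  (exists2 V0 : set ('rV[R]_D * R), within (collar B eps) (nbhs (t0, 0)) V0 &
     forall V : set ('rV[R]_D * R), V `<=` V0 -> V `<=` collar B eps ->
       within (collar B eps) (nbhs (t0, 0)) V ->
       exists2 delta : R, 0 < delta &
         forall theta, (G `\` phi @` V) theta ->
           c0 t0 + delta <= Phi F H rho theta) ->
  0 < hessian_det D.-2 B c0 t0 /\
  forall z : nat -> R, (forall n, 1 <= z n) -> z n @[n --> \oo] --> +oo ->
  z n `^ (D.-2%:R / 2 + 1 + (1 - lambda)) * expR (c0 t0 * z n) * laplace_integral (z n)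
    @[n --> \oo] -->
  (2 * pi) `^ (D.-2%:R / 2) * (omega (t0, 0) * c0 t0 `^ (lambda - 1) /
     (c1 t0 * Num.sqrt (hessian_det D.-2 B c0 t0))).
Proof.
move=> rhoE [K1 FE] Cc0 cc1 Bt0 mu0 grad0 hpos c1_gt0 [V0 V0n V0d].
pose k := D.-2; pose mu := c0 t0.
pose K := Num.max 0 K1; have K_ge0 : 0 <= K by rewrite le_max lexx.
pose psi : 'rV[R]_k -> 'rV[R]_D := chart_at B t0.
have [U [lp U0 psi0]] := chart_at_spec B_smooth Bt0; rewrite -/psi in lp psi0.
have [oU Cpsi rf inj hom] := lp.
pose f := c0 \o psi; have Cf : Ck 2 U f by exact: Cc0.
have fmu : f 0 = mu by rewrite /f/= psi0.
have rf0 : row_free (jac psi 0) by exact: rf.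
have gram0 : 0 < \det (gram psi 0) by exact: det_gram_gt0.
have metric_unit : metric k B t0 \in unitmx.
  by rewrite unitmxE unitfE gt_eqF// /metric -/psi.
(* The metric is invertible and the Jacobian of the chart has full row rank, so the ambient gradient
   vanishes only with the differential. *)
have diff0 : differential k B c0 t0 = 0.
  have := grad0; rewrite /gradient -/psi => /eqP; rewrite mulmx_free_eq0// => /eqP dm.
  by rewrite -[LHS](mulmxKV metric_unit) dm mul0mx.
have df0 i : partial i f 0 = 0.
  by have /rowP/(_ i) := diff0; rewrite !mxE.
pose Q := hess f.
have Qsym : Q^T = Q by exact: (tr_hess oU U0 Cf).
have hessE : hessian k B c0 t0 = Q.
  apply/matrixP => i j; rewrite [LHS]mxE diff0 big1 => [|l _]; last by rewrite mxE mulr0.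
  rewrite subr0 [RHS]mxE.
  exact: (partial_comm oU U0 Cf).
have Qpos : posdef Q by move=> v v0; rewrite /quadratic -hessE; exact: hpos.
have detE : hessian_det k B c0 t0 = \det Q / \det (gram psi 0).
  by rewrite /hessian_det hessE det_mulmx det_inv.
have detQ : 0 < \det Q by exact: det_posdef_gt0.
split=> [|z z1 zoo]; first by rewrite detE divr_gt0.
have z0 n : 0 < z n by exact: lt_le_trans (z1 n).
pose G0 := Num.sqrt (\det (gram psi 0)); have G00 : 0 < G0 by rewrite sqrtr_gt0.
have [a a0 aQ] := posdef_lower_bound Qpos.
(* The error a / 4 * |y| ^ 2 is at most a quarter of the quadratic form, so c0 - mu keeps at least a
   quarter of it instead of a half. *)
have [|r1 r10 tay1] := taylor2 oU U0 Cf (eps := a / 4) _ df0; first by rewrite divr_gt0.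
have tay (e : R) : 0 < e -> exists2 r : R, 0 < r & forall s y, s <= r -> box s y ->
    U y /\ `|f y - mu - quadratic Q y / 2| <= e * s ^+ 2.
  by move=> e0; rewrite -fmu; exact: taylor2.
have BU y : U y -> B (psi y) by exact: local_param_image lp.
have nU : nbhs (0 : 'rV[R]_k) U by exact: open_nbhs_nbhs.
have cpsi : {for 0, continuous psi} by exact: Cpsi.1.
have cf : {for 0, continuous f} by exact: Cf.1.
have cgram : {for 0, continuous (fun y => Num.sqrt (\det (gram psi y)))}.
  exact: (continuous_sqrt_gram Cpsi U0).
have cpsiB : psi y @[y --> within U (nbhs (0 : 'rV[R]_k))] --> within B (nbhs t0).
  apply: cvg_to_within.
    by rewrite -psi0; apply: cvg_trans cpsi; apply: cvg_app; exact: cvg_within.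
  by rewrite near_withinE; apply: nearW => y; exact: BU.
have cc1psi : c1 (psi y) @[y --> within U (nbhs (0 : 'rV[R]_k))] --> c1 t0.
  apply: (@cvg_comp _ _ _ psi c1 _ _ _ cpsiB).
  by move/subspace_continuousP : cc1; apply.
have n1 : \forall y \near (0 : 'rV[R]_k), U y -> 3 / 4 * c1 t0 <= c1 (psi y).
  have : \forall y \near within U (nbhs (0 : 'rV[R]_k)), 3 / 4 * c1 t0 <= c1 (psi y).
    by have /cvgr_ge := cc1psi; apply; lra.
  by rewrite near_withinE.
have n2 : \forall y \near (0 : 'rV[R]_k), U y -> c1 (psi y) <= c1 t0 + 1.
  have : \forall y \near within U (nbhs (0 : 'rV[R]_k)), c1 (psi y) <= c1 t0 + 1.
    by have /cvgr_le := cc1psi; apply; lra.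
  by rewrite near_withinE.
have n3 : \forall y \near (0 : 'rV[R]_k), f y <= mu + 1.
  by have /cvgr_le := cf; apply; rewrite fmu; lra.
have n4 : \forall y \near (0 : 'rV[R]_k), Num.sqrt (\det (gram psi y)) <= G0 + 1.
  by apply: (near_le_continuous cgram); rewrite ltrDl.
have n5 : \forall y \near (0 : 'rV[R]_k), `|y| < r1.
  apply/nbhs_ballP; exists r1 => // y.
  by rewrite mx_norm_ball /ball_/= sub0r normrN.
have [[A1 A2] /= [nA1 nA2] AA] : nbhs (t0, 0 : R) [set p | collar B eps p -> V0 p] := V0n.
have n6 : \forall y \near (0 : 'rV[R]_k), A1 (psi y) by apply: cpsi; rewrite psi0.
have [e2 /= e20 e2A] : exists2 e2 : R, 0 < e2 & ball (0 : R) e2 `<=` A2.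
  by move/nbhs_ballP : nA2.
have [r /= r0 rb] : exists2 r : R, 0 < r & ball (0 : 'rV[R]_k) r `<=`
    [set y | [/\ U y, 3 / 4 * c1 t0 <= c1 (psi y) <= c1 t0 + 1,
       f y <= mu + 1 /\ A1 (psi y), Num.sqrt (\det (gram psi y)) <= G0 + 1 & `|y| < r1]].
  apply/nbhs_ballP; near=> y.
  have Uy : U y by near: y; exact: nU.
  have h1 : 3 / 4 * c1 t0 <= c1 (psi y) by move: Uy; near: y; exact: n1.
  have h2 : c1 (psi y) <= c1 t0 + 1 by move: Uy; near: y; exact: n2.
  have h3 : f y <= mu + 1 by near: y; exact: n3.
  have h4 : Num.sqrt (\det (gram psi y)) <= G0 + 1 by near: y; exact: n4.
  have h5 : `|y| < r1 by near: y; exact: n5.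
  have h6 : A1 (psi y) by near: y; exact: n6.
  by split => //; apply/andP.
(* The bound [e2] keeps the neighbourhood inside [V0]. The third gives K * u ^ 2 <= u * c1 t0 / 4,
   so the slope 3 / 4 * c1 t0 drops to no less than half of c1 t0. The last makes powers of u at
   most 1. *)
pose e := Num.min eps (Num.min e2 (Num.min (c1 t0 / (4 * (K + 1))) 1)).
have K10 : 0 < K + 1 by rewrite ltr_wpDl.
have e0 : 0 < e by rewrite !lt_min eps_gt0 e20 ltr01 divr_gt0// mulr_gt0.
have eeps : e <= eps by rewrite ge_min lexx.
have ee2 : e <= e2 by rewrite !ge_min lexx orbT.
have e1 : e <= 1 by rewrite !ge_min lexx !orbT.
have eK : K * e <= c1 t0 / 4.
  apply: (@le_trans _ _ (K * (c1 t0 / (4 * (K + 1))))).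
    by rewrite ler_wpM2l// !ge_min lexx !orbT.
  rewrite [leLHS](_ : _ = c1 t0 / 4 * (K / (K + 1))); last by field; rewrite gt_eqF.
  by rewrite ler_piMr ?divr_ge0 ?(ltW c1_gt0)// ler_pdivrMr// mul1r lerDl.
pose S := ball (0 : 'rV[R]_k) r.
have SU : S `<=` U by move=> y /rb[].
(* The chart ball covers exactly the part of B in an ambient open set, so the neighbourhood of (t0,
   0) becomes a rectangle in chart and collar coordinates. *)
have [|O oO psiO] := hom S _ SU; first exact: ball_open.
have mS : measurable S by exact: measurable_mx_ball.
have mT : measurable (B `&` O) by apply: measurableI => //; exact: measurable_open_rV.
have S0 : S 0 by exact: ballxx.
have [phi0 phiH _ _ _] := phi_collar.
have PhiE y u : S y -> 0 < u < e -> exists2 q : R, `|q| <= K * u ^+ 2 &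
    Phi F H rho (phi (psi y, u)) = f y + u * c1 (psi y) + q.
  move=> Sy /andP[u0 ue]; have u_eps : u < eps by exact: lt_le_trans ue _.
  have [|q qK Fq] := FE (psi y) u (BU _ (SU _ Sy)); first by rewrite (ltW u0).
  exists q; first by rewrite (le_trans qK)// ler_wpM2r ?sqr_ge0// le_max lexx orbT.
  have Cu : collar B eps (psi y, u).
    by split; [exact: BU (SU _ Sy)|rewrite /= in_itv/= (ltW u0)].
  rewrite /Phi Fq (phiH _ Cu).2/= rhoE powR_mulrn ?(ltW u0)// mulrAC mulfV ?mul1r//.
  by rewrite expf_neq0// gt_eqF.
pose N : set ('rV[R]_D * R) := [set p | O p.1 /\ p.2 < e].
have oN : open N by exact: open_setX_lt.
have [||| delta delta0 dPhi] := V0d (collar B eps `&` N).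
- move=> -[t u] [Ctu [Ot ue]]; apply: AA (Ctu); split => /=.
    have : (psi @` S) t by rewrite psiO; split => //; case: Ctu.
    by move=> [y /rb[_ _ [_ A1y] _ _] <-].
  apply: e2A; case: Ctu => _ /=; rewrite in_itv/= => /andP[u0 _].
  by rewrite /ball/= sub0r normrN ger0_norm// (lt_le_trans ue).
- by move=> p [].
- have nN : nbhs (t0, 0 : R) N.
    apply: open_nbhs_nbhs; split => //; split => //=.
    have : (B `&` O) t0 by rewrite -psiO; exists 0.
    by case.
  by rewrite /within/=; apply: filterS nN => p Np Cp.
apply: (@cvg_tail_localize _ _ _ (surface_measure D) G (phi @` (collar B eps `&` N))
  (W A F lambda) (Phi F H rho) lambda _ mu (mu + delta) z) => //.
- exact: (measurable_collar_image phi_collar).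
- exact: ltW.
- by rewrite ltrDl.
pose g y := Num.sqrt (\det (gram psi y)).
have g_ge0 y : 0 <= g y by exact: sqrtr_ge0.
have mg : measurable_fun S g by exact: (measurable_sqrt_gram lp).
have gG y : S y -> g y <= G0 + 1 by move=> /rb[].
have cg : {for 0, continuous g} by exact: cgram.
pose w (p : 'rV[R]_k * R) := omega (psi p.1, p.2) * g p.1.
pose P (p : 'rV[R]_k * R) := Phi F H rho (phi (psi p.1, p.2)).
have sigma_fin := riemannian_measure_finite B_compact B_smooth sigmaB_riem.
have sub : (B `&` O) `*` (`]0, e[ : set R) `<=` B `*` (`[0, eps] : set R).
  move=> [t v] [/= [Bt _]]; rewrite !in_itv/= => /andP[v0 ve]; split => //=.
  by rewrite (ltW v0) (ltW (lt_le_trans ve eeps)).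
have mXT : measurable ((B `&` O) `*` (`]0, e[ : set R)).
  by apply: measurableX => //; exact: measurable_itv.
have momega : measurable_fun ((B `&` O) `*` (`]0, e[ : set R)) omega.
  apply: (measurable_funS _ sub measurable_omega).
  by apply: measurableX => //; exact: measurable_itv.
have mPhiphi : measurable_fun ((B `&` O) `*` (`]0, e[ : set R)) (Phi F H rho \o phi).
  apply: (measurable_funS _ _ (measurable_collar_Phi eeps)).
    by apply: measurableX => //; exact: measurable_itv.
  by move=> p [[Bp _] p2].
have XT p : (S `*` `]0, e[) p -> ((B `&` O) `*` `]0, e[) (psi p.1, p.2).
  move=> [Sp p2]; split => //.
  by have : (psi @` S) (psi p.1) by [exists p.1]; rewrite psiO.
have mchart := measurable_chart_setX (e := e) lp mS SU.
have P_gt0 p : ((B `&` O) `*` `]0, e[) p -> 0 < Phi F H rho (phi p).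
  move=> [[Bp Op] /=]; rewrite in_itv/= => /andP[p0 pe]; apply: Phi0.
  apply: (posdirs_collar phi_collar) => //.
  by split => //=; rewrite in_itv/= (ltW p0) (lt_le_trans pe).
have omega0 p : ((B `&` O) `*` `]0, e[) p -> 0 <= omega p.
  case: p => t v [/= [Bt _]]; rewrite in_itv/= => /andP[v0 ve].
  by apply: omega_ge0 => //; rewrite v0 (lt_le_trans ve).
have chartE n : (\int[surface_measure D]_(t in G `&` phi @` (collar B eps `&` N))
    (W A F lambda t * igamma lambda (z n * Phi F H rho t))%:E =
    \int[lebesgue_rV k \x leb]_(p in S `*` `]0%R, e[)
      (w p * igamma lambda (z n * P p))%:E)%E.
  rewrite collar_rect//.
  apply: etrans; first apply: (@ge0_integral_chart _ _ _ B sigmaB U S psi (B `&` O) e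
      sigma_fin sigmaB_riem lp mS SU mT psiO
      (fun p => omega p * igamma lambda (z n * (Phi F H rho \o phi) p))).
  - apply: measurable_funM => //.
    apply: measurable_igamma_comp => // [|p Xp]; first exact: measurable_funM.
    by rewrite mulr_gt0// P_gt0.
  - by move=> p Xp; rewrite mulr_ge0 ?igamma_ge0 ?omega0.
  rewrite -/(g _); apply: eq_integral => p _; congr EFin.
  by rewrite /w /P mulrAC.
have g0E : g 0 = G0 by [].
clearbody g.
rewrite (_ : (fun n => _) = fun n => z n `^ (k%:R / 2 + 1 + (1 - lambda)) * expR (mu * z n) *
    fine (\int[lebesgue_rV k \x leb]_(p in S `*` `]0%R, e[)
      (w p * igamma lambda (z n * P p))%:E)%E); last first.
  by apply/funext => n; rewrite chartE.
(* [G0] is the Riemannian density at the centre; dividing it by sqrt (det Q) gives the inverse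
   square root of [hessian_det]. *)
have limE : (2 * pi) `^ (k%:R / 2) * (omega (t0, 0) * mu `^ (lambda - 1) /
     (c1 t0 * Num.sqrt (hessian_det k B c0 t0))) =
   omega (t0, 0) * G0 * mu `^ (lambda - 1) *
     ((2 * pi) `^ (k%:R / 2) / Num.sqrt (\det Q) / c1 t0).
  rewrite detE sqrtrM ?(ltW detQ)// sqrtrV ?(ltW gram0)// -/G0.
  by field; rewrite !gt_eqF ?sqrtr_gt0.
rewrite limE.
have [L0 omega_le] := omega_bounded.
have L_ge0 : 0 <= Num.max 0 L0 by rewrite le_max lexx.
have near_scaled (x : nat -> R) (y : 'rV[R]_k) (s : R) : (forall n, 1 <= x n) ->
    x n @[n --> \oo] --> +oo -> 0 < s ->
    [/\ x n `^ (- 2^-1) *: y @[n --> \oo] --> (0 : 'rV[R]_k),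
        s / x n @[n --> \oo] --> (0 : R),
        \forall n \near \oo, S (x n `^ (- 2^-1) *: y),
        \forall n \near \oo, 0 < s / x n < e &
        (forall n, 0 < s / x n)].
  move=> x1 xoo s0; have x0 n : 0 < x n by exact: lt_le_trans (x1 n).
  have h1 : x n `^ (- 2^-1) *: y @[n --> \oo] --> (0 : 'rV[R]_k).
    rewrite -[X in _ --> X](scale0r y); apply: cvgZl.
    by apply: cvg_powRN_pinfty => //; rewrite invr_gt0.
  have h2 : s / x n @[n --> \oo] --> (0 : R).
    rewrite -[X in _ --> X](mulr0 s); apply: cvgMr.
    have := cvg_powRN_pinfty ltr01 x1 xoo; apply: cvg_trans.
    by apply: near_eq_cvg; apply: nearW => n; rewrite powR_inv1// ltW.
  have h5 n : 0 < s / x n by rewrite divr_gt0.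
  split => //; first by move/cvg_ballP : h1 => /(_ r r0).
  have : \forall n \near \oo, s / x n < e by exact: cvgr_lt h2 _ _.
  by apply: filterS => n ->; rewrite h5.
have cvg_psi (x : nat -> R) (y : 'rV[R]_k) :
    x n `^ (- 2^-1) *: y @[n --> \oo] --> (0 : 'rV[R]_k) ->
    psi (x n `^ (- 2^-1) *: y) @[n --> \oo] --> t0.
  by move=> h; rewrite -psi0; exact: (@cvg_comp _ _ _ _ psi _ _ _ h cpsi).
(* The bound mu + 1 + (c1 t0 + 1) + K adds up the local bounds of c0, of c1 and of the remainder for
   u <= 1. *)
apply: (@laplace_asymptotics R k r e mu (c1 t0 / 2) (c1 t0)
  (omega (t0, 0) * G0) (Num.max 0 L0 * (G0 + 1)) (mu + 1 + (c1 t0 + 1) + K) lambda Q w P) => //.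
- by rewrite divr_gt0.
- by rewrite mulr_ge0// addr_ge0// ltW.
- by rewrite mulr_ge0 ?omega0_ge0// ltW.
- apply: measurable_funM.
    by apply: (@measurable_comp _ _ _ _ _ _ ((B `&` O) `*` (`]0, e[ : set R)) omega) => //;
      move=> _ [p Xp <-]; exact: XT.
  apply: (@measurable_comp _ _ _ _ _ _ S g) => //; first by move=> _ [p [Sp _] <-].
  exact: measurable_funTS.
- by apply: (@measurable_comp _ _ _ _ _ _ ((B `&` O) `*` (`]0, e[ : set R)) (Phi F H rho \o phi)) => //;
    move=> _ [p Xp <-]; exact: XT.
- by move=> p Xp; rewrite mulr_ge0// omega0//; exact: XT.
- move=> p Xp; apply: ler_pM => //; first by apply: omega0; exact: XT.
    rewrite le_max; apply/orP; right; rewrite (le_trans (ler_norm _))//.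
    by apply: omega_le; apply: sub; exact: XT.
  by apply: gG; case: Xp.
- move=> [y u] [/= Sy]; rewrite in_itv/= => u0e; rewrite /P/=.
  have [q qK ->] := PhiE y u Sy u0e; case/andP: u0e => u0 ue.
  have [_ /andP[c1y _] _ _ yr] := rb y Sy.
  have [_ fy] := tay1 _ y (ltW yr) (@box_norm _ _ y).
  rewrite fmu in fy; have aQy := aQ y.
  have quK : K * u ^+ 2 <= u * (c1 t0 / 4).
    by rewrite expr2 mulrCA ler_pM2l// (le_trans _ eK)// ler_wpM2l// ltW.
  have uc : u * (3 / 4 * c1 t0) <= u * c1 (psi y) by rewrite ler_pM2l.
  have fy' : quadratic Q y / 4 <= f y - mu.
    move: fy; rewrite ler_norml => /andP[+ _]; rewrite mulrAC; move: aQy; rewrite -/Q.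
    set A' := a * _; set B' := quadratic Q y; lra.
  move: qK; rewrite ler_norml => /andP[q1 _].
  move: quK uc fy' q1; set u1 := K * _; set u2 := u * _; set u3 := u * c1 _.
  rewrite (_ : u * (3 / 4 * c1 t0) = 3 * u2); last by rewrite /u2; field.
  rewrite (_ : c1 t0 / 2 * u = 2 * u2); last by rewrite /u2; field.
  lra.
- move=> [y u] [/= Sy]; rewrite in_itv/= => u0e; rewrite /P/=.
  have [q qK ->] := PhiE y u Sy u0e; case/andP: u0e => u0 ue.
  have [_ /andP[c1y c1y'] [fy _] _ _] := rb y Sy.
  have u1 : u <= 1 by rewrite ltW// (lt_le_trans ue).
  rewrite lerD ?lerD//.
    have c1p : 0 <= c1 (psi y) by rewrite (le_trans _ c1y)// mulr_ge0// ltW.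
    by rewrite (le_trans _ c1y')// ler_piMl.
  by rewrite (le_trans (ler_norm _))// (le_trans qK)// ler_piMr// exprn_ile1// ltW.
- move=> x y s x1 xoo s0; have [h1 h2 h3 h4 h5] := near_scaled x y s x1 xoo s0.
  rewrite -g0E; apply: cvgM; last exact: (@cvg_comp _ _ _ _ g _ _ _ h1 cg).
  apply: omega_cvg => //; last exact: cvg_psi.
  by apply: filterS h3 => n Sn; apply: BU; exact: SU.
- move=> x y s x1 xoo s0; have [h1 h2 h3 h4 h5] := near_scaled x y s x1 xoo s0.
  have x0 n : 0 < x n by exact: lt_le_trans (x1 n).
  pose yn n := x n `^ (- 2^-1) *: y.
  (* The rescaled excess splits into the part of c0, which tends to the quadratic form, the part of
     c1, which tends to the linear term, and an error [En] of order 1 / x n. *)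
  pose An n := x n * (f (yn n) - mu); pose Bn n := s * c1 (psi (yn n)).
  pose En n := x n * (P (yn n, s / x n) - mu) - An n - Bn n.
  have csqr n : x n * (x n `^ (- 2^-1)) ^+ 2 = 1.
    rewrite powRN exprVn powR12_sqrt ?(ltW (x0 n))// sqr_sqrtr ?(ltW (x0 n))//.
    by rewrite mulfV// gt_eqF.
  have cA : An n @[n --> \oo] --> quadratic Q y / 2.
    (* The Taylor error at the scaled point is multiplied by x n, which cancels the squared scale
       and leaves the tolerance times |y| ^ 2, hence at most b. *)
    apply/cvgrPdistC_le => b b0; have [|rb' rb'0 tayb] := tay (b / (`|y| ^+ 2 + 1)).
      by rewrite divr_gt0// ltr_wpDl// sqr_ge0.
    have : \forall n \near \oo, x n `^ (- 2^-1) * `|y| <= rb'.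
      have cy : x n `^ (- 2^-1) * `|y| @[n --> \oo] --> (0 : R).
        rewrite -[X in _ --> X](mul0r `|y|); apply: cvgMl.
        by apply: cvg_powRN_pinfty => //; rewrite invr_gt0.
      exact: cvgr_le cy _ _.
    apply: filterS => n ny; have [|_ fn] := tayb _ (yn n) ny.
      by move=> i; rewrite mxE normrM ger0_norm ?powR_ge0// ler_wpM2l ?powR_ge0//; exact: box_norm.
    have -> : An n - quadratic Q y / 2 = x n * (f (yn n) - mu - quadratic Q (yn n) / 2).
      rewrite [RHS]mulrBr /An; congr (_ - _).
      have q1 := csqr n; rewrite /yn quadraticZ.
      move: q1; set X := x n `^ _; set q := quadratic Q y => q1.
      transitivity (x n * X ^+ 2 * (q / 2)); first by rewrite q1 mul1r.
      by ring.
    rewrite normrM gtr0_norm//; apply: le_trans (_ : x n * (b / (`|y| ^+ 2 + 1) *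
      (x n `^ (- 2^-1) * `|y|) ^+ 2) <= _); first by rewrite ler_pM2l.
    rewrite exprMn [leLHS](_ : _ = (x n * (x n `^ (- 2^-1)) ^+ 2) *
      (b / (`|y| ^+ 2 + 1) * `|y| ^+ 2)); last by ring.
    rewrite csqr mul1r mulrAC ler_pdivrMr ?ltr_wpDl ?sqr_ge0//.
    by rewrite ler_pM2l// lerDl.
  have cB : Bn n @[n --> \oo] --> c1 t0 * s.
    rewrite mulrC; apply: cvgMr.
    apply: (@cvg_comp _ _ _ yn (c1 \o psi) _ (within U (nbhs (0 : 'rV[R]_k)))) => //.
    by apply: cvg_to_within => //; apply: filterS h3 => n; exact: SU.
  have cE : En n @[n --> \oo] --> (0 : R).
    apply: norm_cvg0; apply: (@squeeze_cvgr _ _ _ _ (fun=> 0) (fun n => K * s * (s / x n))).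
    + apply: filterS2 h3 h4 => n Sn n0; rewrite normr_ge0/=.
      have [q qK Pq] := PhiE _ _ Sn n0.
      have -> : En n = x n * q.
        rewrite /En /An /Bn /P/= Pq; field; by rewrite gt_eqF.
      rewrite normrM gtr0_norm//; apply: le_trans (_ : x n * (K * (s / x n) ^+ 2) <= _).
        by rewrite ler_pM2l.
      by rewrite le_eqVlt; apply/orP; left; apply/eqP; field; rewrite gt_eqF.
    + exact: cvg_cst.
    + by rewrite -[X in _ --> X](mulr0 (K * s)); exact: cvgMr.
  rewrite -[X in _ --> X]addr0.
  apply: cvg_trans (_ : An n + Bn n + En n @[n --> \oo] --> _).
    by apply: near_eq_cvg; apply: nearW => n; rewrite /En; ring.
  by apply: cvgD => //; exact: cvgD.
Unshelve. all: end_near. Qed.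

End frontier.

(** * The asymptotics of the tail *)

Lemma cvg_powR_pinfty (R : realType) (p : R) : 0 < p -> x `^ p @[x --> +oo] --> +oo.
Proof.
move=> p0; apply/cvgryPge => a; near=> x.
have m0 : 0 < Num.max 1 a by rewrite lt_max ltr01.
have xm : Num.max 1 a `^ p^-1 <= x by near: x; apply: nbhs_pinfty_ge; exact: num_real.
have x0 : 0 <= x by rewrite (le_trans _ xm)// powR_ge0.
apply: (@le_trans _ _ (Num.max 1 a)); first by rewrite le_max lexx orbT.
rewrite -[leLHS](@powRr1 _ (Num.max 1 a)) ?(ltW m0)// -(mulVf (lt0r_neq0 p0)) powRrM.
by rewrite ge0_ler_powR ?nnegrE ?powR_ge0 ?(ltW p0).
Unshelve. all: end_near. Qed.

Theorem proposition10p3 (R : realType) (D : nat) (D_ge2 : (2 <= D)%N)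
    (d : measure_display) (Omega : measurableType d) (P : probability Omega R)
    (eta : {RV P >-> 'rV[R]_D})
    (A F H : 'rV[R]_D -> R) (betaA betaF alphaH : R)
    (betaF_gt0 : 0 < betaF) (alphaH_gt0 : 0 < alphaH)
    (A_ge0 : forall v, 0 <= A v) (F_ge0 : forall v, 0 <= F v)
    (A_hom : pos_homogeneous betaA A)
    (F_hom : pos_homogeneous betaF F)
    (H_hom : pos_homogeneous alphaH H)
    (A_meas : measurable_fun (sphere D) A)
    (F_meas : measurable_fun (sphere D) F)
    (H_meas : measurable_fun (sphere D) H)
    (eta_density : has_density eta (fun v => A v * expR (- F v))) :
  let lambda := (D%:R + betaA) / betaF in
  let rho := betaF / alphaH in
  let z (x : R) := x `^ rho in
  let G := posdirs H in
  let tail (x : R) := fine (P [set w | x < H (eta w)]) in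
  forall (lambda_gt0 : 0 < lambda)
    (F_gt0 : forall theta, G theta -> 0 < F theta)
    (W_int : (surface_measure D).-integrable G (EFin \o W A F lambda))
    (* the frontier *)
    (B : set 'rV[R]_D)
    (B_comp : is_component B (sphere_boundary G))
    (B_compact : compact B)
    (B_smooth : submanifold D.-2 B)
    (H_smooth : exists O : set 'rV[R]_D, [/\ open O, B `<=` O &
       Ck_on_submanifold D.-1 2 (sphere D `&` O) H])
    (dH_neq0 : forall t, B t -> differential D.-1 (sphere D) H t != 0)
    (sigmaB : {measure set 'rV[R]_D -> \bar R})
    (sigmaB_riem : is_riemannian_measure D.-2 B sigmaB)
    (* the collar and the effective density *)
    (eps : R) (eps_gt0 : 0 < eps)
    (phi : 'rV[R]_D * R -> 'rV[R]_D)
    (phi_collar : is_collar_map G B H eps phi)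
    (J : 'rV[R]_D * R -> R)
    (J_jacobian : is_collar_jacobian B sigmaB eps phi J)
    (omega : 'rV[R]_D * R -> R)
    (omega_cont : {within B `*` `[0, eps], continuous omega})
    (omega_bounded : exists K : R, forall p : 'rV_D * R, (B `*` `[0, eps]) p -> `|omega p| <= K)
    (omegaE : forall (t : 'rV_D) (u : R), B t -> 0 < u < eps ->
       omega (t, u) = W A F lambda (phi (t, u)) * J (t, u)),
  (* (i) *)
  (forall (m : nat) (zeta : R) (c : 'rV[R]_D -> R)
      (Rfrac : 'rV[R]_D * R -> R),
    rho = m%:R + zeta -> 0 < zeta < 1 ->
    (forall (t : 'rV_D) (u : R), B t -> 0 <= u < eps ->
       F (phi (t, u)) = u ^+ m.+1 * (c t + u * Rfrac (t, u))) ->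
    0 < inf (c @` B) ->
    {within B, continuous c} ->
    (exists K : R, forall p : 'rV_D * R, collar B eps p -> `|Rfrac p| <= K) ->
    (forall e : R, 0 < e <= eps -> exists2 delta : R, 0 < delta &
       forall theta, (G `\` phi @` collar B e) theta ->
         delta <= Phi F H rho theta) ->
    let Cfrac := Gamma (lambda + 1 / (1 - zeta)) / betaF *
      \int[sigmaB]_(t in B) (omega (t, 0) * c t `^ (- (1 / (1 - zeta)))) in
    (tail x - Cfrac * z x `^ (- (1 / (1 - zeta))))
       / z x `^ (- (1 / (1 - zeta))) @[x --> +oo] --> (0 : R) /\
    ((exists2 t, B t & omega (t, 0) != 0) ->
      0 < Cfrac /\
      tail x / (Cfrac * x `^ (- (betaF / (alphaH * (1 - zeta)))))
        @[x --> +oo] --> (1 : R)))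
  /\
  (* (ii) *)
  (forall (m : nat) (c0 c1 : 'rV[R]_D -> R) (t0 : 'rV[R]_D),
    rho = m%:R -> (1 <= m)%N ->
    (exists K : R, forall (t : 'rV_D) (u : R), B t -> 0 <= u < eps ->
       exists2 r : R, `|r| <= K * u ^+ 2 &
         F (phi (t, u)) = u ^+ m * (c0 t + u * c1 t + r)) ->
    Ck_on_submanifold D.-2 2 B c0 ->
    {within B, continuous c1} ->
    B t0 ->
    (forall t, B t -> t != t0 -> c0 t0 < c0 t) ->
    let mu := c0 t0 in
    0 < mu ->
    gradient D.-2 B c0 t0 = 0 ->
    hessian_posdef D.-2 B c0 t0 ->
    0 < c1 t0 ->
    (exists2 V0 : set ('rV[R]_D * R), within (collar B eps) (nbhs (t0, 0)) V0 &
       forall V : set ('rV[R]_D * R), V `<=` V0 -> V `<=` collar B eps ->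
         within (collar B eps) (nbhs (t0, 0)) V ->
         exists2 delta : R, 0 < delta &
           forall theta, (G `\` phi @` V) theta ->
             mu + delta <= Phi F H rho theta) ->
    0 < omega (t0, 0) ->
    let Cinteger := (2 * pi) `^ ((D%:R - 2) / 2) / betaF *
      (omega (t0, 0) * mu `^ (lambda - 1) /
       (c1 t0 * Num.sqrt (hessian_det D.-2 B c0 t0))) in
    tail x / (Cinteger * z x `^ (lambda - 1 - D%:R / 2) *
              expR (- mu * z x)) @[x --> +oo] --> (1 : R)).
Proof.
move=> lambda rho z G tail lambda_gt0 F_gt0 W_int B B_comp B_compact B_smooth
  H_smooth dH_neq0 sigmaB sigmaB_riem eps eps_gt0 phi phi_collar J J_jacobian
  omega omega_cont omega_bounded omegaE.
have D_gt0 : (0 < D)%N by exact: leq_trans D_ge2.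
have rho_gt0 : 0 < rho by rewrite divr_gt0.
have mG : measurable G := measurable_posdirs H_meas.
have mW : measurable_fun G (W A F lambda) by exact: measurable_W.
have mPhi : measurable_fun G (Phi F H rho) by exact: measurable_Phi.
have Phi0 t : G t -> 0 < Phi F H rho t by exact: Phi_gt0.
have tailE x : 0 < x -> tail x = betaF^-1 * laplace_integral A F H rho lambda (z x).
  move=> x0; rewrite /tail (tail_formula D_gt0 betaF_gt0 alphaH_gt0 A_ge0 A_hom F_hom
    H_hom A_meas F_meas H_meas eta_density lambda_gt0 F_gt0 x0).
  by rewrite fine_EFinM ?invr_gt0.
have z_gt0 x : 0 < x -> 0 < z x by exact: powR_gt0.
have zoo : z x @[x --> +oo] --> +oo by exact: cvg_powR_pinfty.
split.
  move=> m zeta c Rfrac rhoE zeta01 FE cinf cc RK Phid Cfrac.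
  have /andP[zeta0 zeta1] := zeta01.
  pose k := 1 / (1 - zeta); have k0 : 0 < k by rewrite divr_gt0// subr_gt0.
  pose I := \int[sigmaB]_(t in B) (omega (t, 0) * c t `^ (- k)).
  have lim : z x `^ k * laplace_integral A F H rho lambda (z x) @[x --> +oo] -->
      Gamma (lambda + k) * I.
    apply: (@cvg_comp _ _ _ z (fun y => y `^ k * laplace_integral A F H rho lambda y) _ _ _ zoo).
    apply: cvg_pinfty_ge1 => u u1 uoo.
    exact: (fractional_frontier A_ge0 mG mW mPhi Phi0 lambda_gt0 W_int B_compact B_smooth
      sigmaB_riem eps_gt0 phi_collar J_jacobian omega_cont omega_bounded omegaE
      rhoE zeta01 FE cinf cc RK Phid u1 uoo).
  have limtail : tail x * z x `^ k @[x --> +oo] --> Cfrac.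
    rewrite (_ : Cfrac = betaF^-1 * (Gamma (lambda + k) * I)); last first.
      by rewrite /Cfrac -/k -/I mulrA [betaF^-1 * _]mulrC.
    apply: cvg_trans (_ : betaF^-1 * (z x `^ k * laplace_integral A F H rho lambda (z x))
      @[x --> +oo] --> _); last exact: cvgMr.
    apply: near_eq_cvg; near=> x.
    rewrite tailE; last by near: x; exact: nbhs_pinfty_gt.
    by ring.
  split.
    apply: cvg_trans (_ : tail x * z x `^ k - Cfrac @[x --> +oo] --> _).
      apply: near_eq_cvg; near=> x.
      have x0 : 0 < x by near: x; exact: nbhs_pinfty_gt.
      rewrite -/k powRN invrK mulrBl mulfVK// gt_eqF// powR_gt0//.
      exact: z_gt0.
    by rewrite -(subrr Cfrac); apply: cvgB => //; exact: cvg_cst.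
  move=> [t Bt ot].
  have Cfrac_gt0 : 0 < Cfrac.
    rewrite mulr_gt0 ?divr_gt0 ?Gamma_gt0 ?addr_gt0//.
    apply: (fractional_constant_gt0 A_ge0 B_compact B_smooth sigmaB_riem eps_gt0
      J_jacobian omega_cont omega_bounded omegaE cinf cc _ Bt ot).
    by rewrite oppr_le0 ltW.
  split => //; apply: cvg_trans (_ : tail x * z x `^ k / Cfrac @[x --> +oo] --> _).
    apply: near_eq_cvg; near=> x.
    have x0 : 0 < x by near: x; exact: nbhs_pinfty_gt.
    rewrite (_ : betaF / (alphaH * (1 - zeta)) = rho * k); last first.
      by rewrite /rho /k; field; rewrite !gt_eqF// subr_gt0.
    have -> : x `^ (- (rho * k)) = (z x `^ k)^-1 by rewrite powRN powRrM.
    by rewrite (@invfM _ Cfrac) invrK mulrA mulrAC.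
  by rewrite -(@mulfV _ Cfrac) ?gt_eqF//; exact: cvgMl.
move=> m c0 c1 t0 rhoE m_ge1 FE Cc0 cc1 Bt0 c0min mu mu_gt0 grad0 hpos c1_gt0 V0 ot0 Cint.
have [hdet_gt0 lim_seq] := integer_frontier A_ge0 mG mW mPhi Phi0 lambda_gt0 W_int B_compact
  B_smooth sigmaB_riem eps_gt0 phi_collar J_jacobian omega_cont omega_bounded omegaE
  rhoE FE Cc0 cc1 Bt0 mu_gt0 grad0 hpos c1_gt0 V0.
(* The dimension [D.-2] of B is a truncated subtraction; D >= 2 makes it exact. *)
have DE : D%:R = D.-2%:R + 2 :> R.
  by rewrite -natrD; congr _%:R; case: (D) D_ge2 => [|[|n]]//; rewrite addn2.
pose p := D.-2%:R / 2 + 1 + (1 - lambda).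
have pE : lambda - 1 - D%:R / 2 = - p by rewrite /p DE; field.
pose L := (2 * pi) `^ (D.-2%:R / 2) * (omega (t0, 0) * mu `^ (lambda - 1) /
     (c1 t0 * Num.sqrt (hessian_det D.-2 B c0 t0))).
(* The factor betaF^-1 of the tail formula is the only difference between the constant and the limit
   [L]. *)
have CintE : Cint = betaF^-1 * L.
  rewrite /Cint /L DE addrK; ring.
have Cint_gt0 : 0 < Cint.
  by rewrite CintE !mulr_gt0 ?invr_gt0 ?mulr_gt0 ?powR_gt0 ?mulr_gt0 ?pi_gt0 ?sqrtr_gt0.
have lim : z x `^ p * expR (mu * z x) * laplace_integral A F H rho lambda (z x)
    @[x --> +oo] --> L.
  apply: (@cvg_comp _ _ _ z
    (fun y => y `^ p * expR (mu * y) * laplace_integral A F H rho lambda y) _ _ _ zoo).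
  by apply: cvg_pinfty_ge1 => u u1 uoo; exact: lim_seq.
apply: cvg_trans (_ : Cint^-1 * (betaF^-1 * (z x `^ p * expR (mu * z x) *
    laplace_integral A F H rho lambda (z x))) @[x --> +oo] --> _); last first.
  rewrite [X in _ --> X](_ : 1 = Cint^-1 * (betaF^-1 * L)).
    by apply: cvgMr; exact: cvgMr.
  by rewrite -CintE mulVf// gt_eqF.
apply: near_eq_cvg; near=> x.
have x0 : 0 < x by near: x; exact: nbhs_pinfty_gt.
rewrite tailE// pE powRN mulNr expRN.
move: Cint_gt0 (powR_gt0 p (z_gt0 _ x0)) (expR_gt0 (mu * z x)).
move: (Cint) (z x `^ p) (expR _) (laplace_integral _ _ _ _ _ _) => C a b l C0 a0 b0.
by field; rewrite !gt_eqF.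
Unshelve. all: end_near. Qed.
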